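(* Let $R$ be a unital ring and let $S$ be a two-sided Ore set of regular elements of $R$. Then the sequence of groups $$0\to\mathcal{U}(\mathcal{Z}(R))\to\mathcal{U}(\mathcal{Z}(RS^{-1}))\to\mathrm{Pic}(R\mid RS^{-1})\to\mathrm{Pic}(R,\mathcal{D}^S_l,\mathcal{D}^S_r)\to\mathrm{Pic}(RS^{-1})$$ is exact, where $\mathrm{Pic}(R\mid RS^{-1})$ is the set of all the $R$-$R$-subbimodules $M$ of $RS^{-1}$ such that $MM^{-1}=M^{-1}M=R$, and where the maps are, in order, the inclusion, $x\mapsto xR$, $M\mapsto[M]$, and $[M]\mapsto[M\otimes_RRS^{-1}]=[RS^{-1}\otimes_RM]$.
   Context: All rings are associative and unital and all modules are unitary. $\mathcal{U}(\mathcal{Z}(A))$ is the group of central invertible elements of a ring $A$. $\mathrm{Pic}(A)$ is the group, under $\otimes_A$, of isomorphism classes $[M]$ of invertible $A$-$A$-bimodules ($M$ is invertible if $M\otimes_AN\cong A\cong N\otimes_AM$ as bimodules for some $A$-$A$-bimodule $N$). $S$ is multiplicatively closed, consists of non-zero-divisors, and satisfies the left and right Ore conditions; $RS^{-1}=S^{-1}R$ is the ring of fractions, which contains $R$. $\mathcal{D}^S_r$ (resp. $\mathcal{D}^S_l$) is the Gabriel filter of right (resp. left) ideals of $R$ that have nonempty intersection with $S$. A right $R$-module is $\mathcal{D}^S_r$-torsion if each of its elements is annihilated by some member of $\mathcal{D}^S_r$, and $\mathcal{D}^S_r$-torsion-free if $0$ is the only element annihilated by a member; similarly for left modules and $\mathcal{D}^S_l$.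 For an invertible $R$-$R$-bimodule $M$ let $T_M=-\otimes_RM$ on $\mathrm{Mod}\text{-}R$ and $U_M=M\otimes_R-$ on $R\text{-}\mathrm{Mod}$. $T^\sharp_M(\mathcal{D}^S_r)=\mathcal{D}^S_r$ means that $T_M$ maps the class of $\mathcal{D}^S_r$-torsion modules onto itself and the class of $\mathcal{D}^S_r$-torsion-free modules onto itself (up to isomorphism); $U^\sharp_M(\mathcal{D}^S_l)=\mathcal{D}^S_l$ is the analogous condition on left modules. $\mathrm{Pic}(R,\mathcal{D}^S_l,\mathcal{D}^S_r)$ is the group, under $\otimes_R$, of isomorphism classes $[M]$ of invertible $R$-$R$-bimodules with $T^\sharp_M(\mathcal{D}^S_r)=\mathcal{D}^S_r$ and $U^\sharp_M(\mathcal{D}^S_l)=\mathcal{D}^S_l$. For an $R$-$R$-subbimodule $M$ of $RS^{-1}$, $M^{-1}=\{n\in RS^{-1}: nM\subseteq R,\ Mn\subseteq R\}$; products of subbimodules are sets of finite sums of products, and $\mathrm{Pic}(R\mid RS^{-1})$ is a group under this product with unit $R$. The last map: for $[M]\in\mathrm{Pic}(R,\mathcal{D}^S_l,\mathcal{D}^S_r)$, the two-sided localization $Q_{\mathcal{D}^S_l,\mathcal{D}^S_r}(M)$ is the set of classes of compatible pairs $(f,g)$, where $f:D\to{}_RM$ is a left $R$-homomorphism (written on the right) with $D\in\mathcal{D}^S_l$, $g:H\to M_R$ is a right $R$-homomorphism with $H\in\mathcal{D}^S_r$, and $x\,g(y)=(x)f\,y$ for all $x\in D$, $y\in H$; two pairs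 are equivalent if both components agree on smaller members of the filters. For $M=R$ this is a ring (product: class of $(x\mapsto((x)f_1)f_2,\ y\mapsto g_1(g_2(y)))$ on the natural domains) which is identified with $RS^{-1}$. $Q_{\mathcal{D}^S_l,\mathcal{D}^S_r}(M)$ is an $RS^{-1}$-$RS^{-1}$-bimodule: for $m=[(f,g)]$, $f:D\to M$, $g:H\to M$, and $q=[(f_1,g_1)]$, $f_1:I\to R$, $g_1:J\to R$, $q\cdot m$ is the class of $(x\mapsto((x)f_1)f,\ y\mapsto\sum_ig_1(z_i)m_i)$ on $\{x\in I:(x)f_1\in D\}$ and $g^{-1}(JM)$, where $g(y)=\sum_iz_im_i$ with $z_i\in J$, $m_i\in M$; the right action is symmetric. Multiplication gives isomorphisms $M\otimes_RRS^{-1}\cong Q_{\mathcal{D}^S_l,\mathcal{D}^S_r}(M)\cong RS^{-1}\otimes_RM$, and the last map sends $[M]$ to the class of this $RS^{-1}$-$RS^{-1}$-bimodule. *)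

(* Defs.v *)
From HB Require Import structures.
From mathcomp Require Import all_boot all_algebra.
From mathcomp Require Import boolp classical_sets.

Set Implicit Arguments.
Unset Strict Implicit.
Unset Printing Implicit Defensive.

Import GRing.Theory.
Local Open Scope ring_scope.
Local Open Scope quotient_scope.
Local Open Scope classical_set_scope.

(** Left modules are MathComp's [lmodType].  A bimodule carries a left and a
    right structure at once, so right modules cannot be encoded as [lmodType]s
    over the converse ring. *)

HB.mixin Record Zmodule_isRmodule (A : pzRingType) V of GRing.Zmodule V := {
  rscale : V -> A -> V;
  rscalerA : forall v a b, rscale (rscale v a) b = rscale v (a * b);
  rscaler1 : forall v, rscale v 1 = v;
  rscalerDl : forall a, {morph rscale^~ a : u v / u + v};
  rscalerDr : forall v, {morph rscale v : a b / a + b}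
}.

#[short(type="rmodType")]
HB.structure Definition Rmodule (A : pzRingType) :=
  {V of GRing.Zmodule V & Zmodule_isRmodule A V}.

Notation "v :*r a" := (rscale v a)
  (at level 40, left associativity, format "v  :*r  a") : ring_scope.

HB.mixin Record Lmodule_Rmodule_isBimodule (A B : pzRingType) V
    of GRing.Lmodule A V & Rmodule B V := {
  scale_rscale : forall (a : A) (v : V) (b : B), (a *: v) :*r b = a *: (v :*r b)
}.

#[short(type="bimodType")]
HB.structure Definition Bimodule (A B : pzRingType) :=
  {V of GRing.Lmodule A V & Rmodule B V & Lmodule_Rmodule_isBimodule A B V}.

Section RmoduleTheory.
Variables (A : pzRingType) (V : rmodType A).
Implicit Types (v : V) (a : A).

Lemma rscale0r a : 0 :*r a = 0 :> V.
Proof. by apply: (addIr (0 :*r a)); rewrite -rscalerDl !add0r. Qed.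

Lemma rscaler0 v : v :*r (0 : A) = 0.
Proof. by apply: (addIr (v :*r (0 : A))); rewrite -rscalerDr !add0r. Qed.

Lemma rscaleNr v a : (- v) :*r a = - (v :*r a).
Proof. by apply/eqP; rewrite -addr_eq0 -rscalerDl addNr rscale0r. Qed.

End RmoduleTheory.

Definition lmod_hom (A : pzRingType) (M N : lmodType A) (f : M -> N) : Prop :=
  {morph f : u v / u + v} /\ forall a u, f (a *: u) = a *: f u.

Definition rmod_hom (A : pzRingType) (M N : rmodType A) (f : M -> N) : Prop :=
  {morph f : u v / u + v} /\ forall u a, f (u :*r a) = f u :*r a.

Definition lmod_iso (A : pzRingType) (M N : lmodType A) : Prop :=
  exists f : M -> N, lmod_hom f /\ bijective f.

Definition rmod_iso (A : pzRingType) (M N : rmodType A) : Prop :=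
  exists f : M -> N, rmod_hom f /\ bijective f.

Definition bimod_isom (A B : pzRingType) (M N : bimodType A B) (f : M -> N) :
    Prop :=
  [/\ lmod_hom f, rmod_hom f & bijective f].

Definition bimod_iso (A B : pzRingType) (M N : bimodType A B) : Prop :=
  exists f : M -> N, bimod_isom f.

HB.instance Definition _ (A : pzRingType) :=
  Zmodule_isRmodule.Build A A^o (fun v a b => esym (mulrA v a b)) (@mulr1 A)
    (fun a u v => mulrDl u v a) (fun v a b => mulrDr v a b).

HB.instance Definition _ (A : pzRingType) :=
  Lmodule_Rmodule_isBimodule.Build A A A^o (fun a v b => esym (mulrA a v b)).

Definition resbimod (A A' B B' : pzRingType) (f : {rmorphism A -> A'})
  (g : {rmorphism B -> B'}) (M : bimodType A' B') : Type := M.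

Section Restriction.
Variables (A A' B B' : pzRingType).
Variables (f : {rmorphism A -> A'}) (g : {rmorphism B -> B'}).
Variable M : bimodType A' B'.

HB.instance Definition _ := GRing.Zmodule.on (resbimod f g M).

Let lres (a : A) (m : resbimod f g M) : resbimod f g M := f a *: (m : M).
Let rres (m : resbimod f g M) (b : B) : resbimod f g M := (m : M) :*r g b.

Fact lresA a b m : lres a (lres b m) = lres (a * b) m.
Proof. by rewrite /lres scalerA rmorphM. Qed.
Fact lres1 : left_id 1 lres.
Proof. by move=> m; rewrite /lres rmorph1 scale1r. Qed.
Fact lresDr : right_distributive lres +%R.
Proof. by move=> a u v; apply: scalerDr. Qed.
Fact lresDl m : {morph lres^~ m : a b / a + b}.
Proof. by move=> a b; rewrite /lres rmorphD; apply: scalerDl. Qed.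
HB.instance Definition _ :=
  GRing.Zmodule_isLmodule.Build A (resbimod f g M) lresA lres1 lresDr lresDl.

Fact rresA m a b : rres (rres m a) b = rres m (a * b).
Proof. by rewrite /rres rscalerA rmorphM. Qed.
Fact rres1 m : rres m 1 = m.
Proof. by rewrite /rres rmorph1 rscaler1. Qed.
Fact rresDl a : {morph rres^~ a : u v / u + v}.
Proof. by move=> u v; apply: rscalerDl. Qed.
Fact rresDr m : {morph rres m : a b / a + b}.
Proof. by move=> a b; rewrite /rres rmorphD; apply: rscalerDr. Qed.
HB.instance Definition _ :=
  Zmodule_isRmodule.Build B (resbimod f g M) rresA rres1 rresDl rresDr.

Fact lres_rres a (m : resbimod f g M) b : (a *: m) :*r b = a *: (m :*r b).
Proof. exact: (scale_rscale (f a) (m : M) (g b)). Qed.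
HB.instance Definition _ :=
  Lmodule_Rmodule_isBimodule.Build A B (resbimod f g M) lres_rres.

End Restriction.

(** An element of [X (x)_A N] is represented by a sequence of pairs, read as the
    sum of the corresponding pure tensors.  Since -(x (x) n) = (-x) (x) n, the
    presentation of the tensor product as a commutative monoid suffices. *)

Section Tensor.
Variables (A : pzRingType) (X : rmodType A) (N : lmodType A).

Inductive tens_rel : seq (X * N) -> seq (X * N) -> Prop :=
| tens_refl s : tens_rel s s
| tens_sym s t : tens_rel s t -> tens_rel t s
| tens_trans s t u : tens_rel s t -> tens_rel t u -> tens_rel s u
| tens_cat s t s' t' :
    tens_rel s s' -> tens_rel t t' -> tens_rel (s ++ t) (s' ++ t')
| tens_catC s t : tens_rel (s ++ t) (t ++ s)
| tens_0l n : tens_rel [:: (0, n)] [::]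
| tens_Dl x y n : tens_rel [:: (x + y, n)] [:: (x, n); (y, n)]
| tens_Dr x m n : tens_rel [:: (x, m + n)] [:: (x, m); (x, n)]
| tens_bal x a n : tens_rel [:: (x :*r a, n)] [:: (x, a *: n)].

Definition tens_relb (s t : seq (X * N)) : bool := `[< tens_rel s t >].

Fact tens_equiv : equiv_class_of tens_relb.
Proof.
split.
- by move=> s; apply/asboolP; apply: tens_refl.
- by move=> s t; apply/asboolP/asboolP; apply: tens_sym.
- by move=> t s u /asboolP st /asboolP tu; apply/asboolP/(tens_trans st tu).
Qed.

Canonical tens_equiv_rel := EquivRelPack tens_equiv.

Definition tensor : Type := {eq_quot tens_relb}.
HB.instance Definition _ := Choice.on tensor.
HB.instance Definition _ := Quotient.on tensor.

Definition tens_sum (s : seq (X * N)) : tensor := \pi_(tensor) s.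
Definition tens (x : X) (n : N) : tensor := tens_sum [:: (x, n)].

Lemma tens_sumP s t : tens_sum s = tens_sum t <-> tens_rel s t.
Proof.
split; first by move/eqquotP/asboolP.
by move=> st; apply/eqquotP/asboolP.
Qed.

Lemma tens_repr s : tens_rel (repr (tens_sum s)) s.
Proof. by apply/tens_sumP; rewrite /tens_sum reprK. Qed.

Lemma tens_sum_surj (t : tensor) : exists s, t = tens_sum s.
Proof. by exists (repr t); rewrite /tens_sum reprK. Qed.

Definition tens_lift (h : seq (X * N) -> seq (X * N)) (t : tensor) : tensor :=
  tens_sum (h (repr t)).

Definition tens_add (t u : tensor) : tensor := tens_sum (repr t ++ repr u).
Definition tens_opp : tensor -> tensor :=
  tens_lift (map (fun p => (- p.1, p.2))).

Lemma tens_addE s t : tens_add (tens_sum s) (tens_sum t) = tens_sum (s ++ t).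
Proof. by apply/tens_sumP/tens_cat; apply: tens_repr. Qed.

Lemma tens_liftE (h : seq (X * N) -> seq (X * N)) s :
    (forall s t, tens_rel s t -> tens_rel (h s) (h t)) ->
  tens_lift h (tens_sum s) = tens_sum (h s).
Proof. by move=> hP; apply/tens_sumP/hP/tens_repr. Qed.

Lemma tens_rel_mapl (f : X -> X) :
    {morph f : x y / x + y} -> (forall x a, f (x :*r a) = f x :*r a) ->
  forall s t, tens_rel s t ->
    tens_rel [seq (f p.1, p.2) | p <- s] [seq (f p.1, p.2) | p <- t].
Proof.
move=> fD fA s t; elim=> {s t} /=.
- by move=> s; apply: tens_refl.
- by move=> s t _; apply: tens_sym.
- by move=> s t u _ st _; apply: tens_trans st.
- by move=> s t s' t' _ ss _ tt; rewrite !map_cat; apply: tens_cat.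
- by move=> s t; rewrite !map_cat; apply: tens_catC.
- have f0 : f 0 = 0 by apply: (addIr (f 0)); rewrite -fD !add0r.
  by move=> n; rewrite f0; apply: tens_0l.
- by move=> x y n; rewrite fD; apply: tens_Dl.
- by move=> x m n; apply: tens_Dr.
- by move=> x a n; rewrite fA; apply: tens_bal.
Qed.

Lemma tens_rel_mapr (f : N -> N) :
    {morph f : x y / x + y} -> (forall a x, f (a *: x) = a *: f x) ->
  forall s t, tens_rel s t ->
    tens_rel [seq (p.1, f p.2) | p <- s] [seq (p.1, f p.2) | p <- t].
Proof.
move=> fD fA s t; elim=> {s t} /=.
- by move=> s; apply: tens_refl.
- by move=> s t _; apply: tens_sym.
- by move=> s t u _ st _; apply: tens_trans st.
- by move=> s t s' t' _ ss _ tt; rewrite !map_cat; apply: tens_cat.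
- by move=> s t; rewrite !map_cat; apply: tens_catC.
- by move=> n; apply: tens_0l.
- by move=> x y n; apply: tens_Dl.
- by move=> x m n; rewrite fD; apply: tens_Dr.
- by move=> x a n; rewrite fA; apply: tens_bal.
Qed.

Lemma tens_oppE s : tens_opp (tens_sum s) = tens_sum [seq (- p.1, p.2) | p <- s].
Proof.
apply: tens_liftE; apply: tens_rel_mapl => [x y|x a]; first exact: opprD.
by rewrite rscaleNr.
Qed.

Fact tens_addA : associative tens_add.
Proof.
move=> t u v; have [s ->] := tens_sum_surj t; have [s' ->] := tens_sum_surj u.
by have [s'' ->] := tens_sum_surj v; rewrite !tens_addE catA.
Qed.

Fact tens_addC : commutative tens_add.
Proof.
move=> t u; have [s ->] := tens_sum_surj t; have [s' ->] := tens_sum_surj u.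
by rewrite !tens_addE; apply/tens_sumP/tens_catC.
Qed.

Fact tens_add0 : left_id (tens_sum [::]) tens_add.
Proof. by move=> t; have [s ->] := tens_sum_surj t; rewrite tens_addE. Qed.

Fact tens_addN : left_inverse (tens_sum [::]) tens_opp tens_add.
Proof.
move=> t; have [s ->] := tens_sum_surj t; rewrite tens_oppE tens_addE.
apply/tens_sumP; elim: s => [|[x n] s IHs] /=; first exact: tens_refl.
set s' := map _ s in IHs *.
apply: (@tens_trans _ ([:: (- x, n); (x, n)] ++ (s' ++ s))).
  have -> : (- x, n) :: s' ++ (x, n) :: s =
      [:: (- x, n)] ++ ((s' ++ [:: (x, n)]) ++ s) by rewrite -catA.
  have -> : [:: (- x, n); (x, n)] ++ (s' ++ s) =
      [:: (- x, n)] ++ (([:: (x, n)] ++ s') ++ s) by [].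
  apply: tens_cat; first exact: tens_refl.
  by apply: tens_cat; [apply: tens_catC | apply: tens_refl].
apply: (@tens_trans _ ([::] ++ [::])); last exact: tens_refl.
apply: tens_cat => //.
apply: tens_trans (tens_sym (tens_Dl _ _ _)) _.
by rewrite addNr; apply: tens_0l.
Qed.

HB.instance Definition _ :=
  GRing.isZmodule.Build tensor tens_addA tens_addC tens_add0 tens_addN.

Lemma tens_sumD s t : tens_sum s + tens_sum t = tens_sum (s ++ t).
Proof. exact: tens_addE. Qed.

Lemma tens_sumE s : tens_sum s = \sum_(p <- s) tens p.1 p.2.
Proof.
elim: s => [|[x n] s IHs]; first by rewrite big_nil.
by rewrite big_cons -IHs tens_sumD.
Qed.

End Tensor.

Section TensorLeft.
Variables (B A : pzRingType) (X : bimodType B A) (N : lmodType A).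
Local Notation T := (tensor X N).

Definition tens_lscale (b : B) : T -> T :=
  @tens_lift A X N (map (fun p => (b *: p.1, p.2))).

Lemma tens_lscaleE b (s : seq (X * N)) :
  tens_lscale b (tens_sum s) = tens_sum [seq (b *: p.1, p.2) | p <- s].
Proof.
apply: tens_liftE; apply: tens_rel_mapl => [x y|x a]; first exact: scalerDr.
by rewrite scale_rscale.
Qed.

Fact tens_lscaleA a b t : tens_lscale a (tens_lscale b t) = tens_lscale (a * b) t.
Proof.
have [s ->] := tens_sum_surj t; rewrite !tens_lscaleE -map_comp.
by congr tens_sum; apply: eq_map => p /=; rewrite scalerA.
Qed.

Fact tens_lscale1 : left_id 1 tens_lscale.
Proof.
move=> t; have [s ->] := tens_sum_surj t; rewrite tens_lscaleE.
by rewrite -[in RHS](map_id s); congr tens_sum; apply: eq_map => -[x n] /=;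
  rewrite scale1r.
Qed.

Fact tens_lscaleDr : right_distributive tens_lscale +%R.
Proof.
move=> b t u; have [s ->] := tens_sum_surj t; have [s' ->] := tens_sum_surj u.
by rewrite tens_sumD !tens_lscaleE tens_sumD map_cat.
Qed.

Fact tens_lscaleDl t : {morph tens_lscale^~ t : a b / a + b}.
Proof.
move=> a b; have [s ->] := tens_sum_surj t; rewrite !tens_lscaleE !tens_sumE.
rewrite !big_map -big_split; apply: eq_bigr => -[x n] _ /=.
by rewrite /tens tens_sumD; apply/tens_sumP; rewrite scalerDl; apply: tens_Dl.
Qed.

HB.instance Definition _ := GRing.Zmodule_isLmodule.Build B T
  tens_lscaleA tens_lscale1 tens_lscaleDr tens_lscaleDl.

End TensorLeft.

Section TensorRight.
Variables (A C : pzRingType) (X : rmodType A) (N : bimodType A C).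
Local Notation T := (tensor X N).

Definition tens_rscale (t : T) (c : C) : T :=
  @tens_lift A X N (map (fun p => (p.1, p.2 :*r c))) t.

Lemma tens_rscaleE (s : seq (X * N)) c :
  tens_rscale (tens_sum s) c = tens_sum [seq (p.1, p.2 :*r c) | p <- s].
Proof.
apply: tens_liftE.
apply: (tens_rel_mapr (f := fun n : N => n :*r c)) => [x y|a x].
  exact: rscalerDl.
exact: scale_rscale.
Qed.

Fact tens_rscaleA t a b : tens_rscale (tens_rscale t a) b = tens_rscale t (a * b).
Proof.
have [s ->] := tens_sum_surj t; rewrite !tens_rscaleE -map_comp.
by congr tens_sum; apply: eq_map => p /=; rewrite rscalerA.
Qed.

Fact tens_rscale1 t : tens_rscale t 1 = t.
Proof.
have [s ->] := tens_sum_surj t; rewrite tens_rscaleE.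
by rewrite -[in RHS](map_id s); congr tens_sum; apply: eq_map => -[x n] /=;
  rewrite rscaler1.
Qed.

Fact tens_rscaleDl c : {morph tens_rscale^~ c : t u / t + u}.
Proof.
move=> t u; have [s ->] := tens_sum_surj t; have [s' ->] := tens_sum_surj u.
by rewrite tens_sumD !tens_rscaleE tens_sumD map_cat.
Qed.

Fact tens_rscaleDr t : {morph tens_rscale t : a b / a + b}.
Proof.
move=> a b; have [s ->] := tens_sum_surj t; rewrite !tens_rscaleE !tens_sumE.
rewrite !big_map -big_split; apply: eq_bigr => -[x n] _ /=.
by rewrite /tens tens_sumD; apply/tens_sumP; rewrite rscalerDr; apply: tens_Dr.
Qed.

HB.instance Definition _ := Zmodule_isRmodule.Build C T
  tens_rscaleA tens_rscale1 tens_rscaleDl tens_rscaleDr.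

End TensorRight.

Section TensorBimodule.
Variables (B A C : pzRingType) (X : bimodType B A) (N : bimodType A C).

Fact tens_scale_rscale (b : B) (t : tensor X N) (c : C) :
  (b *: t) :*r c = b *: (t :*r c).
Proof.
have [s ->] := tens_sum_surj t.
rewrite [LHS](congr1 (fun u => @tens_rscale A C X N u c) (tens_lscaleE b s)).
rewrite [RHS](congr1 (@tens_lscale B A X N b) (tens_rscaleE s c)).
by rewrite tens_rscaleE tens_lscaleE -!map_comp.
Qed.

HB.instance Definition _ :=
  Lmodule_Rmodule_isBimodule.Build B C (tensor X N) tens_scale_rscale.

End TensorBimodule.

(** The group is carried by a subset of an ambient type, given as a predicate:
    [set T] does not accept the type of all bimodules for [T], for universe
    reasons. *)

Record is_group (T : Type) (G : T -> Prop) (op : T -> T -> T) (e : T) : Prop := {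
  group_mul : forall x y, G x -> G y -> G (op x y);
  group_assoc : forall x y z, G x -> G y -> G z ->
    op x (op y z) = op (op x y) z;
  group_one : G e;
  group_mul1 : forall x, G x -> op e x = x /\ op x e = x;
  group_inv : forall x, G x -> exists2 y, G y & op x y = e /\ op y x = e
}.

Definition is_group_hom (T U : Type) (G : T -> Prop) (opT : T -> T -> T)
    (H : U -> Prop) (opU : U -> U -> U) (f : T -> U) : Prop :=
  (forall x, G x -> H (f x)) /\
  (forall x y, G x -> G y -> f (opT x y) = opU (f x) (f y)).

(** Exactness at [H] of [G -f-> H -g-> K], where [e] is the unit of [K]. *)
Definition exact_at (T U V : Type) (G : T -> Prop) (f : T -> U) (H : U -> Prop)
    (g : U -> V) (e : V) : Prop :=
  forall y, (H y /\ g y = e) <-> exists2 x, G x & f x = y.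

Definition central_units (A : pzRingType) : set A :=
  [set x | (forall y, x * y = y * x) /\ exists y, x * y = 1 /\ y * x = 1].

(** Isomorphism classes are represented extensionally, as predicates. *)
Definition bimod_class (A : pzRingType) := bimodType A A -> Prop.

Section Pic.
Variable A : pzRingType.

Definition iso_class (M : bimodType A A) : bimod_class A :=
  fun N => bimod_iso M N.

Definition invertible_bimod (M : bimodType A A) : Prop :=
  exists N : bimodType A A, bimod_iso (tensor M N) A^o /\
                            bimod_iso (A^o : bimodType A A) (tensor N M).

Definition Pic (C : bimod_class A) : Prop :=
  exists2 M, invertible_bimod M & C = iso_class M.

Definition Pic_mul (C D : bimod_class A) : bimod_class A :=
  fun P => exists M N, [/\ C M, D N & bimod_iso (tensor M N) P].

Definition Pic_one : bimod_class A := iso_class A^o.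

End Pic.

Arguments Pic A C : clear implicits.
Arguments Pic_mul A C D : clear implicits.
Arguments Pic_one A _ : clear implicits.

Section Ore.
Variable R : pzRingType.

Record regular_ore_set (S : set R) : Prop := {
  ore_one : S 1;
  ore_mul : forall s t, S s -> S t -> S (s * t);
  ore_regular : forall s, S s -> GRing.lreg s /\ GRing.rreg s;
  ore_right : forall r s, S s -> exists r' s', S s' /\ r * s' = s * r';
  ore_left : forall r s, S s -> exists r' s', S s' /\ s' * r = r' * s
}.

(** [Q], with the embedding [iota], is the ring of fractions
    [R S^-1 = S^-1 R]: every element is [r s^-1], and also [s^-1 r].  Inverses
    are witnessed by [t], since a [pzRingType] has no inverse operation. *)
Record is_fraction_ring (S : set R) (Q : pzRingType) (iota : {rmorphism R -> Q}) :
    Prop := {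
  frac_inj : injective iota;
  frac_unit : forall s, S s -> exists t, iota s * t = 1 /\ t * iota s = 1;
  frac_right : forall q, exists r s t,
    [/\ S s, iota s * t = 1, t * iota s = 1 & q = iota r * t];
  frac_left : forall q, exists r s t,
    [/\ S s, iota s * t = 1, t * iota s = 1 & q = t * iota r]
}.

Definition left_ideal (D : set R) : Prop :=
  [/\ D 0, forall x y, D x -> D y -> D (x + y) & forall r x, D x -> D (r * x)].

Definition right_ideal (D : set R) : Prop :=
  [/\ D 0, forall x y, D x -> D y -> D (x + y) & forall x r, D x -> D (x * r)].

Definition Dl (S : set R) : set (set R) :=
  [set D | left_ideal D /\ D `&` S !=set0].

Definition Dr (S : set R) : set (set R) :=
  [set D | right_ideal D /\ D `&` S !=set0].

Section Torsion.
Variable S : set R.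

Definition rtorsion (X : rmodType R) : Prop :=
  forall x : X, exists2 D, Dr S D & forall r, D r -> x :*r r = 0.

Definition rtorsion_free (X : rmodType R) : Prop :=
  forall x : X, (exists2 D, Dr S D & forall r, D r -> x :*r r = 0) -> x = 0.

Definition ltorsion (X : lmodType R) : Prop :=
  forall x : X, exists2 D, Dl S D & forall r, D r -> r *: x = 0.

Definition ltorsion_free (X : lmodType R) : Prop :=
  forall x : X, (exists2 D, Dl S D & forall r, D r -> r *: x = 0) -> x = 0.

(** A class [P] of modules is mapped onto itself, up to isomorphism, by
    [- (x) M], resp. by [M (x) -]. *)
Definition Tmap_onto (M : bimodType R R) (P : rmodType R -> Prop) : Prop :=
  (forall X, P X -> P (tensor X M : rmodType R)) /\
  (forall Y, P Y -> exists2 X, P X & rmod_iso (tensor X M) Y).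

Definition Umap_onto (M : bimodType R R) (P : lmodType R -> Prop) : Prop :=
  (forall X, P X -> P (tensor M X : lmodType R)) /\
  (forall Y, P Y -> exists2 X, P X & lmod_iso (tensor M X) Y).

Definition Tsharp_fixed (M : bimodType R R) : Prop :=
  Tmap_onto M rtorsion /\ Tmap_onto M rtorsion_free.

Definition Usharp_fixed (M : bimodType R R) : Prop :=
  Umap_onto M ltorsion /\ Umap_onto M ltorsion_free.

(** [Pic(R, D_l, D_r)] *)
Definition Pic_filters (C : bimod_class R) : Prop :=
  exists M : bimodType R R,
    [/\ invertible_bimod M, Tsharp_fixed M, Usharp_fixed M & C = iso_class M].

End Torsion.
End Ore.

Section Subbimodules.
Variables (R Q : pzRingType) (iota : {rmorphism R -> Q}).

Definition subbimodule (M : set Q) : Prop :=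
  [/\ M 0, forall x y, M x -> M y -> M (x + y),
      forall r x, M x -> M (iota r * x) & forall x r, M x -> M (x * iota r)].

(** [set_prod M N] is [MN], [set_inv M] is [M^-1], [range iota] is [R]. *)
Definition set_prod (M N : set Q) : set Q :=
  [set x | exists2 s : seq (Q * Q),
     (forall p, p \in s -> M p.1 /\ N p.2) & x = \sum_(p <- s) p.1 * p.2].

Definition set_inv (M : set Q) : set Q :=
  [set n | forall m, M m -> range iota (n * m) /\ range iota (m * n)].

(** [Pic(R | Q)] *)
Definition Pic_rel : set (set Q) :=
  [set M | [/\ subbimodule M, set_prod M (set_inv M) = range iota
             & set_prod (set_inv M) M = range iota]].

(** [x |-> xR] *)
Definition principal (x : Q) : set Q := [set x * iota r | r in [set: R]].

Definition subbimod (M : set Q) (MP : subbimodule M) : Type :=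
  {x : Q | `[< M x >]}.

Section SubbimoduleType.
Variables (M : set Q) (MP : subbimodule M).
Local Notation sM := (subbimod MP).

HB.instance Definition _ := [isSub of sM for @sval Q (fun x => `[< M x >])].
HB.instance Definition _ := [Choice of sM by <:].

Fact subbimod_mem (x : sM) : M (val x).
Proof. by apply/asboolP; case: x. Qed.

Definition subbimod_in x (Mx : M x) : sM := exist _ x (asboolT Mx).

Fact sb0 : M 0. Proof. by case: MP. Qed.
Fact sbD (x y : sM) : M (val x + val y).
Proof. by case: MP => _ D _ _; apply: D; apply: subbimod_mem. Qed.
Fact sbl r (x : sM) : M (iota r * val x).
Proof. by case: MP => _ _ L _; apply: L; apply: subbimod_mem. Qed.
Fact sbr (x : sM) r : M (val x * iota r).
Proof. by case: MP => _ _ _ L; apply: L; apply: subbimod_mem. Qed.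
Fact sbN (x : sM) : M (- val x).
Proof. by have := sbl (-1) x; rewrite rmorphN1 mulN1r. Qed.

Let add (x y : sM) : sM := subbimod_in (sbD x y).
Let opp (x : sM) : sM := subbimod_in (sbN x).
Let lsc r (x : sM) : sM := subbimod_in (sbl r x).
Let rsc (x : sM) r : sM := subbimod_in (sbr x r).

Fact sb_addA : associative add.
Proof. by move=> x y z; apply: val_inj; apply: addrA. Qed.
Fact sb_addC : commutative add.
Proof. by move=> x y; apply: val_inj; apply: addrC. Qed.
Fact sb_add0 : left_id (subbimod_in sb0) add.
Proof. by move=> x; apply: val_inj; apply: add0r. Qed.
Fact sb_addN : left_inverse (subbimod_in sb0) opp add.
Proof. by move=> x; apply: val_inj; apply: addNr. Qed.
HB.instance Definition _ :=
  GRing.isZmodule.Build sM sb_addA sb_addC sb_add0 sb_addN.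

Fact sb_lA a b x : lsc a (lsc b x) = lsc (a * b) x.
Proof. by apply: val_inj; rewrite /= mulrA rmorphM. Qed.
Fact sb_l1 : left_id 1 lsc.
Proof. by move=> x; apply: val_inj; rewrite /= rmorph1 mul1r. Qed.
Fact sb_lDr : right_distributive lsc +%R.
Proof. by move=> a x y; apply: val_inj; apply: mulrDr. Qed.
Fact sb_lDl x : {morph lsc^~ x : a b / a + b}.
Proof. by move=> a b; apply: val_inj; rewrite /= rmorphD mulrDl. Qed.
HB.instance Definition _ :=
  GRing.Zmodule_isLmodule.Build R sM sb_lA sb_l1 sb_lDr sb_lDl.

Fact sb_rA x a b : rsc (rsc x a) b = rsc x (a * b).
Proof. by apply: val_inj; rewrite /= -mulrA rmorphM. Qed.
Fact sb_r1 x : rsc x 1 = x.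
Proof. by apply: val_inj; rewrite /= rmorph1 mulr1. Qed.
Fact sb_rDl a : {morph rsc^~ a : x y / x + y}.
Proof. by move=> x y; apply: val_inj; apply: mulrDl. Qed.
Fact sb_rDr x : {morph rsc x : a b / a + b}.
Proof. by move=> a b; apply: val_inj; rewrite /= rmorphD mulrDr. Qed.
HB.instance Definition _ :=
  Zmodule_isRmodule.Build R sM sb_rA sb_r1 sb_rDl sb_rDr.

Fact sb_lr a (x : sM) b : (a *: x) :*r b = a *: (x :*r b).
Proof. by apply: val_inj; rewrite /= mulrA. Qed.
HB.instance Definition _ := Lmodule_Rmodule_isBimodule.Build R R sM sb_lr.

End SubbimoduleType.

(** [M |-> [M]]; the value is empty when [M] is not a subbimodule. *)
Definition class_of (M : set Q) : bimod_class R :=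
  fun B => exists MP : subbimodule M, iso_class (subbimod MP) B.

End Subbimodules.

Section TwoSidedLocalization.
Variables (R : pzRingType) (S : set R).

(** A homomorphism defined on a one-sided ideal is represented by a function
    on the whole of [R] of which only the values on the ideal matter.
    Homomorphisms of left modules are written on the right in the mathematics:
    [cp_f p x] is [(x)f]. *)
Record compatible_pair (M : bimodType R R) := CompatiblePair {
  cp_D : set R;
  cp_f : R -> M;
  cp_H : set R;
  cp_g : R -> M;
  cp_DP : Dl S cp_D;
  cp_HP : Dr S cp_H;
  cp_fD : forall x y, cp_D x -> cp_D y -> cp_f (x + y) = cp_f x + cp_f y;
  cp_fZ : forall r x, cp_D x -> cp_f (r * x) = r *: cp_f x;
  cp_gD : forall x y, cp_H x -> cp_H y -> cp_g (x + y) = cp_g x + cp_g y;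
  cp_gZ : forall y r, cp_H y -> cp_g (y * r) = cp_g y :*r r;
  cp_compat : forall x y, cp_D x -> cp_H y -> x *: cp_g y = cp_f x :*r y
}.

Definition pair_equiv (M : bimodType R R) (p q : compatible_pair M) : Prop :=
  (exists D, [/\ Dl S D, D `<=` cp_D p `&` cp_D q
               & forall x, D x -> cp_f p x = cp_f q x]) /\
  (exists H, [/\ Dr S H, H `<=` cp_H p `&` cp_H q
               & forall y, H y -> cp_g p y = cp_g q y]).

Definition is_pair_add (M : bimodType R R) (p q pq : compatible_pair M) : Prop :=
  [/\ cp_D pq = cp_D p `&` cp_D q,
      forall x, cp_D pq x -> cp_f pq x = cp_f p x + cp_f q x,
      cp_H pq = cp_H p `&` cp_H q
    & forall y, cp_H pq y -> cp_g pq y = cp_g p y + cp_g q y].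

(** [qm] is the pair describing the product [q . m]. *)
Definition is_pair_lact (M : bimodType R R)
    (q : compatible_pair R^o) (m qm : compatible_pair M) : Prop :=
  let decomp y (s : seq (R * M)) :=
    (forall zm, zm \in s -> cp_H q zm.1) /\
    cp_g m y = \sum_(zm <- s) zm.1 *: zm.2 in
  [/\ cp_D qm = [set x | cp_D q x /\ cp_D m (cp_f q x)],
      forall x, cp_D qm x -> cp_f qm x = cp_f m (cp_f q x),
      cp_H qm = [set y | cp_H m y /\ exists s, decomp y s]
    & forall y s, cp_H m y -> decomp y s ->
        cp_g qm y = \sum_(zm <- s) (cp_g q zm.1 : R) *: zm.2].

(** [mq] is the pair describing the product [m . q]. *)
Definition is_pair_ract (M : bimodType R R)
    (m : compatible_pair M) (q : compatible_pair R^o) (mq : compatible_pair M) :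
    Prop :=
  let decomp x (s : seq (M * R)) :=
    (forall mz, mz \in s -> cp_D q mz.2) /\
    cp_f m x = \sum_(mz <- s) mz.1 :*r mz.2 in
  [/\ cp_D mq = [set x | cp_D m x /\ exists s, decomp x s],
      forall x s, cp_D m x -> decomp x s ->
        cp_f mq x = \sum_(mz <- s) mz.1 :*r (cp_f q mz.2 : R),
      cp_H mq = [set y | cp_H q y /\ cp_H m (cp_g q y)]
    & forall y, cp_H mq y -> cp_g mq y = cp_g m (cp_g q y)].

Variables (Q : pzRingType) (iota : {rmorphism R -> Q}).

(** The identification of the localization of [R] with the ring of fractions:
    [q] corresponds to the class of (right, left) multiplication by [q]. *)
Definition represents (q : Q) (p : compatible_pair R^o) : Prop :=
  (forall x, cp_D p x -> iota (cp_f p x) = iota x * q) /\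
  (forall y, cp_H p y -> iota (cp_g p y) = q * iota y).

(** The bimodule [B] is the two-sided localization of [M], [cls p] being the
    class of the pair [p]: the elements of [B] are the classes of compatible
    pairs, and the operations of [B] are those of the localization.  The
    requirement that a pair describing each sum and product exists is part of
    the definition. *)
Record is_localization (M : bimodType R R) (B : bimodType Q Q)
    (cls : compatible_pair M -> B) : Prop := {
  loc_surj : forall b, exists p, cls p = b;
  loc_eq : forall p p', cls p = cls p' <-> pair_equiv p p';
  loc_add : forall p p',
    exists2 pp, is_pair_add p p' pp & cls pp = cls p + cls p';
  loc_represents : forall q, exists p, represents q p;
  loc_lact : forall q pq p, represents q pq ->
    exists2 p', is_pair_lact pq p p' & cls p' = q *: cls p;
  loc_ract : forall p q pq, represents q pq ->
    exists2 p', is_pair_ract p pq p' & cls p' = cls p :*r q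
}.

Definition loc_class (C : bimod_class R) : bimod_class Q :=
  fun B => exists (M : bimodType R R) (cls : compatible_pair M -> B),
     C M /\ is_localization cls.

(** The canonical map from [M] to its localization sends [m] to the class of
    [canonical_pair m]. *)
Section CanonicalPair.
Hypothesis SP : regular_ore_set S.
Variables (M : bimodType R R) (m : M).

Fact setT_Dl : Dl S setT.
Proof. by split; [split | exists 1; split=> //; apply: (ore_one SP)]. Qed.

Fact setT_Dr : Dr S setT.
Proof. by split; [split | exists 1; split=> //; apply: (ore_one SP)]. Qed.

Definition canonical_pair : compatible_pair M :=
  @CompatiblePair M setT (fun x => x *: m) setT (fun y => m :*r y)
    setT_Dl setT_Dr
    (fun x y _ _ => scalerDl m x y) (fun r x _ => esym (scalerA r x m))
    (fun x y _ _ => rscalerDr m x y) (fun y r _ => esym (rscalerA m y r))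
    (fun x y _ _ => esym (scale_rscale x m y)).

End CanonicalPair.

End TwoSidedLocalization.

(* Main.v *)
(** A surjective Morita context (two compatible pairings of [M] with its inverse
    [N]) replaces the isomorphisms [M (x) N = R = N (x) M] and makes everything
    elementwise.  Testing the filter conditions on [R / sR] and [R / Rs] shows
    that [[M]] lies in [Pic(R, D_l, D_r)] iff [M] and [N] satisfy Ore conditions
    of the form [m s' = s m'] and [s' m = m' s].  These are what is needed for
    [Q (x) M (x) Q] to be simultaneously [S^-1 M] and [M S^-1], with [M]
    embedded in it.  Such a bimodule of fractions is unique, is compatible with
    tensor products, and is the same thing as the two-sided localization: the
    class of a compatible pair [(f, g)] is the unique [b] with [x b = (x)f] and
    [b y = g(y)].  If the bimodule of fractions of [M] is [Q], then [M] embeds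
    in [Q], and the functionals on [M] given by [N] are right multiplications by
    the elements of [M^-1]. *)

From HB Require Import structures.
Require Import Defs.
From mathcomp Require Import all_boot all_algebra.
From mathcomp Require Import boolp classical_sets.

Set Implicit Arguments.
Unset Strict Implicit.
Unset Printing Implicit Defensive.

Import GRing.Theory.
Local Open Scope ring_scope.
Local Open Scope classical_set_scope.

(** * Tensor products *)

(** An element of an invertible bimodule [M] is determined by its values under the functionals
    [al(-, n)], because a decomposition of 1 through [be] acts as a dual basis; the same holds for
    tensors in [X (x) M]. Torsion-freeness and injectivity are therefore tested on these
    coordinates, where it is an Ore condition on [N] that moves [s] past [n]. Hence conditions on
    [M] and [N] occur together, and passing to the inverse of [[M]] merely exchanges them.

    The obstacle to forming fractions is that [Q (x) M] carries only a right action of [R].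
    Extending it to [Q] on the right keeps [M] embedded because [S] acts bijectively: injectively by
    the right Ore condition on [N], surjectively by the left one on [M].

    Uniqueness of the bimodule of fractions then spares the last map any computation with pairs: a
    product, or [R] itself, has two visible bimodules of fractions, and these must be isomorphic.
    Pairs enter only in matching fractions with the localization. There sums and products come with
    exact domains, so pairs have to be built on prescribed ideals. *)

Section AdditiveMaps.
Variables (U V : zmodType) (f : U -> V).
Hypothesis fD : {morph f : x y / x + y}.

Lemma morph_add0 : f 0 = 0.
Proof. by apply: (addIr (f 0)); rewrite -fD !add0r. Qed.

Lemma morph_addN x : f (- x) = - f x.
Proof. by apply/eqP; rewrite -addr_eq0 -fD addNr morph_add0. Qed.

Lemma morph_add_sum I (r : seq I) (F : I -> U) :
  f (\sum_(i <- r) F i) = \sum_(i <- r) f (F i).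
Proof. exact: (big_morph f fD morph_add0). Qed.

Lemma morph_add_inj : (forall x, f x = 0 -> x = 0) -> injective f.
Proof.
move=> ker0 x y fxy; apply/eqP; rewrite -subr_eq0; apply/eqP/ker0.
by rewrite fD morph_addN fxy subrr.
Qed.

End AdditiveMaps.

Lemma inj_surj_bij (T U : Type) (f : T -> U) :
  injective f -> (forall y, exists x, f x = y) -> bijective f.
Proof.
move=> fI fS; have [g fK] := boolp.choice fS.
by exists g => // x; apply: fI; rewrite fK.
Qed.

Lemma rscale_sumr (A : pzRingType) (V : rmodType A) I (r : seq I) (F : I -> A)
    (v : V) :
  v :*r (\sum_(i <- r) F i) = \sum_(i <- r) v :*r F i.
Proof. by apply: morph_add_sum => a b; apply: rscalerDr. Qed.

Lemma rscale_suml (A : pzRingType) (V : rmodType A) I (r : seq I) (F : I -> V)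
    (a : A) :
  (\sum_(i <- r) F i) :*r a = \sum_(i <- r) F i :*r a.
Proof.
by apply: (morph_add_sum (f := fun v : V => v :*r a)) => u v; apply: rscalerDl.
Qed.

Record balanced (A : pzRingType) (X : rmodType A) (N : lmodType A)
    (Z : zmodType) (f : X -> N -> Z) : Prop := {
  balDl : forall n, {morph f^~ n : x y / x + y};
  balDr : forall x, {morph f x : m n / m + n};
  balA : forall x a n, f (x :*r a) n = f x (a *: n)
}.

Section TensorMaps.
Variables (A : pzRingType) (X : rmodType A) (N : lmodType A).
Implicit Types (x : X) (n : N) (t : tensor X N).

Lemma tensDl x y n : tens (x + y) n = tens x n + tens y n.
Proof. by rewrite /tens tens_sumD; apply/tens_sumP/tens_Dl. Qed.

Lemma tensDr x m n : tens x (m + n) = tens x m + tens x n.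
Proof. by rewrite /tens tens_sumD; apply/tens_sumP/tens_Dr. Qed.

Lemma tensA x a n : tens (x :*r a) n = tens x (a *: n).
Proof. exact/tens_sumP/tens_bal. Qed.

Lemma tens_balanced : balanced (@tens A X N).
Proof.
by split=> [n x y|x m n|x a n]; [apply: tensDl|apply: tensDr|apply: tensA].
Qed.

Lemma tens0l n : tens (0 : X) n = 0.
Proof. exact: (morph_add0 (balDl tens_balanced n)). Qed.

Lemma tens0r x : tens x (0 : N) = 0.
Proof. exact: (morph_add0 (balDr tens_balanced x)). Qed.

Lemma tens_suml I (r : seq I) (F : I -> X) n :
  tens (\sum_(i <- r) F i) n = \sum_(i <- r) tens (F i) n.
Proof. exact: (morph_add_sum (balDl tens_balanced n)). Qed.

Lemma tens_sumr I (r : seq I) (F : I -> N) x :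
  tens x (\sum_(i <- r) F i) = \sum_(i <- r) tens x (F i).
Proof. exact: (morph_add_sum (balDr tens_balanced x)). Qed.

Lemma tensor_ind (P : tensor X N -> Prop) :
  P 0 -> (forall t u, P t -> P u -> P (t + u)) -> (forall x n, P (tens x n)) ->
  forall t, P t.
Proof.
move=> P0 PD PT t; have [s ->] := tens_sum_surj t; rewrite tens_sumE.
by elim/big_ind: _.
Qed.

Lemma tensor_ext (Z : zmodType) (f g : tensor X N -> Z) :
  {morph f : x y / x + y} -> {morph g : x y / x + y} ->
  (forall x n, f (tens x n) = g (tens x n)) -> f =1 g.
Proof.
move=> fD gD fg; elim/tensor_ind => [|t u ft gu|//].
  by rewrite !morph_add0.
by rewrite fD gD ft gu.
Qed.

Section Lift.
Variables (Z : zmodType) (f : X -> N -> Z).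

(** Evaluated on a chosen representative, hence meaningful only for balanced [f]; independence of
    the representative is [balanced_rel]. *)
Definition tens_map t : Z := \sum_(p <- repr t) f p.1 p.2.

Hypothesis fP : balanced f.

Lemma balanced_rel (s s' : seq (X * N)) : tens_rel s s' ->
  \sum_(p <- s) f p.1 p.2 = \sum_(p <- s') f p.1 p.2.
Proof.
elim=> {s s'} //=.
- by move=> s t u _ -> _ ->.
- by move=> s t s' t' _ ss _ tt; rewrite !big_cat /= ss tt.
- by move=> s t; rewrite !big_cat /= addrC.
- by move=> n; rewrite big_seq1 big_nil (morph_add0 (balDl fP n)).
- by move=> x y n; rewrite big_seq1 big_cons big_seq1 /= (balDl fP).
- by move=> x m n; rewrite big_seq1 big_cons big_seq1 /= (balDr fP).
- by move=> x a n; rewrite !big_seq1 /= (balA fP).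
Qed.

Lemma tens_map_sum s : tens_map (tens_sum s) = \sum_(p <- s) f p.1 p.2.
Proof. exact/balanced_rel/tens_repr. Qed.

Lemma tens_mapE x n : tens_map (tens x n) = f x n.
Proof. by rewrite tens_map_sum big_seq1. Qed.

Lemma tens_mapD : {morph tens_map : t u / t + u}.
Proof.
move=> t u; have [s ->] := tens_sum_surj t; have [s' ->] := tens_sum_surj u.
by rewrite tens_sumD !tens_map_sum big_cat.
Qed.

End Lift.
End TensorMaps.

Lemma scale_tens (B A : pzRingType) (X : bimodType B A) (N : lmodType A)
  (b : B) (x : X) (n : N) : b *: tens x n = tens (b *: x) n.
Proof. exact: tens_lscaleE. Qed.

Lemma rscale_tens (A C : pzRingType) (X : rmodType A) (N : bimodType A C)
  (x : X) (n : N) (c : C) : tens x n :*r c = tens x (n :*r c).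
Proof. exact: tens_rscaleE. Qed.

Lemma tens_map_scale (B A : pzRingType) (X : bimodType B A) (N : lmodType A)
    (Z : lmodType B) (f : X -> N -> Z) :
  balanced f -> (forall b x n, f (b *: x) n = b *: f x n) ->
  forall b t, tens_map f (b *: t) = b *: tens_map f t.
Proof.
move=> fP fZ b; apply: tensor_ext => [t u|t u|x n].
- by rewrite scalerDr tens_mapD.
- by rewrite tens_mapD // scalerDr.
- by rewrite scale_tens !tens_mapE.
Qed.

Lemma tens_map_rscale (A C : pzRingType) (X : rmodType A) (N : bimodType A C)
    (Z : rmodType C) (f : X -> N -> Z) :
  balanced f -> (forall x n c, f x (n :*r c) = f x n :*r c) ->
  forall t c, tens_map f (t :*r c) = tens_map f t :*r c.
Proof.
move=> fP fZ t c; move: t; apply: tensor_ext => [t u|t u|x n].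
- by rewrite rscalerDl tens_mapD.
- by rewrite tens_mapD // rscalerDl.
- by rewrite rscale_tens !tens_mapE.
Qed.

Section TensorFunctor.
Variables (A : pzRingType) (X X' : rmodType A) (N N' : lmodType A).
Variables (f : X -> X') (g : N -> N').
Hypotheses (fP : rmod_hom f) (gP : lmod_hom g).

Lemma balanced_fun : balanced (fun x n => tens (f x) (g n)).
Proof.
case: fP gP => fD fA [gD gA]; split=> [n x y|x m n|x a n].
- by rewrite fD tensDl.
- by rewrite gD tensDr.
- by rewrite fA gA tensA.
Qed.

End TensorFunctor.

Definition tens_fun (A : pzRingType) (X X' : rmodType A) (N N' : lmodType A)
    (f : X -> X') (g : N -> N') : tensor X N -> tensor X' N' :=
  tens_map (fun x n => tens (f x) (g n)).

Lemma tens_funK (A : pzRingType) (X X' : rmodType A) (N N' : lmodType A)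
    (f : X -> X') (f' : X' -> X) (g : N -> N') (g' : N' -> N) :
  rmod_hom f -> rmod_hom f' -> lmod_hom g -> lmod_hom g' ->
  cancel f f' -> cancel g g' -> cancel (tens_fun f g) (tens_fun f' g').
Proof.
move=> fP fP' gP gP' fK gK; rewrite /tens_fun.
have bP := balanced_fun fP gP; have bP' := balanced_fun fP' gP'.
apply: tensor_ext => [x y|x y|x n] //; first by rewrite !tens_mapD.
by rewrite !tens_mapE // fK gK.
Qed.

Lemma lmod_hom_inv (A : pzRingType) (M N : lmodType A) (f : M -> N) f' :
  lmod_hom f -> cancel f f' -> cancel f' f -> lmod_hom f'.
Proof.
move=> [fD fA] fK f'K; split=> [x y|a x]; apply: (can_inj fK).
  by rewrite fD !f'K.
by rewrite fA !f'K.
Qed.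

Lemma rmod_hom_inv (A : pzRingType) (M N : rmodType A) (f : M -> N) f' :
  rmod_hom f -> cancel f f' -> cancel f' f -> rmod_hom f'.
Proof.
move=> [fD fA] fK f'K; split=> [x y|x a]; apply: (can_inj fK).
  by rewrite fD !f'K.
by rewrite fA !f'K.
Qed.

Lemma lmod_hom_id (A : pzRingType) (M : lmodType A) : lmod_hom (@id M).
Proof. by split. Qed.

Lemma rmod_hom_id (A : pzRingType) (M : rmodType A) : rmod_hom (@id M).
Proof. by split. Qed.

Lemma rmod_iso_trans (A : pzRingType) (M N P : rmodType A) :
  rmod_iso M N -> rmod_iso N P -> rmod_iso M P.
Proof.
case=> f [[fD fr] fb] [g [[gD gr] gb]]; exists (g \o f).
split; last exact: bij_comp.
by split=> [x y|x a] /=; rewrite ?fD ?gD ?fr ?gr.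
Qed.

Lemma lmod_iso_trans (A : pzRingType) (M N P : lmodType A) :
  lmod_iso M N -> lmod_iso N P -> lmod_iso M P.
Proof.
case=> f [[fD fl] fb] [g [[gD gl] gb]]; exists (g \o f).
split; last exact: bij_comp.
by split=> [x y|a x] /=; rewrite ?fD ?gD ?fl ?gl.
Qed.

Lemma rmod_iso_sym (A : pzRingType) (M N : rmodType A) :
  rmod_iso M N -> rmod_iso N M.
Proof.
case=> f [fr [g fK gK]]; exists g; split; last by exists f.
exact: rmod_hom_inv fr fK gK.
Qed.

Lemma lmod_iso_sym (A : pzRingType) (M N : lmodType A) :
  lmod_iso M N -> lmod_iso N M.
Proof.
case=> f [fl [g fK gK]]; exists g; split; last by exists f.
exact: lmod_hom_inv fl fK gK.
Qed.

Lemma rmod_iso_refl (A : pzRingType) (M : rmodType A) : rmod_iso M M.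
Proof. by exists id; split; [exact: rmod_hom_id|exists id]. Qed.

Lemma lmod_iso_refl (A : pzRingType) (M : lmodType A) : lmod_iso M M.
Proof. by exists id; split; [exact: lmod_hom_id|exists id]. Qed.

Section BimodIso.
Variables (A B : pzRingType).
Implicit Types M N P : bimodType A B.

Lemma bimod_iso_refl M : bimod_iso M M.
Proof.
exists id; split; [exact: lmod_hom_id|exact: rmod_hom_id|by exists id].
Qed.

Lemma bimod_iso_sym M N : bimod_iso M N -> bimod_iso N M.
Proof.
case=> f [fl fr [g fK gK]]; exists g; split; last by exists f.
  exact: lmod_hom_inv fl fK gK.
exact: rmod_hom_inv fr fK gK.
Qed.

Lemma bimod_iso_trans M N P : bimod_iso M N -> bimod_iso N P -> bimod_iso M P.
Proof.
case=> f [[fD fl] [_ fr] fb] [g [[gD gl] [_ gr] gb]]; exists (g \o f).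
split; last exact: bij_comp.
- by split=> [x y|a x] /=; rewrite ?fD ?gD ?fl ?gl.
- by split=> [x y|x a] /=; rewrite ?fD ?gD ?fr ?gr.
Qed.

End BimodIso.

Lemma bimod_iso_tensor (B A C : pzRingType) (M M' : bimodType B A)
    (N N' : bimodType A C) :
  bimod_iso M M' -> bimod_iso N N' -> bimod_iso (tensor M N) (tensor M' N').
Proof.
case=> f [fl fr [f' fK f'K]] [g [gl gr [g' gK g'K]]].
have bP := balanced_fun fr gl; exists (tens_fun f g); split.
- split; first exact: tens_mapD.
  by apply: tens_map_scale => // b x n; rewrite scale_tens (proj2 fl).
- split; first exact: tens_mapD.
  by apply: tens_map_rscale => // x n c; rewrite rscale_tens (proj2 gr).
- have fr' := rmod_hom_inv fr fK f'K; have gl' := lmod_hom_inv gl gK g'K.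
  by exists (tens_fun f' g'); apply: tens_funK.
Qed.

Lemma rmod_iso_tensor (A C : pzRingType) (X X' : rmodType A)
    (N N' : bimodType A C) :
  rmod_iso X X' -> bimod_iso N N' -> rmod_iso (tensor X N) (tensor X' N').
Proof.
case=> f [fr [f' fK f'K]] [g [gl gr [g' gK g'K]]].
have bP := balanced_fun fr gl; exists (tens_fun f g); split.
  split; first exact: tens_mapD.
  by apply: tens_map_rscale => // x n c; rewrite rscale_tens (proj2 gr).
have fr' := rmod_hom_inv fr fK f'K; have gl' := lmod_hom_inv gl gK g'K.
by exists (tens_fun f' g'); apply: tens_funK.
Qed.

Lemma lmod_iso_tensor (A C : pzRingType) (N N' : bimodType C A)
    (X X' : lmodType A) :
  bimod_iso N N' -> lmod_iso X X' -> lmod_iso (tensor N X) (tensor N' X').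
Proof.
case=> g [gl gr [g' gK g'K]] [f [fl [f' fK f'K]]].
have bP := balanced_fun gr fl; exists (tens_fun g f); split.
  split; first exact: tens_mapD.
  by apply: tens_map_scale => // c n x; rewrite scale_tens (proj2 gl).
have gr' := rmod_hom_inv gr gK g'K; have fl' := lmod_hom_inv fl fK f'K.
by exists (tens_fun g' f'); apply: tens_funK.
Qed.

(** * Associativity and unit isomorphisms *)

Section TensorAssoc.
Variables (A C : pzRingType).
Variables (X : rmodType A) (M : bimodType A C) (N : lmodType C).

Lemma balanced_assocr0 (n : N) : balanced (fun (x : X) (m : M) => tens x (tens
  m n)).
Proof.
split=> [m x y|x m m'|x a m]; first by rewrite tensDl.
  by rewrite tensDl tensDr.
by rewrite tensA scale_tens.
Qed.

Lemma balanced_assocr :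
  balanced (fun (t : tensor X M) (n : N) =>
              tens_map (fun x m => tens x (tens m n)) t).
Proof.
have bP := balanced_assocr0.
split=> [n|t m n|t a n].
- exact/tens_mapD/balanced_assocr0.
- move: t; apply: tensor_ext => [t u|t u|x p].
  + exact: tens_mapD (bP _) _ _.
  + by rewrite !(tens_mapD (bP _)) addrACA.
  + by rewrite !(tens_mapE (bP _)) ?tensDr.
- move: t; apply: tensor_ext => [t u|t u|x p].
  + by rewrite rscalerDl (tens_mapD (bP _)).
  + exact: tens_mapD (bP _) _ _.
  + by rewrite rscale_tens !(tens_mapE (bP _)) ?tensA.
Qed.

Definition tens_assocr : tensor (tensor X M) N -> tensor X (tensor M N) :=
  tens_map (fun t n => tens_map (fun x m => tens x (tens m n)) t).

Lemma tens_assocrE (x : X) (m : M) (n : N) :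
  tens_assocr (tens (tens x m) n) = tens x (tens m n).
Proof.
rewrite /tens_assocr tens_mapE; last exact: balanced_assocr.
by rewrite tens_mapE //; apply: balanced_assocr0.
Qed.

Lemma tens_assocrD : {morph tens_assocr : t u / t + u}.
Proof. exact/tens_mapD/balanced_assocr. Qed.

Lemma balanced_assocl0 (x : X) : balanced (fun (m : M) (n : N) => tens (tens x
  m) n).
Proof.
split=> [n m m'|m n n'|m a n]; first by rewrite tensDr tensDl.
  by rewrite tensDr.
by rewrite -tensA rscale_tens.
Qed.

Lemma balanced_assocl :
  balanced (fun (x : X) (t : tensor M N) =>
              tens_map (fun m n => tens (tens x m) n) t).
Proof.
have bP := balanced_assocl0.
split=> [t x y|x|x a t].
- move: t; apply: tensor_ext => [t u|t u|m n].
  + exact: tens_mapD (bP _) _ _.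
  + by rewrite !(tens_mapD (bP _)) addrACA.
  + by rewrite !(tens_mapE (bP _)) ?tensDl.
- exact/tens_mapD/balanced_assocl0.
- move: t; apply: tensor_ext => [t u|t u|m n].
  + exact: tens_mapD (bP _) _ _.
  + by rewrite scalerDr (tens_mapD (bP _)).
  + by rewrite scale_tens !(tens_mapE (bP _)) ?tensA.
Qed.

Definition tens_assocl : tensor X (tensor M N) -> tensor (tensor X M) N :=
  tens_map (fun x t => tens_map (fun m n => tens (tens x m) n) t).

Lemma tens_assoclE (x : X) (m : M) (n : N) :
  tens_assocl (tens x (tens m n)) = tens (tens x m) n.
Proof.
rewrite /tens_assocl tens_mapE; last exact: balanced_assocl.
by rewrite tens_mapE //; apply: balanced_assocl0.
Qed.

Lemma tens_assoclD : {morph tens_assocl : t u / t + u}.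
Proof. exact/tens_mapD/balanced_assocl. Qed.

Lemma tensor_indl (P : tensor (tensor X M) N -> Prop) :
  P 0 -> (forall t u, P t -> P u -> P (t + u)) ->
  (forall x m n, P (tens (tens x m) n)) -> forall t, P t.
Proof.
move=> P0 PD PT; apply: tensor_ind => // t n; move: t.
apply: tensor_ind => [|t u Pt Pu|x m //]; first by rewrite tens0l.
by rewrite tensDl; apply: PD.
Qed.

Lemma tensor_indr (P : tensor X (tensor M N) -> Prop) :
  P 0 -> (forall t u, P t -> P u -> P (t + u)) ->
  (forall x m n, P (tens x (tens m n))) -> forall t, P t.
Proof.
move=> P0 PD PT; apply: tensor_ind => // x;
  apply: tensor_ind => [|t u Pt Pu|//].
  by rewrite tens0r.
by rewrite tensDr; apply: PD.
Qed.

Lemma tensor_extl (Z : zmodType) (f g : tensor (tensor X M) N -> Z) :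
  {morph f : x y / x + y} -> {morph g : x y / x + y} ->
  (forall x m n, f (tens (tens x m) n) = g (tens (tens x m) n)) -> f =1 g.
Proof.
move=> fD gD fg; elim/tensor_indl => [|t u ft gu|//].
  by rewrite !morph_add0.
by rewrite fD gD ft gu.
Qed.

Lemma tens_assocr_bij : bijective tens_assocr.
Proof.
exists tens_assocl.
- apply: tensor_extl => // [x y|x m n].
    by rewrite tens_assocrD tens_assoclD.
  by rewrite tens_assocrE tens_assoclE.
- elim/tensor_indr=> [|t u tE uE|x m n].
  + by rewrite (morph_add0 tens_assoclD) (morph_add0 tens_assocrD).
  + by rewrite tens_assoclD tens_assocrD tE uE.
  + by rewrite tens_assoclE tens_assocrE.
Qed.

End TensorAssoc.

Lemma tens_assocr_rmod_hom (A C D : pzRingType) (X : rmodType A)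
    (M : bimodType A C) (N : bimodType C D) :
  rmod_hom (@tens_assocr A C X M N).
Proof.
split=> [|t d]; first exact: tens_assocrD.
move: t; apply: tensor_extl => [t u|t u|x m n].
- by rewrite rscalerDl tens_assocrD.
- by rewrite tens_assocrD rscalerDl.
- by rewrite rscale_tens !tens_assocrE !rscale_tens.
Qed.

Lemma tens_assocr_lmod_hom (B A C : pzRingType) (X : bimodType B A)
    (M : bimodType A C) (N : lmodType C) :
  lmod_hom (@tens_assocr A C X M N).
Proof.
split=> [|b]; first exact: tens_assocrD.
apply: tensor_extl => [t u|t u|x m n].
- by rewrite scalerDr tens_assocrD.
- by rewrite tens_assocrD scalerDr.
- by rewrite !scale_tens !tens_assocrE scale_tens.
Qed.

Lemma bimod_iso_assoc (B A C D : pzRingType) (X : bimodType B A)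
    (M : bimodType A C) (N : bimodType C D) :
  bimod_iso (tensor (tensor X M) N) (tensor X (tensor M N)).
Proof.
exists (@tens_assocr A C X M N); split.
- exact: tens_assocr_lmod_hom.
- exact: tens_assocr_rmod_hom.
- exact: tens_assocr_bij.
Qed.

Section TensorUnit.
Variable A : pzRingType.

Lemma balanced_unitl (M : lmodType A) :
  balanced (fun (a : A^o) (m : M) => (a : A) *: m).
Proof.
split=> [m x y|x m n|x a m]; first by rewrite scalerDl.
  by rewrite scalerDr.
by rewrite scalerA.
Qed.

Lemma balanced_unitr (M : rmodType A) :
  balanced (fun (m : M) (a : A^o) => m :*r (a : A)).
Proof.
split=> [m x y|x m n|x a m]; first by rewrite rscalerDl.
  by rewrite rscalerDr.
by rewrite rscalerA.
Qed.

Lemma unitl_bij (M : lmodType A) :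
  bijective (tens_map (fun (a : A^o) (m : M) => (a : A) *: m)).
Proof.
have bP := balanced_unitl M; exists (tens (1 : A^o)).
- apply: tensor_ext => // [x y|a m].
    by rewrite tens_mapD // tensDr.
  by rewrite tens_mapE // -tensA; congr (tens _ m); apply: mul1r.
- by move=> m; rewrite tens_mapE // scale1r.
Qed.

Lemma unitr_bij (M : rmodType A) :
  bijective (tens_map (fun (m : M) (a : A^o) => m :*r (a : A))).
Proof.
have bP := balanced_unitr M; exists (fun m => tens m (1 : A^o)).
- apply: tensor_ext => // [x y|m a].
    by rewrite tens_mapD // tensDl.
  by rewrite tens_mapE // tensA; congr (tens m _); apply: mulr1.
- by move=> m; rewrite tens_mapE // rscaler1.
Qed.

Lemma tens_unitl_iso (M : lmodType A) :
  lmod_iso (tensor (A^o : bimodType A A) M) M.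
Proof.
have bP := balanced_unitl M.
exists (tens_map (fun (a : A^o) (m : M) => (a : A) *: m)); split.
  split; first exact: tens_mapD.
  by apply: tens_map_scale => // b x n; rewrite scalerA.
exact: unitl_bij.
Qed.

Lemma tens_unitr_iso (M : rmodType A) :
  rmod_iso (tensor M (A^o : bimodType A A)) M.
Proof.
have bP := balanced_unitr M.
exists (tens_map (fun (m : M) (a : A^o) => m :*r (a : A))); split.
  split; first exact: tens_mapD.
  by apply: tens_map_rscale => // x n b; rewrite rscalerA.
exact: unitr_bij.
Qed.

Lemma tens_unitl (M : bimodType A A) : bimod_iso (tensor A^o M) M.
Proof.
have bP := balanced_unitl M.
exists (tens_map (fun (a : A^o) (m : M) => (a : A) *: m)); split.
- split; first exact: tens_mapD.
  by apply: tens_map_scale => // b x n; rewrite scalerA.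
- split; first exact: tens_mapD.
  by apply: tens_map_rscale => // x n b; rewrite scale_rscale.
exact: unitl_bij.
Qed.

Lemma tens_unitr (M : bimodType A A) : bimod_iso (tensor M A^o) M.
Proof.
have bP := balanced_unitr M.
exists (tens_map (fun (m : M) (a : A^o) => m :*r (a : A))); split.
- split; first exact: tens_mapD.
  by apply: tens_map_scale => // b x n; rewrite scale_rscale.
- split; first exact: tens_mapD.
  by apply: tens_map_rscale => // x n b; rewrite rscalerA.
exact: unitr_bij.
Qed.

End TensorUnit.

(** * Isomorphism classes and the Picard group *)

Section PicClasses.
Variable A : pzRingType.
Implicit Types M N P : bimodType A A.

Lemma iso_classP M N : iso_class M = iso_class N <-> bimod_iso M N.
Proof.
split=> [MN|MN].
  by rewrite -[bimod_iso _ _]/(iso_class M N) MN; apply: bimod_iso_refl.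
apply: funext => P; apply: propext; split=> [MP|NP].
  exact: bimod_iso_trans (bimod_iso_sym MN) MP.
exact: bimod_iso_trans NP.
Qed.

(** The union over all representatives collapses to one class, since the tensor product respects
    isomorphisms. *)
Lemma Pic_mulE M N :
  Pic_mul A (iso_class M) (iso_class N) = iso_class (tensor M N).
Proof.
apply: funext => P; apply: propext; split=> [[M' [N' [MM NN]]]|MNP].
  by apply: bimod_iso_trans; apply: bimod_iso_tensor.
by exists M, N; split=> //; apply: bimod_iso_refl.
Qed.

Lemma invertible_inv M N : bimod_iso (tensor M N) A^o ->
  bimod_iso (tensor N M) A^o -> invertible_bimod M.
Proof. by move=> MN NM; exists N; split=> //; apply: bimod_iso_sym. Qed.

Lemma invertible1 : invertible_bimod (A^o : bimodType A A).
Proof. by apply: (@invertible_inv _ A^o); apply: tens_unitl. Qed.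

(** [M (x) (M' (x) N') (x) N] collapses from the inside. *)
Lemma tensor_cancel M M' N N' :
  bimod_iso (tensor M' N') A^o -> bimod_iso (tensor M N) A^o ->
  bimod_iso (tensor (tensor M M') (tensor N' N)) A^o.
Proof.
move=> MN' MN; apply: bimod_iso_trans (bimod_iso_assoc M M' (tensor N' N)) _.
apply: bimod_iso_trans MN; apply: bimod_iso_tensor (bimod_iso_refl M) _.
apply: bimod_iso_trans (bimod_iso_sym (bimod_iso_assoc M' N' N)) _.
apply: bimod_iso_trans (tens_unitl N).
exact: bimod_iso_tensor MN' (bimod_iso_refl N).
Qed.

Lemma invertible_tensor M N : invertible_bimod M -> invertible_bimod N ->
  invertible_bimod (tensor M N).
Proof.
move=> [M' [MM' /bimod_iso_sym M'M]] [N' [NN' /bimod_iso_sym N'N]].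
by apply: (@invertible_inv _ (tensor N' M')); apply: tensor_cancel.
Qed.

(** [closed] is [Pic] itself, or the subgroup fixing a pair of filters. *)
Lemma Pic_is_group (closed : bimodType A A -> Prop) :
    closed A^o ->
    (forall M N, closed M -> closed N -> closed (tensor M N)) ->
    (forall M, closed M -> invertible_bimod M) ->
    (forall M N, closed M -> bimod_iso (tensor M N) A^o ->
       bimod_iso (tensor N M) A^o -> closed N) ->
  is_group (fun C => exists2 M, closed M & C = iso_class M)
    (Pic_mul A) (Pic_one A).
Proof.
move=> c1 cM cI cV; split.
- move=> _ _ [M cMM ->] [N cN ->]; rewrite Pic_mulE.
  by exists (tensor M N) => //; apply: cM.
- move=> _ _ _ [M _ ->] [N _ ->] [P _ ->]; rewrite !Pic_mulE.
  exact/esym/iso_classP/bimod_iso_assoc.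
- by exists A^o.
- move=> _ [M _ ->]; rewrite /Pic_one !Pic_mulE.
  by split; apply/iso_classP; [apply: tens_unitl|apply: tens_unitr].
- move=> _ [M cMM ->]; have [N [MN /bimod_iso_sym NM]] := cI M cMM.
  exists (iso_class N); first by exists N => //; apply: cV MN NM.
  by rewrite !Pic_mulE; split; apply/iso_classP.
Qed.

Lemma Pic_group : is_group (Pic A) (Pic_mul A) (Pic_one A).
Proof.
apply: Pic_is_group => // [|M N|M N _ MN NM].
- exact: invertible1.
- exact: invertible_tensor.
- exact: invertible_inv NM MN.
Qed.

End PicClasses.

(** * Morita contexts *)

(** The elementwise form of a bimodule homomorphism from [tensor M N] to the ring. *)
Record pairing (A : pzRingType) (M N : bimodType A A) (al : M -> N -> A) :
    Prop := {
  pairDl : forall n, {morph al^~ n : x y / x + y};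
  pairDr : forall m, {morph al m : x y / x + y};
  pairZl : forall a m n, al (a *: m) n = a * al m n;
  pairZr : forall m n a, al m (n :*r a) = al m n * a;
  pairA : forall m a n, al (m :*r a) n = al m (a *: n)
}.

Lemma pairing_balanced (A : pzRingType) (M N : bimodType A A)
  (al : M -> N -> A) : pairing al -> balanced al.
Proof. by case=> Dl Dr _ _ bal; split. Qed.

Lemma balanced_scale (A : pzRingType) (N : rmodType A) (V : lmodType A)
    (f : N -> A) :
    {morph f : x y / x + y} -> (forall a n, f (n :*r a) = f n * a) ->
  balanced (fun (n : N) (m : V) => f n *: m).
Proof.
move=> fD fA; split=> [m x y|n x y|n a m]; first by rewrite fD scalerDl.
  by rewrite scalerDr.
by rewrite fA scalerA.
Qed.

Lemma balanced_rscale (A : pzRingType) (N : lmodType A) (V : rmodType A)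
    (f : N -> A) :
    {morph f : x y / x + y} -> (forall a n, f (a *: n) = a * f n) ->
  balanced (fun (m : V) (n : N) => m :*r f n).
Proof.
move=> fD fA; split=> [n x y|m x y|m a n]; first by rewrite rscalerDl.
  by rewrite fD rscalerDr.
by rewrite fA rscalerA.
Qed.

Record context (A : pzRingType) (M N : bimodType A A)
    (al : M -> N -> A) (be : N -> M -> A) : Prop := {
  ctx_pairl : pairing al;
  ctx_pairr : pairing be;
  ctxAl : forall m n m', al m n *: m' = m :*r be n m';
  ctxAr : forall n m n', be n m *: n' = n :*r al m n';
  ctx1l : exists s : seq (M * N), \sum_(p <- s) al p.1 p.2 = 1;
  ctx1r : exists t : seq (N * M), \sum_(p <- t) be p.1 p.2 = 1
}.

Lemma context_sym (A : pzRingType) (M N : bimodType A A)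
  (al : M -> N -> A) (be : N -> M -> A) : context al be -> context be al.
Proof. by case. Qed.

Section PairingOfIso.
Variables (A : pzRingType) (M N : bimodType A A) (f : tensor M N -> A^o).
Hypothesis fP : bimod_isom f.

Let al m n : A := f (tens m n).

Lemma pairing_iso : pairing al.
Proof.
case: fP => -[fD fl] [_ fr] _; split=> [n x y|m x y|a m n|m n a|m a n].
- by rewrite /al tensDl fD.
- by rewrite /al tensDr fD.
- by rewrite /al -scale_tens fl.
- by rewrite /al -rscale_tens fr.
- by rewrite /al tensA.
Qed.

Lemma pairing_iso_sum s : \sum_(p <- s) al p.1 p.2 = f (tens_sum s).
Proof. by case: fP => -[fD _] _ _; rewrite tens_sumE morph_add_sum. Qed.

Lemma pairing_iso_surj : exists s : seq (M * N), \sum_(p <- s) al p.1 p.2 = 1.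
Proof.
case: fP => _ _ [g _ gK]; have [s gE] := tens_sum_surj (g 1).
by exists s; rewrite pairing_iso_sum -gE gK.
Qed.

(** Injectivity of [f] as a transfer principle: sums of pure tensors with the same value are the
    same tensor, so no balanced map separates them. *)
Lemma pairing_iso_inj (Z : zmodType) (g : M -> N -> Z) s t : balanced g ->
  \sum_(p <- s) al p.1 p.2 = \sum_(p <- t) al p.1 p.2 ->
  \sum_(p <- s) g p.1 p.2 = \sum_(p <- t) g p.1 p.2.
Proof.
case: fP => _ _ /bij_inj fI gP; rewrite !pairing_iso_sum => /fI.
by move=> /tens_sumP/balanced_rel; apply.
Qed.

End PairingOfIso.

(** The two isomorphisms need not be compatible; they become so after twisting
    the second one by the automorphism [u] of [M] with
    [u (m be0(n, m')) = al(m, n) m']. *)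
Lemma iso_context (A : pzRingType) (M N : bimodType A A) :
  bimod_iso (tensor M N) A^o -> bimod_iso (tensor N M) A^o ->
  exists (al : M -> N -> A) (be : N -> M -> A), context al be.
Proof.
case=> f fP [g gP].
pose al m n : A := f (tens m n); pose be0 n m : A := g (tens n m).
have alP : pairing al := pairing_iso fP.
have beP : pairing be0 := pairing_iso gP.
have [s s1] : exists s : seq (M * N), \sum_(p <- s) al p.1 p.2 = 1.
  exact: pairing_iso_surj fP.
have [t t1] : exists t : seq (N * M), \sum_(p <- t) be0 p.1 p.2 = 1.
  exact: pairing_iso_surj gP.
(* Writing [m] as the sum of the [m :*r be0 p.1 p.2] over [t] leaves this as the only candidate for
   the twist. Its inverse [w] is obtained likewise from [s]. *)
pose u m := \sum_(p <- t) al m p.1 *: p.2.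
pose w m := \sum_(p <- s) p.1 :*r be0 p.2 m.
have uD : {morph u : x y / x + y}.
  move=> x y; rewrite /u -big_split; apply: eq_bigr => p _.
  by rewrite (pairDl alP) scalerDl.
have wD : {morph w : x y / x + y}.
  move=> x y; rewrite /w -big_split; apply: eq_bigr => p _.
  by rewrite (pairDr beP) rscalerDr.
have uZ a m : u (a *: m) = a *: u m.
  by rewrite /u scaler_sumr; apply: eq_bigr => p _;
    rewrite (pairZl alP) scalerA.
have uE m n m' : u (m :*r be0 n m') = al m n *: m'.
  have gB : balanced (fun (n : N) (m' : M) => al m n *: m').
    by apply: (@balanced_scale _ _ _ (al m)) => [x y|a x];
      [apply: (pairDr alP)|apply: (pairZr alP)].
  (* Both sequences have the value [be0 n m'] under [g], since the values over [t] add up to 1; so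
     they represent the same tensor. *)
  have := pairing_iso_inj gP (s := [seq (be0 n m' *: p.1, p.2) | p <- t])
    (t := [:: (n, m')]) gB.
  rewrite !big_map !big_seq1 /= => <-.
    by apply: eq_bigr => p _; rewrite (pairA alP).
  rewrite -[RHS]mulr1 -t1 mulr_sumr.
  by apply: eq_bigr => p _; rewrite /= -/(be0 _ _) (pairZl beP).
have wE m n m' : w (al m n *: m') = m :*r be0 n m'.
  have gB : balanced (fun (m : M) (n : N) => m :*r be0 n m').
    by apply: (@balanced_rscale _ _ _ (be0^~ m')) => [x y|a x];
      [apply: (pairDl beP)|apply: (pairZl beP)].
  have := pairing_iso_inj fP (s := [seq (p.1, p.2 :*r al m n) | p <- s])
    (t := [:: (m, n)]) gB.
  rewrite !big_map !big_seq1 /= => <-.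
    by apply: eq_bigr => p _; rewrite (pairA beP).
  rewrite -[RHS]mul1r -s1 mulr_suml.
  by apply: eq_bigr => p _; rewrite /= -/(al _ _) (pairZr alP).
have uK m : w (u m) = m.
  rewrite /u (morph_add_sum wD) -[RHS]rscaler1 -t1 rscale_sumr.
  by apply: eq_bigr => p _; rewrite wE.
have wK m : u (w m) = m.
  rewrite {1}/w (morph_add_sum uD) -[RHS]scale1r -s1 scaler_suml.
  by apply: eq_bigr => p _; rewrite uE.
have uR m a : u (m :*r a) = u m :*r a.
  rewrite -[m in LHS]rscaler1 rscalerA -t1 mulr_suml rscale_sumr (morph_add_sum
    uD).
  rewrite [u m in RHS]/u rscale_suml; apply: eq_bigr => p _.
  by rewrite -(pairZr beP) uE scale_rscale.
have assoc m n m' : al m n *: m' = m :*r be0 n (u m').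
  by apply: (can_inj uK); rewrite uE uZ.
(* If [al p.2 x] vanishes, then so does the tensor of [p.2] and [x], and with it [be0 p.1 p.2 *: x].
   Summing over [t] returns [x]. *)
have nondeg x : (forall m, al m x = 0) -> x = 0.
  move=> x0; rewrite -[x]scale1r -t1 scaler_suml big1 // => p _.
  have gB : balanced (fun (m : M) (n : N) => be0 p.1 m *: n).
    by apply: (@balanced_scale _ _ _ (be0 p.1)) => [y z|a y];
      [apply: (pairDr beP)|apply: (pairZr beP)].
  have := pairing_iso_inj fP (s := [:: (p.2, x)]) (t := [::]) gB.
  by rewrite !big_seq1 !big_nil; apply; apply: x0.
exists al, (fun n m => be0 n (u m)); split=> //.
- split=> [n x y|m x y|a m n|m n a|m a n].
  + exact: (pairDl beP).
  + by rewrite uD (pairDr beP).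
  + exact: (pairZl beP).
  + by rewrite uR (pairZr beP).
  + by rewrite (pairA beP) uZ.
(* The second associativity law follows from the first: paired with an arbitrary [m0], both sides
   become [al m0 n * al m n'], and [nondeg] concludes. *)
- move=> n m n'; apply/eqP; rewrite -subr_eq0; apply/eqP/nondeg => m0.
  rewrite (pairDr alP) (morph_addN (pairDr alP m0)) -(pairA alP) -assoc.
  by rewrite (pairZl alP) (pairZr alP) subrr.
- by exists s.
- exists [seq (p.1, w p.2) | p <- t]; rewrite big_map -[RHS]t1.
  by apply: eq_bigr => p _; rewrite wK.
Qed.

Lemma invertible_context (A : pzRingType) (M : bimodType A A) :
  invertible_bimod M ->
  exists (N : bimodType A A) (al : M -> N -> A) (be : N -> M -> A),
    context al be.
Proof.
by move=> [N [MN /bimod_iso_sym NM]]; exists N; apply: iso_context.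
Qed.

Section Context.
Variables (A : pzRingType) (M N : bimodType A A).
Variables (al : M -> N -> A) (be : N -> M -> A).
Hypothesis ctx : context al be.
Let alP := ctx_pairl ctx.
Let beP := ctx_pairr ctx.

Lemma context_nondegl m : (forall n, al m n = 0) -> m = 0.
Proof.
move=> m0; have [t t1] := ctx1r ctx.
rewrite -[m]rscaler1 -t1 rscale_sumr big1 // => p _.
by rewrite -(ctxAl ctx) m0 scale0r.
Qed.

(** Surjectivity forces injectivity. The inverse multiplies a fixed preimage of 1 by [a]; the two
    associativity laws carry [al m n] from the left of that preimage to its right, where the
    preimage contracts to 1 again. *)
Lemma context_iso : bimod_iso (tensor M N) A^o.
Proof.
have bP := pairing_balanced alP.
have [s s1] := ctx1l ctx.
exists (tens_map al : tensor M N -> A^o); split.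
- split; first exact: tens_mapD.
  by apply: (tens_map_scale (Z := A^o) bP) => *; apply: (pairZl alP).
- split; first exact: tens_mapD.
  by apply: (tens_map_rscale (Z := A^o) bP) => *; apply: (pairZr alP).
exists (fun a : A^o => \sum_(p <- s) tens ((a : A) *: p.1) p.2).
- apply: tensor_ext => [x y|//|m n]; first rewrite -big_split /=.
    by apply: eq_bigr => p _; rewrite tens_mapD // scalerDl tensDl.
  rewrite tens_mapE //; transitivity (\sum_(p <- s) tens m (n :*r al p.1 p.2)).
    by apply: eq_bigr => p _; rewrite (ctxAl ctx) tensA (ctxAr ctx).
  by rewrite -tens_sumr -rscale_sumr s1 rscaler1.
- move=> a; rewrite (morph_add_sum (tens_mapD bP)) -[RHS]mulr1 -s1 mulr_sumr.
  by apply: eq_bigr => p _; rewrite tens_mapE // (pairZl alP).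
Qed.

End Context.

Lemma context_invertible (A : pzRingType) (M N : bimodType A A)
    (al : M -> N -> A) (be : N -> M -> A) :
  context al be -> invertible_bimod M.
Proof.
move=> ctx; apply: (@invertible_inv _ M N); first exact: context_iso ctx.
exact: context_iso (context_sym ctx).
Qed.

(** * Cyclic torsion modules *)

Section QuotientGroup.
Local Open Scope quotient_scope.
Variables (V : zmodType) (K : set V).
Hypotheses (K0 : K 0) (KD : forall x y, K x -> K y -> K (x + y)).
Hypothesis KN : forall x, K x -> K (- x).

(** The proofs are unused arguments; they let the canonical equivalence
    structure be recovered from the relation. *)
Definition coset_relb (_ : K 0) (_ : forall x y, K x -> K y -> K (x + y))
    (_ : forall x, K x -> K (- x)) (x y : V) : bool := `[< K (x - y) >].
Local Notation rel := (coset_relb K0 KD KN).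

Fact coset_equiv : equiv_class_of rel.
Proof.
split.
- by move=> x; apply/asboolP; rewrite subrr.
- move=> x y; apply/asboolP/asboolP => /KN; by rewrite opprB.
- move=> y x z /asboolP xy /asboolP yz; apply/asboolP.
  by have := KD xy yz; rewrite addrA subrK.
Qed.

Canonical coset_equiv_rel := EquivRelPack coset_equiv.

Definition quotient_group : Type := {eq_quot rel}.
HB.instance Definition _ := Choice.on quotient_group.
HB.instance Definition _ := Quotient.on quotient_group.

Definition quot_pi (x : V) : quotient_group := \pi_(quotient_group) x.

Lemma quot_piP x y : quot_pi x = quot_pi y <-> K (x - y).
Proof.
split; first by move/eqquotP/asboolP.
by move=> xy; apply/eqquotP/asboolP.
Qed.

Lemma quot_piK (u : quotient_group) : quot_pi (repr u) = u.
Proof. exact: reprK. Qed.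

Definition quot_add (u v : quotient_group) : quotient_group :=
  quot_pi (repr u + repr v).
Definition quot_opp (u : quotient_group) : quotient_group := quot_pi (- repr u).

Lemma quot_repr x : K (repr (quot_pi x) - x).
Proof. by apply/quot_piP; rewrite quot_piK. Qed.

Lemma quot_addE x y : quot_add (quot_pi x) (quot_pi y) = quot_pi (x + y).
Proof.
by apply/quot_piP; rewrite opprD addrACA; apply: KD; apply: quot_repr.
Qed.

Lemma quot_oppE x : quot_opp (quot_pi x) = quot_pi (- x).
Proof. by apply/quot_piP; rewrite -opprD; apply/KN/quot_repr. Qed.

Fact quot_addA : associative quot_add.
Proof.
move=> u v w; rewrite -(quot_piK u) -(quot_piK v) -(quot_piK w).
by rewrite !quot_addE addrA.
Qed.

Fact quot_addC : commutative quot_add.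
Proof. by move=> u v; rewrite /quot_add addrC. Qed.

Fact quot_add0 : left_id (quot_pi 0) quot_add.
Proof. by move=> u; rewrite -(quot_piK u) quot_addE add0r. Qed.

Fact quot_addN : left_inverse (quot_pi 0) quot_opp quot_add.
Proof. by move=> u; rewrite -(quot_piK u) quot_oppE quot_addE addNr. Qed.

HB.instance Definition _ :=
  GRing.isZmodule.Build quotient_group quot_addA quot_addC quot_add0 quot_addN.

Lemma quot_piD : {morph quot_pi : x y / x + y}.
Proof. by move=> x y; rewrite -quot_addE. Qed.

Lemma quot_pi_eq0 x : quot_pi x = 0 <-> K x.
Proof. by rewrite (quot_piP x 0) subr0. Qed.

End QuotientGroup.

Section CyclicRight.
Variables (R : pzRingType) (s : R).

Let K : set R := [set s * a | a in [set: R]].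
Fact rprincipal0 : K 0. Proof. by exists 0; rewrite ?mulr0. Qed.
Fact rprincipalD x y : K x -> K y -> K (x + y).
Proof. by move=> [a _ <-] [b _ <-]; exists (a + b); rewrite ?mulrDr. Qed.
Fact rprincipalN x : K x -> K (- x).
Proof. by move=> [a _ <-]; exists (- a); rewrite ?mulrN. Qed.

Definition rcyclic : Type :=
  quotient_group rprincipal0 rprincipalD rprincipalN.
HB.instance Definition _ := GRing.Zmodule.on rcyclic.

Definition rcyclic_pi (x : R) : rcyclic := quot_pi _ _ _ x.

Lemma rcyclic_piD : {morph rcyclic_pi : x y / x + y}.
Proof. exact: quot_piD. Qed.

Lemma rcyclic_pi_eq0 x : rcyclic_pi x = 0 <-> exists a, x = s * a.
Proof.
split=> [/quot_pi_eq0[a _ <-]|[a ->]]; first by exists a.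
by apply/quot_pi_eq0; exists a.
Qed.

Lemma rcyclic_surj u : exists x, u = rcyclic_pi x.
Proof. by exists (repr u); rewrite /rcyclic_pi quot_piK. Qed.

Let act (u : rcyclic) (r : R) : rcyclic := rcyclic_pi (repr u * r).

Lemma rcyclic_actE x r : act (rcyclic_pi x) r = rcyclic_pi (x * r).
Proof.
apply/quot_piP; rewrite -mulrBl.
have [a _ <-] := quot_repr rprincipal0 rprincipalD rprincipalN x.
by exists (a * r); rewrite ?mulrA.
Qed.

Fact rcyclicA u a b : act (act u a) b = act u (a * b).
Proof. by have [x ->] := rcyclic_surj u; rewrite !rcyclic_actE mulrA. Qed.
Fact rcyclic1 u : act u 1 = u.
Proof. by have [x ->] := rcyclic_surj u; rewrite !rcyclic_actE mulr1. Qed.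
Fact rcyclicDl a : {morph act^~ a : u v / u + v}.
Proof.
move=> u v; have [x ->] := rcyclic_surj u; have [y ->] := rcyclic_surj v.
by rewrite -rcyclic_piD !rcyclic_actE -rcyclic_piD mulrDl.
Qed.
Fact rcyclicDr u : {morph act u : a b / a + b}.
Proof.
move=> a b; have [x ->] := rcyclic_surj u.
by rewrite !rcyclic_actE -rcyclic_piD mulrDr.
Qed.
HB.instance Definition _ :=
  Zmodule_isRmodule.Build R rcyclic rcyclicA rcyclic1 rcyclicDl rcyclicDr.

Lemma rcyclic_piZ x r : rcyclic_pi x :*r r = rcyclic_pi (x * r).
Proof. exact: rcyclic_actE. Qed.

End CyclicRight.

Section CyclicLeft.
Variables (R : pzRingType) (s : R).

Let K : set R := [set a * s | a in [set: R]].
Fact lprincipal0 : K 0. Proof. by exists 0; rewrite ?mul0r. Qed.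
Fact lprincipalD x y : K x -> K y -> K (x + y).
Proof. by move=> [a _ <-] [b _ <-]; exists (a + b); rewrite ?mulrDl. Qed.
Fact lprincipalN x : K x -> K (- x).
Proof. by move=> [a _ <-]; exists (- a); rewrite ?mulNr. Qed.

Definition lcyclic : Type :=
  quotient_group lprincipal0 lprincipalD lprincipalN.
HB.instance Definition _ := GRing.Zmodule.on lcyclic.

Definition lcyclic_pi (x : R) : lcyclic := quot_pi _ _ _ x.

Lemma lcyclic_piD : {morph lcyclic_pi : x y / x + y}.
Proof. exact: quot_piD. Qed.

Lemma lcyclic_pi_eq0 x : lcyclic_pi x = 0 <-> exists a, x = a * s.
Proof.
split=> [/quot_pi_eq0[a _ <-]|[a ->]]; first by exists a.
by apply/quot_pi_eq0; exists a.
Qed.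

Lemma lcyclic_surj u : exists x, u = lcyclic_pi x.
Proof. by exists (repr u); rewrite /lcyclic_pi quot_piK. Qed.

Let act (r : R) (u : lcyclic) : lcyclic := lcyclic_pi (r * repr u).

Lemma lcyclic_actE r x : act r (lcyclic_pi x) = lcyclic_pi (r * x).
Proof.
apply/quot_piP; rewrite -mulrBr.
have [a _ <-] := quot_repr lprincipal0 lprincipalD lprincipalN x.
by exists (r * a); rewrite ?mulrA.
Qed.

Fact lcyclicA a b u : act a (act b u) = act (a * b) u.
Proof. by have [x ->] := lcyclic_surj u; rewrite !lcyclic_actE mulrA. Qed.
Fact lcyclic1 : left_id 1 act.
Proof. by move=> u; have [x ->] := lcyclic_surj u;
  rewrite !lcyclic_actE mul1r. Qed.
Fact lcyclicDr : right_distributive act +%R.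
Proof.
move=> a u v; have [x ->] := lcyclic_surj u; have [y ->] := lcyclic_surj v.
by rewrite -lcyclic_piD !lcyclic_actE -lcyclic_piD mulrDr.
Qed.
Fact lcyclicDl u : {morph act^~ u : a b / a + b}.
Proof.
move=> a b; have [x ->] := lcyclic_surj u.
by rewrite !lcyclic_actE -lcyclic_piD mulrDl.
Qed.
HB.instance Definition _ :=
  GRing.Zmodule_isLmodule.Build R lcyclic lcyclicA lcyclic1 lcyclicDr lcyclicDl.

Lemma lcyclic_piZ r x : r *: lcyclic_pi x = lcyclic_pi (r * x).
Proof. exact: lcyclic_actE. Qed.

End CyclicLeft.

(** * The filter conditions *)

Section Sharp.
Variables (R : pzRingType) (S : set R).
Hypothesis SP : regular_ore_set S.

Lemma common_right_multiple s t : S s -> S t ->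
  exists a b, S (s * a) /\ s * a = t * b.
Proof.
move=> Ss St; have [a [b [Sb e]]] := ore_right SP t Ss.
by exists a, b; rewrite -e; split=> //; apply: (ore_mul SP).
Qed.

Lemma common_left_multiple s t : S s -> S t ->
  exists a b, S (a * s) /\ a * s = b * t.
Proof.
move=> Ss St; have [a [b [Sb e]]] := ore_left SP t Ss.
by exists a, b; rewrite -e; split=> //; apply: (ore_mul SP).
Qed.

Definition right_ore_bimod (M : bimodType R R) : Prop :=
  forall (m : M) s, S s -> exists m' s', S s' /\ m :*r s' = s *: m'.

Definition left_ore_bimod (M : bimodType R R) : Prop :=
  forall (m : M) s, S s -> exists m' s', S s' /\ s' *: m = m' :*r s.

(** The annihilator of [x] is a right ideal, so it belongs to the filter as soon as it contains one
    element of [S]. *)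
Lemma rtorsP (X : rmodType R) (x : X) :
  (exists2 D, Dr S D & forall r, D r -> x :*r r = 0) <->
  exists2 s, S s & x :*r s = 0.
Proof.
split=> [[D [_ [s [Ds Ss]]] xD]|[s Ss xs]]; first by exists s => //; apply: xD.
exists [set r | x :*r r = 0] => //; split; last by exists s.
split=> /= [|a b xa xb|a r xa]; first by rewrite rscaler0.
  by rewrite rscalerDr xa xb addr0.
by rewrite -rscalerA xa rscale0r.
Qed.

Lemma ltorsP (X : lmodType R) (x : X) :
  (exists2 D, Dl S D & forall r, D r -> r *: x = 0) <->
  exists2 s, S s & s *: x = 0.
Proof.
split=> [[D [_ [s [Ds Ss]]] xD]|[s Ss xs]]; first by exists s => //; apply: xD.
exists [set r | r *: x = 0] => //; split; last by exists s.
split=> /= [|a b xa xb|r a xa]; first by rewrite scale0r.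
  by rewrite scalerDl xa xb addr0.
by rewrite -scalerA xa scaler0.
Qed.

Lemma rtors_add (X : rmodType R) (x y : X) :
  (exists2 s, S s & x :*r s = 0) -> (exists2 s, S s & y :*r s = 0) ->
  exists2 s, S s & (x + y) :*r s = 0.
Proof.
move=> [s Ss xs] [t St yt].
have [a [b [Sa e]]] := common_right_multiple Ss St.
exists (s * a) => //; rewrite rscalerDl -rscalerA xs rscale0r add0r.
by rewrite e -rscalerA yt rscale0r.
Qed.

Lemma ltors_add (X : lmodType R) (x y : X) :
  (exists2 s, S s & s *: x = 0) -> (exists2 s, S s & s *: y = 0) ->
  exists2 s, S s & s *: (x + y) = 0.
Proof.
move=> [s Ss xs] [t St yt].
have [a [b [Sa e]]] := common_left_multiple Ss St.
exists (a * s) => //; rewrite scalerDr -scalerA xs scaler0 add0r.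
by rewrite e -scalerA yt scaler0.
Qed.

Lemma rtorsion_iso (X Y : rmodType R) :
  rmod_iso X Y -> rtorsion S X -> rtorsion S Y.
Proof.
move=> [f [[fD fr] [g _ gK]]] Xt y; apply/rtorsP.
have /rtorsP[s Ss gs] := Xt (g y); exists s => //.
by rewrite -[y]gK -fr gs (morph_add0 fD).
Qed.

Lemma ltorsion_iso (X Y : lmodType R) :
  lmod_iso X Y -> ltorsion S X -> ltorsion S Y.
Proof.
move=> [f [[fD fl] [g _ gK]]] Xt y; apply/ltorsP.
have /ltorsP[s Ss gs] := Xt (g y); exists s => //.
by rewrite -[y]gK -fl gs (morph_add0 fD).
Qed.

Lemma rtorsion_tensor (X : rmodType R) (M : bimodType R R) :
  right_ore_bimod M -> rtorsion S X -> rtorsion S (tensor X M).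
Proof.
move=> Mo Xt t; apply/rtorsP; elim/tensor_ind: t => [|t u tt tu|x m].
- by exists 1; [apply: (ore_one SP)|rewrite rscale0r].
- exact: rtors_add.
- have /rtorsP[s Ss xs] := Xt x; have [m' [s' [Ss' e]]] := Mo m s Ss.
  by exists s' => //; rewrite rscale_tens e -tensA xs tens0l.
Qed.

Lemma ltorsion_tensor (X : lmodType R) (M : bimodType R R) :
  left_ore_bimod M -> ltorsion S X -> ltorsion S (tensor M X).
Proof.
move=> Mo Xt t; apply/ltorsP; elim/tensor_ind: t => [|t u tt tu|m x].
- by exists 1; [apply: (ore_one SP)|rewrite scaler0].
- exact: ltors_add.
- have /ltorsP[s Ss xs] := Xt x; have [m' [s' [Ss' e]]] := Mo m s Ss.
  by exists s' => //; rewrite scale_tens e tensA xs tens0r.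
Qed.

Section WithContext.
Variables (M N : bimodType R R) (al : M -> N -> R) (be : N -> M -> R).
Hypothesis ctx : context al be.
Let alP := ctx_pairl ctx.
Let beP := ctx_pairr ctx.

Definition rcontract (X : rmodType R) (n : N) : tensor X M -> X :=
  tens_map (fun x m => x :*r al m n).

Lemma rcontract_balanced (X : rmodType R) (n : N) :
  balanced (fun (x : X) (m : M) => x :*r al m n).
Proof.
by apply: (@balanced_rscale _ _ _ (al^~ n)) => [x y|a x];
  [apply: (pairDl alP)|apply: (pairZl alP)].
Qed.

Lemma rcontractE (X : rmodType R) (n : N) (x : X) (m : M) :
  rcontract n (tens x m) = x :*r al m n.
Proof. by rewrite /rcontract tens_mapE //; apply: rcontract_balanced. Qed.

Lemma rcontractD (X : rmodType R) (n : N) :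
  {morph @rcontract X n : t u / t + u}.
Proof. exact: tens_mapD (rcontract_balanced X n). Qed.

Lemma rcontractZ (X : rmodType R) (n : N) (r : R) (t : tensor X M) :
  rcontract n (t :*r r) = rcontract (r *: n) t.
Proof.
move: t; apply: tensor_ext => [t u|t u|x m].
- by rewrite rscalerDl rcontractD.
- by rewrite rcontractD.
- by rewrite rscale_tens !rcontractE (pairA alP).
Qed.

Lemma rcontractZr (X : rmodType R) (n : N) (r : R) (t : tensor X M) :
  rcontract (n :*r r) t = rcontract n t :*r r.
Proof.
move: t; apply: tensor_ext => [t u|t u|x m].
- by rewrite rcontractD.
- by rewrite rcontractD rscalerDl.
- by rewrite !rcontractE (pairZr alP) rscalerA.
Qed.

(** The contractions are coordinates: a decomposition of 1 through [be] is a dual basis that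
    rebuilds [t] from finitely many of them. *)
Lemma rcontract_eq0 (X : rmodType R) (t : tensor X M) :
  (forall n, rcontract n t = 0) -> t = 0.
Proof.
have [d d1] := ctx1r ctx.
suff tE : t = \sum_(p <- d) tens (rcontract p.1 t) p.2.
  by move=> t0; rewrite tE big1 // => p _; rewrite t0 tens0l.
move: t; apply: tensor_ext => [//|t u|x m].
  rewrite -big_split; apply: eq_bigr => p _.
  by rewrite rcontractD tensDl.
rewrite -[m in LHS]rscaler1 -d1 rscale_sumr tens_sumr; apply: eq_bigr => p _.
by rewrite rcontractE tensA (ctxAl ctx).
Qed.

Definition lcontract (X : lmodType R) (n : N) : tensor M X -> X :=
  tens_map (fun m x => be n m *: x).

Lemma lcontract_balanced (X : lmodType R) (n : N) :
  balanced (fun (m : M) (x : X) => be n m *: x).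
Proof.
by apply: (@balanced_scale _ _ _ (be n)) => [x y|a x];
  [apply: (pairDr beP)|apply: (pairZr beP)].
Qed.

Lemma lcontractE (X : lmodType R) (n : N) (x : X) (m : M) :
  lcontract n (tens m x) = be n m *: x.
Proof. by rewrite /lcontract tens_mapE //; apply: lcontract_balanced. Qed.

Lemma lcontractD (X : lmodType R) (n : N) :
  {morph @lcontract X n : t u / t + u}.
Proof. exact: tens_mapD (lcontract_balanced X n). Qed.

Lemma lcontractZ (X : lmodType R) (n : N) (r : R) (t : tensor M X) :
  lcontract n (r *: t) = lcontract (n :*r r) t.
Proof.
move: t; apply: tensor_ext => [t u|t u|m x].
- by rewrite scalerDr lcontractD.
- by rewrite lcontractD.
- by rewrite scale_tens !lcontractE (pairA beP).
Qed.

Lemma lcontractZl (X : lmodType R) (n : N) (r : R) (t : tensor M X) :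
  lcontract (r *: n) t = r *: lcontract n t.
Proof.
move: t; apply: tensor_ext => [t u|t u|m x].
- by rewrite lcontractD.
- by rewrite lcontractD scalerDr.
- by rewrite !lcontractE (pairZl beP) scalerA.
Qed.

Lemma lcontract_eq0 (X : lmodType R) (t : tensor M X) :
  (forall n, lcontract n t = 0) -> t = 0.
Proof.
have [d d1] := ctx1l ctx.
suff tE : t = \sum_(p <- d) tens p.1 (lcontract p.2 t).
  by move=> t0; rewrite tE big1 // => p _; rewrite t0 tens0r.
move: t; apply: tensor_ext => [//|t u|m x].
  rewrite -big_split; apply: eq_bigr => p _.
  by rewrite lcontractD tensDr.
rewrite -[m in LHS]scale1r -d1 scaler_suml tens_suml; apply: eq_bigr => p _.
by rewrite lcontractE -tensA (ctxAl ctx).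
Qed.

(** Torsion is read off from the contractions against [n]. To use [t s = 0] there, [s] has to move
    past [n], which is the Ore condition on the inverse bimodule. *)
Lemma rtorsion_free_tensor (X : rmodType R) :
  right_ore_bimod N -> rtorsion_free S X -> rtorsion_free S (tensor X M).
Proof.
move=> No Xf t /rtorsP[s Ss ts]; apply: rcontract_eq0 => n; apply: Xf.
have [n' [s' [Ss' e]]] := No n s Ss; apply/rtorsP; exists s' => //.
by rewrite -rcontractZr e -rcontractZ ts (morph_add0 (@rcontractD X n')).
Qed.

Lemma ltorsion_free_tensor (X : lmodType R) :
  left_ore_bimod N -> ltorsion_free S X -> ltorsion_free S (tensor M X).
Proof.
move=> No Xf t /ltorsP[s Ss ts]; apply: lcontract_eq0 => n; apply: Xf.
have [n' [s' [Ss' e]]] := No n s Ss; apply/ltorsP; exists s' => //.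
by rewrite -lcontractZl e -lcontractZ ts (morph_add0 (@lcontractD X n')).
Qed.

Lemma rtensor_cancel (X : rmodType R) : rmod_iso (tensor (tensor X M) N) X.
Proof.
apply: rmod_iso_trans (tens_unitr_iso X).
apply: (@rmod_iso_trans _ _ (tensor X (tensor M N))).
  exists (@tens_assocr _ _ X M N); split; first exact: tens_assocr_rmod_hom.
  exact: tens_assocr_bij.
exact: rmod_iso_tensor (rmod_iso_refl X) (context_iso ctx).
Qed.

Lemma ltensor_cancel (X : lmodType R) : lmod_iso (tensor M (tensor N X)) X.
Proof.
apply: lmod_iso_trans (tens_unitl_iso X).
apply: (@lmod_iso_trans _ _ (tensor (tensor M N) X)).
  apply: lmod_iso_sym.
  exists (@tens_assocr _ _ M N X); split; first exact: tens_assocr_lmod_hom.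
  exact: tens_assocr_bij.
exact: lmod_iso_tensor (context_iso ctx) (lmod_iso_refl X).
Qed.

(** [R / sR] is torsion, so some [s'] in [S] annihilates [1 (x) m]. *)
Lemma rtorsion_right_ore :
  (forall X : rmodType R, rtorsion S X -> rtorsion S (tensor X M)) ->
  right_ore_bimod M.
Proof.
move=> Mt m s Ss.
have cyc : rtorsion S (rcyclic s).
  move=> u; apply/rtorsP; have [x ->] := rcyclic_surj u.
  have [r [t [St e]]] := ore_right SP x Ss; exists t => //.
  by rewrite rcyclic_piZ e; apply/rcyclic_pi_eq0; exists r.
have /rtorsP[s' Ss' e] := Mt _ cyc (tens (rcyclic_pi s 1) m).
have inK n : exists a, al (m :*r s') n = s * a.
  apply/rcyclic_pi_eq0; have := rcontractE n (rcyclic_pi s 1) (m :*r s').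
  rewrite -rscale_tens e rcyclic_piZ mul1r => <-.
  exact: (morph_add0 (@rcontractD _ n)).
have [a aE] := boolp.choice inK; have [d d1] := ctx1r ctx.
(* The dual basis [d] expresses [m :*r s'] with coefficients [al (m :*r s') p.1], each of which is
   [s * a p.1]; the common left factor [s] comes out. *)
exists (\sum_(p <- d) a p.1 *: p.2), s'; split=> //.
rewrite -[m :*r s']rscaler1 -d1 rscale_sumr scaler_sumr.
by apply: eq_bigr => p _; rewrite -(ctxAl ctx) aE scalerA.
Qed.

Lemma ltorsion_left_ore :
  (forall X : lmodType R, ltorsion S X -> ltorsion S (tensor M X)) ->
  left_ore_bimod M.
Proof.
move=> Mt m s Ss.
have cyc : ltorsion S (lcyclic s).
  move=> u; apply/ltorsP; have [x ->] := lcyclic_surj u.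
  have [r [t [St e]]] := ore_left SP x Ss; exists t => //.
  by rewrite lcyclic_piZ e; apply/lcyclic_pi_eq0; exists r.
have /ltorsP[s' Ss' e] := Mt _ cyc (tens m (lcyclic_pi s 1)).
have inK n : exists a, be n (s' *: m) = a * s.
  apply/lcyclic_pi_eq0; have := lcontractE n (lcyclic_pi s 1) (s' *: m).
  rewrite -scale_tens e lcyclic_piZ mulr1 => <-.
  exact: (morph_add0 (@lcontractD _ n)).
have [a aE] := boolp.choice inK; have [d d1] := ctx1l ctx.
exists (\sum_(p <- d) p.1 :*r a p.2), s'; split=> //.
rewrite -[s' *: m]scale1r -d1 scaler_suml rscale_suml.
by apply: eq_bigr => p _; rewrite (ctxAl ctx) aE rscalerA.
Qed.

End WithContext.

Lemma context_Tsharp (M N : bimodType R R) (al : M -> N -> R)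
    (be : N -> M -> R) : context al be ->
  Tsharp_fixed S M <-> right_ore_bimod M /\ right_ore_bimod N.
Proof.
move=> ctx; have ctx' := context_sym ctx; split=> [[[Mt Mto] _]|[Mo No]].
  split; first exact: rtorsion_right_ore ctx Mt.
  (* Surjectivity on torsion modules gives the condition on [N]: a torsion [X] is [Y (x) M] with [Y]
     torsion, and then [X (x) N] is isomorphic to [Y]. *)
  apply: (rtorsion_right_ore ctx') => X /Mto[Y Yt YX].
  apply: rtorsion_iso Yt.
  apply: rmod_iso_trans (rmod_iso_sym (rtensor_cancel ctx Y)) _.
  exact: rmod_iso_tensor YX (bimod_iso_refl N).
split; split=> [X|Y Yt]; last 2 first.
- by apply: (rtorsion_free_tensor ctx).
- exists (tensor Y N); first exact: (rtorsion_free_tensor ctx').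
  exact: rtensor_cancel ctx' Y.
- exact: rtorsion_tensor.
- exists (tensor Y N); first exact: rtorsion_tensor.
  exact: rtensor_cancel ctx' Y.
Qed.

Lemma context_Usharp (M N : bimodType R R) (al : M -> N -> R)
    (be : N -> M -> R) : context al be ->
  Usharp_fixed S M <-> left_ore_bimod M /\ left_ore_bimod N.
Proof.
move=> ctx; have ctx' := context_sym ctx; split=> [[[Mt Mto] _]|[Mo No]].
  split; first exact: ltorsion_left_ore ctx Mt.
  apply: (ltorsion_left_ore ctx') => X /Mto[Y Yt YX].
  apply: ltorsion_iso Yt.
  apply: lmod_iso_trans (lmod_iso_sym (ltensor_cancel ctx' Y)) _.
  exact: lmod_iso_tensor (bimod_iso_refl N) YX.
split; split=> [X|Y Yt]; last 2 first.
- by apply: (ltorsion_free_tensor ctx).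
- exists (tensor N Y); first exact: (ltorsion_free_tensor ctx').
  exact: ltensor_cancel ctx Y.
- exact: ltorsion_tensor.
- exists (tensor N Y); first exact: ltorsion_tensor.
  exact: ltensor_cancel ctx Y.
Qed.

Definition ore_bimod (M : bimodType R R) : Prop :=
  right_ore_bimod M /\ left_ore_bimod M.

Lemma ore_bimod_iso (M M' : bimodType R R) :
  bimod_iso M M' -> ore_bimod M -> ore_bimod M'.
Proof.
move=> [f [[fD fl] [_ fr] [g _ gK]]] [ro lo]; split=> m s Ss.
  have [m' [s' [Ss' e]]] := ro (g m) s Ss; exists (f m'), s'; split=> //.
  by rewrite -[m]gK -fr e fl.
have [m' [s' [Ss' e]]] := lo (g m) s Ss; exists (f m'), s'; split=> //.
by rewrite -[m]gK -fl e fr.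
Qed.

Lemma ore_bimod1 : ore_bimod (R^o : bimodType R R).
Proof.
split=> m s Ss.
  by have [r [t [St e]]] := ore_right SP m Ss; exists r, t.
by have [r [t [St e]]] := ore_left SP m Ss; exists r, t.
Qed.

Lemma ore_bimod_tensor (M N : bimodType R R) :
  ore_bimod M -> ore_bimod N -> ore_bimod (tensor M N).
Proof.
move=> [Mr Ml] [Nr Nl]; split=> t s Ss.
  elim/tensor_ind: t => [|t u|m n].
  - by exists 0, 1; rewrite rscale0r scaler0; split=> //; apply: (ore_one SP).
  - move=> [t' [a [Sa ta]]] [u' [b [Sb ub]]].
    have [a' [b' [Sab e]]] := common_right_multiple Sa Sb.
    exists (t' :*r a' + u' :*r b'), (a * a'); split=> //.
    rewrite rscalerDl {2}e -!rscalerA ta ub !scale_rscale.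
    by rewrite scalerDr.
  - have [m' [s' [Ss' e]]] := Mr m s Ss.
    have [n' [s'' [Ss'' e']]] := Nr n s' Ss'.
    exists (tens m' n'), s''; split=> //.
    by rewrite rscale_tens e' -tensA e scale_tens.
elim/tensor_ind: t => [|t u|m n].
- by exists 0, 1; rewrite rscale0r scaler0; split=> //; apply: (ore_one SP).
- move=> [t' [a [Sa ta]]] [u' [b [Sb ub]]].
  have [a' [b' [Sab e]]] := common_left_multiple Sa Sb.
  exists (a' *: t' + b' *: u'), (a' * a); split=> //.
  rewrite scalerDr {2}e -!scalerA ta ub -!scale_rscale.
  by rewrite rscalerDl.
- have [n' [s' [Ss' e]]] := Nl n s Ss.
  have [m' [s'' [Ss'' e']]] := Ml m s' Ss'.
  exists (tens m' n'), s''; split=> //.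
  by rewrite scale_tens e' tensA e rscale_tens.
Qed.

Definition filter_bimod (M : bimodType R R) : Prop :=
  [/\ invertible_bimod M, Tsharp_fixed S M & Usharp_fixed S M].

Lemma context_filter_bimod (M N : bimodType R R) (al : M -> N -> R)
    (be : N -> M -> R) : context al be ->
  filter_bimod M <-> ore_bimod M /\ ore_bimod N.
Proof.
move=> ctx; split=> [[_ /(context_Tsharp ctx)[? ?] /(context_Usharp ctx)[?
  ?]]|].
  by [].
move=> [[? ?] [? ?]]; split; first exact: context_invertible ctx.
  by apply/(context_Tsharp ctx).
by apply/(context_Usharp ctx).
Qed.

Lemma filter_bimod_context (M : bimodType R R) : filter_bimod M ->
  exists (N : bimodType R R) (al : M -> N -> R) (be : N -> M -> R),
    [/\ context al be, ore_bimod M & ore_bimod N].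
Proof.
move=> MF; have [MI _ _] := MF; have [N [al [be ctx]]] := invertible_context MI.
by exists N, al, be; have /(context_filter_bimod ctx)[] := MF.
Qed.

Lemma filter_bimod1 : filter_bimod (R^o : bimodType R R).
Proof.
have i : bimod_iso (tensor (R^o : bimodType R R) R^o) R^o by exact: tens_unitl.
have [al [be ctx]] := iso_context i i.
by apply/(context_filter_bimod ctx); split; apply: ore_bimod1.
Qed.

Lemma filter_bimod_tensor (M N : bimodType R R) :
  filter_bimod M -> filter_bimod N -> filter_bimod (tensor M N).
Proof.
move=> /filter_bimod_context[M' [al [be [ctx Mo Mo']]]].
move=> /filter_bimod_context[N' [al' [be' [ctx' No No']]]].
have i : bimod_iso (tensor (tensor M N) (tensor N' M')) R^o.
  by apply: tensor_cancel; apply: context_iso; [apply: ctx'|apply: ctx].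
have i' : bimod_iso (tensor (tensor N' M') (tensor M N)) R^o.
  by apply: tensor_cancel; apply: context_iso;
    [apply: context_sym ctx|apply: context_sym ctx'].
have [? [? /context_filter_bimod->]] := iso_context i i'.
by split; apply: ore_bimod_tensor.
Qed.

(** The criterion [context_filter_bimod] is symmetric in the two bimodules of a context. *)
Lemma filter_bimod_inv (M N : bimodType R R) : filter_bimod M ->
  bimod_iso (tensor M N) R^o -> bimod_iso (tensor N M) R^o -> filter_bimod N.
Proof.
move=> MF i i'; have [? [? ctx]] := iso_context i i'.
apply/(context_filter_bimod (context_sym ctx)).
by have /(context_filter_bimod ctx)[] := MF.
Qed.

Lemma Pic_filtersE :
  Pic_filters S = (fun C => exists2 M, filter_bimod M & C = iso_class M).
Proof.
apply: funext => C; apply: propext; split; first by move=> [M [? ? ? ->]];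
  exists M.
by move=> [M [? ? ?] ->]; exists M.
Qed.

Lemma filter_bimod_iso (N M : bimodType R R) :
  bimod_iso N M -> filter_bimod N -> filter_bimod M.
Proof.
move=> NM /filter_bimod_context[N' [al [be [ctx No No']]]].
have i : bimod_iso (tensor M N') R^o.
  apply: bimod_iso_trans (context_iso ctx).
  exact: bimod_iso_tensor (bimod_iso_sym NM) (bimod_iso_refl N').
have i' : bimod_iso (tensor N' M) R^o.
  apply: bimod_iso_trans (context_iso (context_sym ctx)).
  exact: bimod_iso_tensor (bimod_iso_refl N') (bimod_iso_sym NM).
have [? [? /context_filter_bimod->]] := iso_context i i'.
by split=> //; apply: ore_bimod_iso No.
Qed.

Lemma Pic_filters_iso_class (M : bimodType R R) :
  Pic_filters S (iso_class M) -> filter_bimod M.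
Proof.
move=> [N [NI NT NU /iso_classP/bimod_iso_sym NM]].
exact: filter_bimod_iso NM _.
Qed.

Lemma Pic_filters_group :
  is_group (Pic_filters S) (Pic_mul R) (Pic_one R).
Proof.
rewrite Pic_filtersE; apply: Pic_is_group => [|M N|M []|M N] //.
- exact: filter_bimod1.
- exact: filter_bimod_tensor.
- exact: filter_bimod_inv.
Qed.

End Sharp.

(** * Bimodules of fractions *)

Section Fractions.
Variables (R Q : pzRingType) (S : set R) (iota : {rmorphism R -> Q}).
Hypotheses (SP : regular_ore_set S) (QP : is_fraction_ring S iota).

Local Notation QR := (resbimod idfun iota (Q^o : bimodType Q Q)).
Local Notation RQ := (resbimod iota idfun (Q^o : bimodType Q Q)).

Lemma frac_num_left q : exists r s, S s /\ iota s * q = iota r.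
Proof.
have [r [s [t [Ss st _ ->]]]] := frac_left QP q.
by exists r, s; rewrite mulrA st mul1r.
Qed.

Lemma frac_num_right q : exists r s, S s /\ q * iota s = iota r.
Proof.
have [r [s [t [Ss _ ts ->]]]] := frac_right QP q.
by exists r, s; rewrite -mulrA ts mulr1.
Qed.

Lemma frac_lcancel (V : lmodType Q) s (x y : V) :
  S s -> iota s *: x = iota s *: y -> x = y.
Proof.
move=> /(frac_unit QP)[t [_ ts]] /(congr1 (fun z => t *: z)).
by rewrite !scalerA ts !scale1r.
Qed.

Lemma frac_rcancel (V : rmodType Q) s (x y : V) :
  S s -> x :*r iota s = y :*r iota s -> x = y.
Proof.
move=> /(frac_unit QP)[t [st _]] /(congr1 (fun z => z :*r t)).
by rewrite !rscalerA st !rscaler1.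
Qed.

Lemma frac_ldiv (V : lmodType Q) s (x : V) : S s -> exists y, iota s *: y = x.
Proof.
by move=> /(frac_unit QP)[t [st _]]; exists (t *: x);
  rewrite scalerA st scale1r.
Qed.

Lemma frac_rdiv (V : rmodType Q) s (x : V) : S s -> exists y, y :*r iota s = x.
Proof.
move=> /(frac_unit QP)[t [_ ts]].
by exists (x :*r t); rewrite rscalerA ts rscaler1.
Qed.

(** [j] exhibits [B] as both [S^-1 M] and [M S^-1], and [M] embeds. *)
Record is_frac (M : bimodType R R) (B : bimodType Q Q) (j : M -> B) : Prop := {
  fracD : {morph j : x y / x + y};
  fracZ : forall r m, j (r *: m) = iota r *: j m;
  fracR : forall m r, j (m :*r r) = j m :*r iota r;
  frac_ker : forall m, j m = 0 -> m = 0;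
  frac_denl : forall b, exists s m, S s /\ iota s *: b = j m;
  frac_denr : forall b, exists s m, S s /\ b :*r iota s = j m
}.

Section Denominators.
Variables (M : bimodType R R) (B : bimodType Q Q) (j : M -> B).

Lemma denl_add (b b' : B) : {morph j : x y / x + y} ->
  (forall r m, j (r *: m) = iota r *: j m) ->
  (exists s m, S s /\ iota s *: b = j m) ->
  (exists s m, S s /\ iota s *: b' = j m) ->
  exists s m, S s /\ iota s *: (b + b') = j m.
Proof.
move=> jD jZ [s [m [Ss sb]]] [t [n [St tb]]].
have [a [c [Sas e]]] := common_left_multiple SP Ss St.
exists (a * s), (a *: m + c *: n); split=> //; rewrite scalerDr.
by rewrite {2}e !rmorphM -!scalerA sb tb jD !jZ.
Qed.

Lemma denr_add (b b' : B) : {morph j : x y / x + y} ->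
  (forall m r, j (m :*r r) = j m :*r iota r) ->
  (exists s m, S s /\ b :*r iota s = j m) ->
  (exists s m, S s /\ b' :*r iota s = j m) ->
  exists s m, S s /\ (b + b') :*r iota s = j m.
Proof.
move=> jD jR [s [m [Ss sb]]] [t [n [St tb]]].
have [a [c [Sas e]]] := common_right_multiple SP Ss St.
exists (s * a), (m :*r a + n :*r c); split=> //; rewrite rscalerDl.
by rewrite {2}e !rmorphM -!rscalerA sb tb jD !jR.
Qed.

Lemma frac_inj_mor : is_frac j -> injective j.
Proof. by move=> jP; apply: morph_add_inj (fracD jP) (frac_ker jP). Qed.

(** In [B] the left fraction [s^-1 j(m)] also has a right denominator [s']; clearing both
    denominators is the Ore condition. *)
Lemma frac_right_ore : is_frac j -> right_ore_bimod S M.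
Proof.
move=> jP m s Ss; have [b sb] := frac_ldiv (j m) Ss.
have [s' [m' [Ss' bs']]] := frac_denr jP b; exists m', s'; split=> //.
by apply: (frac_inj_mor jP); rewrite (fracR jP) -sb scale_rscale bs' (fracZ jP).
Qed.

Lemma frac_left_ore : is_frac j -> left_ore_bimod S M.
Proof.
move=> jP m s Ss; have [b sb] := frac_rdiv (j m) Ss.
have [s' [m' [Ss' bs']]] := frac_denl jP b; exists m', s'; split=> //.
by apply: (frac_inj_mor jP);
  rewrite (fracZ jP) -sb -scale_rscale bs' (fracR jP).
Qed.

End Denominators.

Section LeftExtension.
Variable M : lmodType R.

Lemma tensQA (q : Q) (r : R) (m : M) :
  tens (q * iota r : QR) m = tens (q : QR) (r *: m).
Proof. exact: (tensA (q : QR) r m). Qed.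

Lemma tensQ_denl (z : tensor QR M) :
  exists s m, S s /\ iota s *: z = tens (1 : QR) m.
Proof.
elim/tensor_ind: z => [|z w [s [m [Ss sz]]] [t [n [St tw]]]|q m].
- by exists 1, 0; rewrite scaler0 tens0r; split=> //; apply: (ore_one SP).
- have [a [c [Sas e]]] := common_left_multiple SP Ss St.
  exists (a * s), (a *: m + c *: n); split=> //; rewrite scalerDr.
  rewrite {2}e !rmorphM -!scalerA sz tw !scale_tens tensDr.
  by rewrite -!tensQA !mul1r; congr (tens _ m + tens _ n); apply: mulr1.
- have [r [s [Ss e]]] := frac_num_left q.
  exists s, (r *: m); split=> //; rewrite scale_tens -tensQA mul1r -e.
  by congr (tens _ m).
Qed.

Variables (V : lmodType Q) (f : M -> V).
Hypothesis fD : {morph f : x y / x + y}.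
Hypothesis fZ : forall r m, f (r *: m) = iota r *: f m.

Definition lextend : tensor QR M -> V :=
  tens_map (fun (q : QR) m => (q : Q) *: f m).

Lemma lextend_balanced : balanced (fun (q : QR) m => (q : Q) *: f m).
Proof.
split=> [m x y|x m n|x a m]; first by rewrite scalerDl.
  by rewrite fD scalerDr.
by rewrite fZ scalerA.
Qed.

Lemma lextendE (q : Q) m : lextend (tens (q : QR) m) = q *: f m.
Proof. exact: tens_mapE lextend_balanced _ _. Qed.

Lemma lextend_hom : lmod_hom lextend.
Proof.
split; first exact: tens_mapD lextend_balanced.
by apply: (tens_map_scale lextend_balanced) => a q m; rewrite scalerA.
Qed.

(** Once its denominator is cleared, an element of the kernel has the form [tens 1 m], and its image
    is [f m]. *)
Lemma lextend_inj : (forall m, f m = 0 -> m = 0) -> injective lextend.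
Proof.
have [LD LZ] := lextend_hom => ker0; apply: morph_add_inj LD _ => z z0.
have [s [m [Ss sz]]] := tensQ_denl z.
have m0 : m = 0.
  by apply: ker0; rewrite -[f m]scale1r -lextendE -sz LZ z0 scaler0.
by apply: (frac_lcancel Ss); rewrite sz m0 tens0r scaler0.
Qed.

End LeftExtension.

Section RightExtension.
Variable M : rmodType R.

Lemma tensAQ (q : Q) (r : R) (m : M) :
  tens m (iota r * q : RQ) = tens (m :*r r) (q : RQ).
Proof. exact/esym/(tensA m r (q : RQ)). Qed.

Lemma tensQ_denr (z : tensor M RQ) :
  exists s m, S s /\ z :*r iota s = tens m (1 : RQ).
Proof.
elim/tensor_ind: z => [|z w [s [m [Ss sz]]] [t [n [St tw]]]|m q].
- by exists 1, 0; rewrite rscale0r tens0l; split=> //; apply: (ore_one SP).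
- have [a [c [Sas e]]] := common_right_multiple SP Ss St.
  exists (s * a), (m :*r a + n :*r c); split=> //; rewrite rscalerDl.
  rewrite {2}e !rmorphM -!rscalerA sz tw !rscale_tens tensDl.
  by rewrite -!tensAQ !mulr1; congr (tens m _ + tens n _); apply: mul1r.
- have [r [s [Ss e]]] := frac_num_right q.
  exists s, (m :*r r); split=> //; rewrite rscale_tens -tensAQ mulr1 -e.
  by congr (tens m _).
Qed.

Variables (V : rmodType Q) (f : M -> V).
Hypothesis fD : {morph f : x y / x + y}.
Hypothesis fR : forall m r, f (m :*r r) = f m :*r iota r.

Definition rextend : tensor M RQ -> V :=
  tens_map (fun m (q : RQ) => f m :*r (q : Q)).

Lemma rextend_balanced : balanced (fun m (q : RQ) => f m :*r (q : Q)).
Proof.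
split=> [m x y|x m n|x a m]; first by rewrite fD rscalerDl.
  by rewrite rscalerDr.
by rewrite fR rscalerA.
Qed.

Lemma rextendE (q : Q) m : rextend (tens m (q : RQ)) = f m :*r q.
Proof. exact: tens_mapE rextend_balanced _ _. Qed.

Lemma rextend_hom : rmod_hom rextend.
Proof.
split; first exact: tens_mapD rextend_balanced.
by apply: (tens_map_rscale rextend_balanced) => m q a; rewrite rscalerA.
Qed.

Lemma rextend_inj : (forall m, f m = 0 -> m = 0) -> injective rextend.
Proof.
have [LD LR] := rextend_hom => ker0; apply: morph_add_inj LD _ => z z0.
have [s [m [Ss sz]]] := tensQ_denr z.
have m0 : m = 0.
  by apply: ker0; rewrite -[f m]rscaler1 -rextendE -sz LR z0 rscale0r.
by apply: (frac_rcancel Ss); rewrite sz m0 tens0l rscale0r.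
Qed.

End RightExtension.

Section Universal.
Variables (M : bimodType R R) (B : bimodType Q Q) (j : M -> B).
Hypothesis jP : is_frac j.

Lemma lextend_bij : bijective (lextend j).
Proof.
have [LD LZ] := lextend_hom (fracD jP) (fracZ jP).
apply: inj_surj_bij; first exact: lextend_inj (fracD jP) (fracZ jP) (frac_ker
  jP).
move=> b; have [s [m [Ss sb]]] := frac_denl jP b.
have [t [_ ts]] := frac_unit QP Ss; exists (tens (t : QR) m).
by rewrite (lextendE (fracD jP) (fracZ jP)) -sb scalerA ts scale1r.
Qed.

Lemma rextend_bij : bijective (rextend j).
Proof.
have [LD LR] := rextend_hom (fracD jP) (fracR jP).
apply: inj_surj_bij; first exact: rextend_inj (fracD jP) (fracR jP) (frac_ker
  jP).
move=> b; have [s [m [Ss sb]]] := frac_denr jP b.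
have [t [st _]] := frac_unit QP Ss; exists (tens m (t : RQ)).
by rewrite (rextendE (fracD jP) (fracR jP)) -sb rscalerA st rscaler1.
Qed.

(** The bijection [lextend j] identifies [Q (x) M] with [B], so [B] inherits the universal property
    of extension of scalars. *)
Lemma frac_lextension (V : lmodType Q) (f : M -> V) :
  {morph f : x y / x + y} -> (forall r m, f (r *: m) = iota r *: f m) ->
  exists2 F : B -> V, lmod_hom F & forall m, F (j m) = f m.
Proof.
move=> fD fZ; have [g gK gK'] := lextend_bij.
have [FD FZ] := lextend_hom fD fZ.
have [gD gZ] := lmod_hom_inv (lextend_hom (fracD jP) (fracZ jP)) gK gK'.
exists (lextend f \o g); first by split=> [x y|a x] /=; rewrite ?gD ?FD ?gZ ?FZ.
move=> m /=; have {1}<- : lextend j (tens (1 : QR) m) = j m.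
  by rewrite (lextendE (fracD jP) (fracZ jP)) scale1r.
by rewrite gK (lextendE fD fZ) scale1r.
Qed.

Lemma frac_lhom_uniq (V : lmodType Q) (F G : B -> V) :
  lmod_hom F -> lmod_hom G -> (forall m, F (j m) = G (j m)) -> F =1 G.
Proof.
move=> [_ FZ] [_ GZ] FG b; have [s [m [Ss sb]]] := frac_denl jP b.
by apply: (frac_lcancel Ss); rewrite -FZ -GZ sb.
Qed.

(** Linearity spreads in two stages: left denominators extend [R]-linearity from [j(M)] to [B], and
    a right denominator of [q] then extends it from [R] to [Q]. *)
Lemma frac_bimod_hom (B' : bimodType Q Q) (F : B -> B') : lmod_hom F ->
  (forall m r, F (j m :*r iota r) = F (j m) :*r iota r) -> rmod_hom F.
Proof.
move=> [FD FZ] Fr.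
have FR b r : F (b :*r iota r) = F b :*r iota r.
  have [s [m [Ss sb]]] := frac_denl jP b.
  by apply: (frac_lcancel Ss); rewrite -FZ -!scale_rscale -FZ sb Fr.
split=> // b q; have [r [s [Ss e]]] := frac_num_right q.
by apply: (frac_rcancel Ss); rewrite -FR !rscalerA e FR.
Qed.

End Universal.

Lemma frac_uniq (M : bimodType R R) (B B' : bimodType Q Q)
    (j : M -> B) (j' : M -> B') : is_frac j -> is_frac j' ->
  exists2 F : B -> B', bimod_isom F & forall m, F (j m) = j' m.
Proof.
move=> jP jP'.
have [F Fl Fj] := frac_lextension jP (fracD jP') (fracZ jP').
have [G Gl Gj] := frac_lextension jP' (fracD jP) (fracZ jP).
exists F => //; split=> //.
  by apply: (frac_bimod_hom jP) => // m r; rewrite -(fracR jP) !Fj (fracR jP').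
exists G.
- apply: (frac_lhom_uniq jP (F := G \o F) (G := id)) => [||m].
  + by case: Fl Gl => FD FZ [GD GZ]; split=> [x y|a x] /=;
      rewrite ?FD ?GD ?FZ ?GZ.
  + exact: lmod_hom_id.
  + by rewrite /= Fj Gj.
- apply: (frac_lhom_uniq jP' (F := F \o G) (G := id)) => [||m].
  + by case: Fl Gl => FD FZ [GD GZ]; split=> [x y|a x] /=;
      rewrite ?GD ?FD ?GZ ?FZ.
  + exact: lmod_hom_id.
  + by rewrite /= Gj Fj.
Qed.

Lemma frac_comp_isom (M M' : bimodType R R) (B : bimodType Q Q)
    (f : M' -> M) (j : M -> B) :
  bimod_isom f -> is_frac j -> is_frac (j \o f).
Proof.
move=> [[fD fZ] [_ fR] [g fK gK]] jP; split=> /=.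
- by move=> x y /=; rewrite fD (fracD jP).
- by move=> r m; rewrite fZ (fracZ jP).
- by move=> m r; rewrite fR (fracR jP).
- by move=> m /(frac_ker jP) fm0; rewrite -[m]fK fm0 -(morph_add0 fD) fK.
- move=> b; have [s [m [Ss sb]]] := frac_denl jP b.
  by exists s, (g m); rewrite gK.
- move=> b; have [s [m [Ss sb]]] := frac_denr jP b.
  by exists s, (g m); rewrite gK.
Qed.

Lemma isom_comp_frac (M : bimodType R R) (B B' : bimodType Q Q)
    (g : B -> B') (j : M -> B) :
  bimod_isom g -> is_frac j -> is_frac (g \o j).
Proof.
move=> [[gD gZ] [_ gR] [h gK hK]] jP; split=> /=.
- by move=> x y /=; rewrite (fracD jP) gD.
- by move=> r m; rewrite (fracZ jP) gZ.
- by move=> m r; rewrite (fracR jP) gR.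
- by move=> m gj0; apply: (frac_ker jP);
    rewrite -[j m]gK gj0 -(morph_add0 gD) gK.
- move=> b; have [s [m [Ss sb]]] := frac_denl jP (h b).
  by exists s, m; rewrite -sb gZ hK.
- move=> b; have [s [m [Ss sb]]] := frac_denr jP (h b).
  by exists s, m; rewrite -sb gR hK.
Qed.

Lemma frac_ring : is_frac (iota : R^o -> Q^o).
Proof.
split.
- exact: rmorphD.
- exact: rmorphM.
- exact: rmorphM.
- by move=> m m0; apply: (frac_inj QP); rewrite rmorph0; apply: m0.
- by move=> q; have [r [s [Ss e]]] := frac_num_left q; exists s, r.
- by move=> q; have [r [s [Ss e]]] := frac_num_right q; exists s, r.
Qed.

(** * Tensor products of bimodules of fractions *)

Section FracTensor.
Variables (M N P : bimodType R R) (B C : bimodType Q Q).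
Variables (al : N -> P -> R) (be : P -> N -> R) (j : M -> B) (k : N -> C).
Hypotheses (ctx : context al be) (jP : is_frac j) (kP : is_frac k).

Lemma frac_tensor_balanced : balanced (fun m n => tens (j m) (k n)).
Proof.
split=> [n x y|x m n|x a n].
- by rewrite (fracD jP) tensDl.
- by rewrite (fracD kP) tensDr.
- by rewrite (fracR jP) (fracZ kP) tensA.
Qed.

Definition frac_tens : tensor M N -> tensor B C :=
  tens_map (fun m n => tens (j m) (k n)).

Lemma frac_tensE m n : frac_tens (tens m n) = tens (j m) (k n).
Proof. exact: tens_mapE frac_tensor_balanced _ _. Qed.

(** For [p] in [P], the functional [al(-, p)] extends to a left [Q]-linear map
    [C -> Q], which gives a map [B (x) C -> B] detecting the elements of
    [M (x) N]. *)
Lemma frac_tens_ker t : frac_tens t = 0 -> t = 0.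
Proof.
have tD : {morph frac_tens : t u / t + u} := tens_mapD frac_tensor_balanced.
have alP := ctx_pairl ctx.
move=> t0; apply: (rcontract_eq0 ctx) => p.
have [F [FD FZ] Fk] : exists2 F : C -> Q^o, lmod_hom F &
    forall n, F (k n) = iota (al n p).
  apply: (frac_lextension kP (V := Q^o)) => [x y|r n].
    by rewrite (pairDl alP) rmorphD.
  by rewrite (pairZl alP) rmorphM.
have fP : balanced (fun (b : B) (c : C) => b :*r (F c : Q)).
  by apply: (@balanced_rscale _ _ _ (F : C -> Q)) => [x y|a x];
    [apply: FD|apply: FZ].
apply: (frac_ker jP); rewrite -(morph_add0 (tens_mapD fP)) -t0.
move: t {t0}; apply: tensor_ext => [t u|t u|m n].
- by rewrite (rcontractD ctx) (fracD jP).
- by rewrite tD (tens_mapD fP).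
- rewrite (rcontractE ctx) frac_tensE (tens_mapE fP).
  by rewrite (fracR jP) Fk.
Qed.

Lemma frac_tensP : is_frac frac_tens.
Proof.
have tD : {morph frac_tens : t u / t + u} := tens_mapD frac_tensor_balanced.
have tZ r t : frac_tens (r *: t) = iota r *: frac_tens t.
  move: t; apply: tensor_ext => [t u|t u|m n].
  - by rewrite scalerDr tD.
  - by rewrite tD scalerDr.
  - by rewrite scale_tens !frac_tensE scale_tens (fracZ jP).
have tR t r : frac_tens (t :*r r) = frac_tens t :*r iota r.
  move: t; apply: tensor_ext => [t u|t u|m n].
  - by rewrite rscalerDl tD.
  - by rewrite tD rscalerDl.
  - by rewrite rscale_tens !frac_tensE rscale_tens (fracR kP).
split=> //; first exact: frac_tens_ker.
- elim/tensor_ind=> [|x y|b c].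
  + by exists 1, 0; rewrite scaler0 (morph_add0 tD); split=> //;
      apply: (ore_one SP).
  + exact: denl_add.
  (* The left denominator of [c] is taken over by [b], written as [b'] times [s]; what remains is
     the left denominator of [b']. *)
  + have [s [n [Ss sc]]] := frac_denl kP c; have [b' b'E] := frac_rdiv b Ss.
    have [t [m [St tb]]] := frac_denl jP b'; exists t, (tens m n); split=> //.
    by rewrite -b'E tensA sc scale_tens tb frac_tensE.
- elim/tensor_ind=> [|x y|b c].
  + by exists 1, 0; rewrite rscale0r (morph_add0 tD); split=> //;
      apply: (ore_one SP).
  + exact: denr_add.
  + have [s [m [Ss sb]]] := frac_denr jP b; have [c' c'E] := frac_ldiv c Ss.
    have [t [n [St tc]]] := frac_denr kP c'; exists t, (tens m n); split=> //.
    by rewrite -c'E -tensA sb rscale_tens tc frac_tensE.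
Qed.

End FracTensor.

(** * Existence of bimodules of fractions *)

Section RightAction.
Variable X : rmodType R.
Hypothesis Xker : forall (x : X) s, S s -> x :*r s = 0 -> x = 0.
Hypothesis Xdiv : forall (x : X) s, S s -> exists y, y :*r s = x.

(** Since [S] acts bijectively, [x q] for [q = r s^-1] can be the solution [y] of [y s = x r]. The
    two properties stated yield a retraction of the map from [X] to [tensor X RQ] that tensors with
    1, so that this map is injective. *)
Lemma frac_action : exists act : X -> RQ -> X,
  balanced act /\ forall x, act x (1 : RQ) = x.
Proof.
have [num /boolp.choice[den numden]] := boolp.choice frac_num_right.
have divP (x : X) s : exists y, S s -> y :*r s = x.
  (* The default 0 outside [S] makes division a total function that [choice] can deliver. *)
  have [Ss|nSs] := pselect (S s); last by exists 0.
  by have [y] := Xdiv x Ss; exists y.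
have [div divE] := boolp.choice (fun p : X * R => divP p.1 p.2).
pose act (x : X) (q : RQ) : X := div (x :*r num q, den q).
have actP x (q : RQ) : act x q :*r den q = x :*r num q.
  by rewrite (divE (_, _)) //; apply: (proj1 (numden q)).
have Xinj (x y : X) s : S s -> x :*r s = y :*r s -> x = y.
  move=> Ss xy; apply/eqP; rewrite -subr_eq0; apply/eqP/(Xker Ss).
  by rewrite rscalerDl rscaleNr xy subrr.
(* Independence of the fraction: any [r] and [s] with [q s = r] compute the action. The two
   candidates are compared after multiplication by a common right multiple of the denominators. *)
have actE x (q : RQ) r s y : S s -> (q : Q) * iota s = iota r -> y :*r s = x
  :*r r ->
    act x q = y.
  move=> Ss qs ys; have [Sd qd] := numden q.
  have [a [b [Sda e]]] := common_right_multiple SP Sd Ss.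
  apply: (Xinj _ _ _ Sda); rewrite {2}e -!rscalerA actP ys !rscalerA.
  congr (_ :*r _); apply: (frac_inj QP).
  by rewrite !rmorphM -qd -qs -!mulrA -!rmorphM e.
exists act; split; first split=> [q x y|x q q'|x a q].
- have [Sd qd] := numden q.
  by apply: (actE _ _ _ _ _ Sd qd); rewrite !rscalerDl !actP.
- have [Sd qd] := numden q; have [Sd' qd'] := numden q'.
  have [a [b [Sda e]]] := common_right_multiple SP Sd Sd'.
  apply: (actE _ _ (num q * a + num q' * b) _ _ Sda).
    rewrite rmorphD !rmorphM -qd -qd' -!mulrA -!rmorphM -e.
    exact: mulrDl.
  by rewrite rscalerDl {2}e -!rscalerA !actP rscalerDr !rscalerA.
- have [Sd qd] := numden q; apply/esym.
  apply: (actE _ _ (a * num q) _ _ Sd); last by rewrite actP rscalerA.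
  by rewrite rmorphM -qd mulrA.
- move=> x; apply: (actE _ _ 1 _ _ (ore_one SP)); first by rewrite mul1r.
  by [].
Qed.

End RightAction.

Section FracExists.
Variables (M N : bimodType R R) (al : M -> N -> R) (be : N -> M -> R).
Hypotheses (ctx : context al be) (Mo : ore_bimod S M) (No : ore_bimod S N).
Let alP := ctx_pairl ctx.

Local Notation X := (tensor QR M).

(** Each functional [al(-, n)] extends to [Q (x) M] with values in [Q], so all of them vanish at
    [m]. This replaces any appeal to flatness. *)
Lemma tensQ_ker m : tens (1 : QR) m = 0 :> X -> m = 0.
Proof.
move=> m0; apply: (context_nondegl ctx) => n; apply: (frac_inj QP).
have fD : {morph (fun m => iota (al m n) : Q^o) : x y / x + y}.
  by move=> x y; rewrite (pairDl alP) rmorphD.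
have fZ r m' : (iota (al (r *: m') n) : Q^o) = iota r *: (iota (al m' n) : Q^o).
  by rewrite (pairZl alP) rmorphM.
have := lextendE fD fZ 1 m; rewrite m0 (morph_add0 (proj1 (lextend_hom fD fZ))).
by rewrite rmorph0 scale1r => <-.
Qed.

(** With [n s' = s n'], the element [al m n * s'] equals [al (m s) n' = 0], and [s'] is regular. *)
Lemma ore_torsion_free (m : M) s : S s -> m :*r s = 0 -> m = 0.
Proof.
move=> Ss ms; apply: (context_nondegl ctx) => n.
have [n' [s' [Ss' e]]] := No.1 n s Ss; apply: (ore_regular SP Ss').2.
rewrite mul0r -(pairZr alP) e -(pairA alP) ms.
exact: (morph_add0 (pairDl alP n')).
Qed.

(** The carrier [Q (x) M (x) Q] has commuting [Q]-actions by construction; the question is whether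
    [M] survives in it. For that, [S] is shown to act bijectively on the right of [Q (x) M], and
    [frac_action] supplies a retraction onto this module. *)
Lemma frac_exists : exists (B : bimodType Q Q) (j : M -> B), is_frac j.
Proof.
have Xker (x : X) s : S s -> x :*r s = 0 -> x = 0.
  move=> Ss xs; have [t [m [St tx]]] := tensQ_denl x.
  apply: (frac_lcancel St); rewrite tx scaler0.
  have : tens (1 : QR) (m :*r s) = 0 :> X.
    by rewrite -rscale_tens -tx scale_rscale xs scaler0.
  by move=> /tensQ_ker/(ore_torsion_free Ss) ->; rewrite tens0r.
have Xdiv (x : X) s : S s -> exists y, y :*r s = x.
  move=> Ss; have [t [m [St tx]]] := tensQ_denl x.
  have [m' [s' [Ss' e]]] := Mo.2 m s Ss.
  (* From [t x = 1 (x) m] and [s' m = m' s], the quotient of [x] by [s] on the right is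
     [(s' t)^-1 (1 (x) m')]. *)
  have [y yE] := frac_ldiv (tens (1 : QR) m' : X) (ore_mul SP Ss' St).
  exists y; apply: (frac_lcancel (ore_mul SP Ss' St)).
  rewrite -scale_rscale yE rscale_tens -e rmorphM -scalerA tx scale_tens.
  by rewrite -tensQA mul1r; congr (tens _ m); apply/esym/mulr1.
have [act [actP act1]] := frac_action Xker Xdiv.
pose j m : tensor X RQ := tens (tens (1 : QR) m) (1 : RQ).
have jD : {morph j : x y / x + y} by move=> x y; rewrite /j tensDr tensDl.
have jZ r m : j (r *: m) = iota r *: j m.
  rewrite /j !scale_tens -tensQA mul1r; congr (tens (tens _ m) _).
  exact/esym/mulr1.
have jR m r : j (m :*r r) = j m :*r iota r.
  have e : tens (1 : QR) (m :*r r) = tens (1 : QR) m :*r r :> X.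
    by rewrite rscale_tens.
  rewrite /j e -tensAQ mulr1 rscale_tens; congr (tens _ _).
  exact/esym/mul1r.
exists (tensor X RQ), j; split=> //.
- move=> m jm0; apply: tensQ_ker; rewrite -[LHS]act1 -(tens_mapE actP).
  by rewrite -/(j m) jm0 (morph_add0 (tens_mapD actP)).
- elim/tensor_ind=> [|x y|x q].
  + by exists 1, 0; rewrite scaler0 (morph_add0 jD); split=> //;
      apply: (ore_one SP).
  + exact: denl_add.
  + have [r [t [St qt]]] := frac_num_right q.
    have [u [tu ut]] := frac_unit QP St.
    have -> : q = iota r * u by rewrite -qt -mulrA tu mulr1.
    rewrite tensAQ; have [s [m [Ss sx]]] := tensQ_denl (x :*r r).
    (* The left Ore condition makes a right factor [t] appear on [m']; it crosses the tensor sign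
       and cancels [u], its inverse. *)
    have [m' [s' [Ss' e]]] := Mo.2 m t St.
    exists (s' * s), m'; split; first exact: (ore_mul SP).
    rewrite rmorphM -scalerA scale_tens sx scale_tens scale_tens.
    have -> : iota s' *: (1 : QR) = (1 * iota s' : Q).
      by rewrite mul1r; apply: mulr1.
    by rewrite tensQA e -rscale_tens -tensAQ tu.
- elim/tensor_ind=> [|x y|x q].
  + by exists 1, 0; rewrite rscale0r (morph_add0 jD); split=> //;
      apply: (ore_one SP).
  + exact: denr_add.
  + have [r [t [St qt]]] := frac_num_right q.
    have [s [m [Ss sx]]] := tensQ_denl (x :*r r).
    (* Here the right Ore condition makes a left factor [s] appear, which cancels the left
       denominator of [x :*r r]. *)
    have [m' [s' [Ss' e]]] := Mo.1 m s Ss.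
    exists (t * s'), m'; split; first exact: (ore_mul SP).
    have xs : x :*r r :*r s' = tens (1 : QR) m'.
      apply: (frac_lcancel Ss);
        rewrite -scale_rscale sx rscale_tens e scale_tens.
      by rewrite -tensQA mul1r; congr (tens _ m'); apply/esym/mulr1.
    rewrite /j -xs -!tensAQ rmorphM -rscalerA !rscale_tens; congr (tens _ _).
    by rewrite mulr1 -qt.
Qed.

End FracExists.
End Fractions.

(** * Two-sided localization *)

Section Filters.
Variables (R : pzRingType) (S : set R).
Hypothesis SP : regular_ore_set S.

Lemma Dl_setI D D' : Dl S D -> Dl S D' -> Dl S (D `&` D').
Proof.
move=> [[D0 DD DZ] [s [Ds Ss]]] [[D0' DD' DZ'] [t [Dt St]]]; split.
  split=> [|x y [Dx Dx'] [Dy Dy']|r x [Dx Dx']]; first by [].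
    by split; [apply: DD|apply: DD'].
  by split; [apply: DZ|apply: DZ'].
have [a [b [Sas e]]] := common_left_multiple SP Ss St.
by exists (a * s); split=> //; split; [apply: DZ|rewrite e; apply: DZ'].
Qed.

Lemma Dr_setI D D' : Dr S D -> Dr S D' -> Dr S (D `&` D').
Proof.
move=> [[D0 DD DZ] [s [Ds Ss]]] [[D0' DD' DZ'] [t [Dt St]]]; split.
  split=> [|x y [Dx Dx'] [Dy Dy']|r x [Dx Dx']]; first by [].
    by split; [apply: DD|apply: DD'].
  by split; [apply: DZ|apply: DZ'].
have [a [b [Sas e]]] := common_right_multiple SP Ss St.
by exists (s * a); split=> //; split; [apply: DZ|rewrite e; apply: DZ'].
Qed.

Lemma pair_equiv_eq (M : bimodType R R) (p q : compatible_pair S M) :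
  cp_D p = cp_D q -> cp_H p = cp_H q ->
  (forall x, cp_D p x -> cp_f p x = cp_f q x) ->
  (forall y, cp_H p y -> cp_g p y = cp_g q y) -> pair_equiv p q.
Proof.
move=> eD eH ef eg; split.
  exists (cp_D p); split=> //; first exact: cp_DP.
  by move=> x Dx; split=> //; rewrite -eD.
exists (cp_H p); split=> //; first exact: cp_HP.
by move=> x Dx; split=> //; rewrite -eH.
Qed.

End Filters.

Section Localization.
Variables (R Q : pzRingType) (S : set R) (iota : {rmorphism R -> Q}).
Hypotheses (SP : regular_ore_set S) (QP : is_fraction_ring S iota).

(** [p] consists of the multiplications by [b]. *)
Definition pair_value (M : bimodType R R) (B : bimodType Q Q) (j : M -> B)
    (p : compatible_pair S M) (b : B) : Prop :=
  (forall x, cp_D p x -> j (cp_f p x) = iota x *: b) /\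
  (forall y, cp_H p y -> j (cp_g p y) = b :*r iota y).

Section PairValue.
Variables (M : bimodType R R) (B : bimodType Q Q) (j : M -> B).
Hypothesis jP : is_frac S iota j.

Lemma pair_value_exists p : exists b, pair_value j p b.
Proof.
(* The value is forced to be [s^-1 (s)f] for a single [s] of [S] in the left domain. The left Ore
   condition spreads the formula over that domain, and compatibility transfers it to [cp_g]. *)
have [_ [s [Ds Ss]]] := cp_DP p; have [b sb] := frac_ldiv QP (j (cp_f p s)) Ss.
exists b; split=> [x Dx|y Hy].
  have [a [t [St e]]] := ore_left SP x Ss; apply: (frac_lcancel QP St).
  rewrite scalerA -rmorphM e rmorphM -scalerA sb -!(fracZ jP).
  by rewrite -!cp_fZ // e.
apply: (frac_lcancel QP Ss); rewrite -scale_rscale sb -(fracR jP) -(fracZ jP).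
by rewrite cp_compat.
Qed.

Lemma pair_value_uniq p b b' : pair_value j p b -> pair_value j p b' -> b = b'.
Proof.
move=> [bl _] [bl' _]; have [_ [s [Ds Ss]]] := cp_DP p.
by apply: (frac_lcancel QP Ss); rewrite -bl // -bl'.
Qed.

Lemma pair_equiv_value p p' b b' : pair_value j p b -> pair_value j p' b' ->
  b = b' <-> pair_equiv p p'.
Proof.
move=> [bl br] [bl' br']; split=> [e|[[D [DP Dpp fE]] _]].
  split.
    exists (cp_D p `&` cp_D p'); split=> // [|x [Dx Dx']].
      by apply: Dl_setI => //; apply: cp_DP.
    by apply: (frac_inj_mor jP); rewrite bl // bl' // e.
  exists (cp_H p `&` cp_H p'); split=> // [|y [Hy Hy']].
    by apply: Dr_setI => //; apply: cp_HP.
  by apply: (frac_inj_mor jP); rewrite br // br' // e.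
have [_ [s [Ds Ss]]] := DP; have [Dps Dps'] := Dpp s Ds.
by apply: (frac_lcancel QP Ss); rewrite -bl // -bl' // fE.
Qed.

(** The domains are arguments because sums and products of pairs have exactly prescribed domains. On
    them the two maps are forced by injectivity of [j], so every law is verified in [B]; outside
    they take the default 0. *)
Lemma pair_of_value b D H : Dl S D -> Dr S H ->
  (forall x, D x -> exists m, iota x *: b = j m) ->
  (forall y, H y -> exists m, b :*r iota y = j m) ->
  exists p : compatible_pair S M,
    [/\ cp_D p = D, cp_H p = H & pair_value j p b].
Proof.
move=> DP HP bD bH; have jI := frac_inj_mor jP.
have fP x : exists m, D x -> j m = iota x *: b.
  have [Dx|nDx] := pselect (D x); last by exists 0.
  by have [m mE] := bD x Dx; exists m.
have gP y : exists m, H y -> j m = b :*r iota y.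
  have [Hy|nHy] := pselect (H y); last by exists 0.
  by have [m mE] := bH y Hy; exists m.
have [f fE] := boolp.choice fP; have [g gE] := boolp.choice gP.
have [[D0 DD DZ] _] := DP; have [[H0 HD HZ] _] := HP.
have fD x y : D x -> D y -> f (x + y) = f x + f y.
  move=> Dx Dy; apply: jI; rewrite fE; last exact: DD.
  by rewrite (fracD jP) !fE // rmorphD scalerDl.
have fZ r x : D x -> f (r * x) = r *: f x.
  move=> Dx; apply: jI; rewrite fE; last exact: DZ.
  by rewrite (fracZ jP) fE // rmorphM scalerA.
have gD x y : H x -> H y -> g (x + y) = g x + g y.
  move=> Hx Hy; apply: jI; rewrite gE; last exact: HD.
  by rewrite (fracD jP) !gE // rmorphD rscalerDr.
have gZ y r : H y -> g (y * r) = g y :*r r.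
  move=> Hy; apply: jI; rewrite gE; last exact: HZ.
  by rewrite (fracR jP) gE // rmorphM rscalerA.
have fg x y : D x -> H y -> x *: g y = f x :*r y.
  move=> Dx Hy; apply: jI; rewrite (fracZ jP) (fracR jP) fE // gE //.
  by rewrite scale_rscale.
by exists (CompatiblePair DP HP fD fZ gD gZ fg).
Qed.

(** The domains are the largest possible ones, made of all elements that multiply [b] into [j(M)];
    they meet [S] because [b] has denominators on both sides. *)
Lemma pair_of b : exists p : compatible_pair S M, pair_value j p b.
Proof.
have [|||//|p [_ _ pb]] := @pair_of_value b
  [set x | exists m, iota x *: b = j m] [set y | exists m, b :*r iota y = j m].
- split; last by have [s [m [Ss sb]]] := frac_denl jP b; exists s; split=> //;
    exists m.
  split=> [|x y [m xb] [n yb]|r x [m xb]].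
  + by exists 0; rewrite rmorph0 scale0r (morph_add0 (fracD jP)).
  + by exists (m + n); rewrite rmorphD scalerDl xb yb (fracD jP).
  + by exists (r *: m); rewrite rmorphM -scalerA xb (fracZ jP).
- split; last by have [s [m [Ss sb]]] := frac_denr jP b; exists s; split=> //;
    exists m.
  split=> [|x y [m xb] [n yb]|x r [m xb]].
  + by exists 0; rewrite rmorph0 rscaler0 (morph_add0 (fracD jP)).
  + by exists (m + n); rewrite rmorphD rscalerDr xb yb (fracD jP).
  + by exists (m :*r r); rewrite rmorphM -rscalerA xb (fracR jP).
- by [].
- by exists p.
Qed.

Lemma canonical_pair_value m : pair_value j (canonical_pair SP m) (j m).
Proof. by split=> x _ /=; rewrite ?(fracZ jP) ?(fracR jP). Qed.

Lemma pair_value_add p p' b b' : pair_value j p b -> pair_value j p' b' ->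
  exists2 pp, is_pair_add p p' pp & pair_value j pp (b + b').
Proof.
move=> [bl br] [bl' br'].
have [||||pp [Dpp Hpp [ppl ppr]]] := @pair_of_value (b + b')
  (cp_D p `&` cp_D p') (cp_H p `&` cp_H p').
- by apply: Dl_setI => //; apply: cp_DP.
- by apply: Dr_setI => //; apply: cp_HP.
- move=> x [Dx Dx']; exists (cp_f p x + cp_f p' x).
  by rewrite scalerDr (fracD jP) bl // bl'.
- move=> y [Hy Hy']; exists (cp_g p y + cp_g p' y).
  by rewrite rscalerDl (fracD jP) br // br'.
exists pp => //; split=> // x.
  rewrite Dpp => -[Dx Dx']; apply: (frac_inj_mor jP).
  by rewrite ppl ?Dpp // scalerDr (fracD jP) bl // bl'.
rewrite Hpp => -[Hx Hx']; apply: (frac_inj_mor jP).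
by rewrite ppr ?Hpp // rscalerDl (fracD jP) br // br'.
Qed.

Lemma pair_value_lact q pq p b : represents iota q pq -> pair_value j p b ->
  exists2 p', is_pair_lact pq p p' & pair_value j p' (q *: b).
Proof.
move=> [ql qr] [bl br].
(* Reading the sum in [B] as [q b y] shows that it does not depend on the decomposition of
   [cp_g p y]. *)
have gE y (s : seq (R * M)) : cp_H p y -> (forall zm, zm \in s -> cp_H pq zm.1)
  ->
    cp_g p y = \sum_(zm <- s) zm.1 *: zm.2 ->
    (q *: b) :*r iota y = j (\sum_(zm <- s) (cp_g pq zm.1 : R) *: zm.2).
  move=> Hy sH yE; rewrite scale_rscale -br // yE !(morph_add_sum (fracD jP)).
  rewrite scaler_sumr big_seq [RHS]big_seq; apply: eq_bigr => zm zms.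
  by rewrite !(fracZ jP) scalerA -qr //; apply: sH.
have [[D0 DD DZ] [s [Ds Ss]]] := cp_DP p.
have [[H0 HD HZ] [h [Hh Sh]]] := cp_HP p.
have [[D0' DD' DZ'] [s' [Ds' Ss']]] := cp_DP pq.
have [[H0' HD' HZ'] [h' [Hh' Sh']]] := cp_HP pq.
have f0 : cp_f pq 0 = 0.
  by rewrite -[X in cp_f _ X](mul0r (0 : R)) cp_fZ // scale0r.
have g0 : cp_g p 0 = 0.
  by rewrite -[X in cp_g _ X](mul0r (0 : R)) cp_gZ // rscaler0.
have [||||p' [Dp' Hp' [pl pr]]] := @pair_of_value (q *: b)
  [set x | cp_D pq x /\ cp_D p (cp_f pq x)]
  [set y | cp_H p y /\ exists s : seq (R * M),
     (forall zm, zm \in s -> cp_H pq zm.1) /\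
     cp_g p y = \sum_(zm <- s) zm.1 *: zm.2].
- split.
    split=> /= [|x y [Dx Dx'] [Dy Dy']|r x [Dx Dx']].
    + by rewrite f0.
    + by rewrite cp_fD //; split; [apply: DD'|apply: DD].
    + by rewrite cp_fZ //; split; [apply: DZ'|apply: DZ].
  (* The domain meets [S] in [t * s']: the multiplier [t] pushes the image of [s'] into the left
     ideal [cp_D p]. *)
  have [a [t [St e]]] := ore_left SP (cp_f pq s' : R) Ss.
  exists (t * s'); split; last exact: (ore_mul SP).
  split; first exact: DZ'.
  rewrite cp_fZ //; have -> : t *: cp_f pq s' = a * s :> R^o by exact: e.
  exact: DZ.
- split.
    split=> /= [|x y [Hx [u [uH uE]]] [Hy [v [vH vE]]]|x r [Hx [u [uH uE]]]].
    + by split=> //; exists [::]; rewrite big_nil.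
    + split; first exact: HD.
      exists (u ++ v); split; last by rewrite big_cat cp_gD // uE vE.
      by move=> zm; rewrite mem_cat => /orP[/uH|/vH].
    + split; first exact: HZ.
      exists [seq (zm.1, zm.2 :*r r) | zm <- u]; split.
        by move=> _ /mapP[zm /uH zmH ->].
      rewrite cp_gZ // uE rscale_suml big_map; apply: eq_bigr => zm _ /=.
      by rewrite scale_rscale.
  (* The right Ore condition on [M] gives [g(h t) = h' m'], a decomposition with a single term and
     [h'] in the required ideal. *)
  have [m' [t [St e]]] := frac_right_ore QP jP (cp_g p h) Sh'.
  exists (h * t); split; last exact: (ore_mul SP).
  split; first exact: HZ.
  exists [:: (h', m')]; rewrite big_seq1 cp_gZ //; split=> // zm.
  by rewrite inE => /eqP->.
- move=> x [Dx Dx']; exists (cp_f p (cp_f pq x)).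
  by rewrite scalerA -ql // bl.
- move=> y [Hy [u [uH uE]]].
  by exists (\sum_(zm <- u) (cp_g pq zm.1 : R) *: zm.2); apply: gE.
exists p' => //; split=> // [x|y u Hy [uH uE]].
  rewrite Dp' => -[Dx Dx']; apply: (frac_inj_mor jP).
  by rewrite pl ?Dp' // scalerA -ql // bl.
apply: (frac_inj_mor jP); rewrite pr ?Hp'; last by split=> //; exists u.
exact: gE.
Qed.

Lemma pair_value_ract q pq p b : represents iota q pq -> pair_value j p b ->
  exists2 p', is_pair_ract p pq p' & pair_value j p' (b :*r q).
Proof.
move=> [ql qr] [bl br].
have fE x (s : seq (M * R)) : cp_D p x -> (forall mz, mz \in s -> cp_D pq mz.2)
  ->
    cp_f p x = \sum_(mz <- s) mz.1 :*r mz.2 ->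
    iota x *: (b :*r q) = j (\sum_(mz <- s) mz.1 :*r (cp_f pq mz.2 : R)).
  move=> Dx sD xE; rewrite -scale_rscale -bl // xE !(morph_add_sum (fracD jP)).
  rewrite rscale_suml big_seq [RHS]big_seq; apply: eq_bigr => mz mzs.
  by rewrite !(fracR jP) rscalerA -ql //; apply: sD.
have [[D0 DD DZ] [s [Ds Ss]]] := cp_DP p.
have [[H0 HD HZ] [h [Hh Sh]]] := cp_HP p.
have [[D0' DD' DZ'] [s' [Ds' Ss']]] := cp_DP pq.
have [[H0' HD' HZ'] [h' [Hh' Sh']]] := cp_HP pq.
have f0 : cp_f p 0 = 0.
  by rewrite -[X in cp_f _ X](mul0r (0 : R)) cp_fZ // scale0r.
have g0 : cp_g pq 0 = 0.
  by rewrite -[X in cp_g _ X](mul0r (0 : R)) cp_gZ // rscaler0.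
have [||||p' [Dp' Hp' [pl pr]]] := @pair_of_value (b :*r q)
  [set x | cp_D p x /\ exists s : seq (M * R),
     (forall mz, mz \in s -> cp_D pq mz.2) /\
     cp_f p x = \sum_(mz <- s) mz.1 :*r mz.2]
  [set y | cp_H pq y /\ cp_H p (cp_g pq y)].
- split.
    split=> /= [|x y [Hx [u [uH uE]]] [Hy [v [vH vE]]]|r x [Hx [u [uH uE]]]].
    + by split=> //; exists [::]; rewrite big_nil.
    + split; first exact: DD.
      exists (u ++ v); split; last by rewrite big_cat cp_fD // uE vE.
      by move=> zm; rewrite mem_cat => /orP[/uH|/vH].
    + split; first exact: DZ.
      exists [seq (r *: mz.1, mz.2) | mz <- u]; split.
        by move=> _ /mapP[zm /uH zmH ->].
      rewrite cp_fZ // uE scaler_sumr big_map; apply: eq_bigr => mz _ /=.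
      by rewrite scale_rscale.
  have [m' [t [St e]]] := frac_left_ore QP jP (cp_f p s) Ss'.
  exists (t * s); split; last exact: (ore_mul SP).
  split; first exact: DZ.
  exists [:: (m', s')]; rewrite big_seq1 cp_fZ //; split=> // mz.
  by rewrite inE => /eqP->.
- split.
    split=> /= [|x y [Hx Hx'] [Hy Hy']|x r [Hx Hx']].
    + by rewrite g0.
    + by rewrite cp_gD //; split; [apply: HD'|apply: HD].
    + by rewrite cp_gZ //; split; [apply: HZ'|apply: HZ].
  have [a [t [St e]]] := ore_right SP (cp_g pq h' : R) Sh.
  exists (h' * t); split; last exact: (ore_mul SP).
  split; first exact: HZ'.
  rewrite cp_gZ //; have -> : cp_g pq h' :*r t = h * a :> R^o by exact: e.
  exact: HZ.
- move=> x [Hx [u [uH uE]]].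
  by exists (\sum_(mz <- u) mz.1 :*r (cp_f pq mz.2 : R)); apply: fE.
- move=> y [Hy Hy']; exists (cp_g p (cp_g pq y)).
  by rewrite rscalerA -qr // br.
exists p' => //; split=> // [x u Hx [uH uE]|y].
  apply: (frac_inj_mor jP); rewrite pl ?Dp'; last by split=> //; exists u.
  exact: fE.
rewrite Hp' => -[Hy Hy']; apply: (frac_inj_mor jP).
by rewrite pr ?Hp' // rscalerA -qr // br.
Qed.

End PairValue.

Lemma frac_localization (M : bimodType R R) (B : bimodType Q Q) (j : M -> B) :
  is_frac S iota j -> exists cls : compatible_pair S M -> B,
    is_localization iota cls /\ forall m, cls (canonical_pair SP m) = j m.
Proof.
move=> jP; have [cls clsP] := boolp.choice (pair_value_exists jP).
exists cls; split; last first.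
  by move=> m; apply: (pair_value_uniq (clsP _)); apply: canonical_pair_value.
split.
- move=> b; have [p pb] := pair_of jP b; exists p.
  exact: pair_value_uniq (clsP p) pb.
- by move=> p p'; apply: (pair_equiv_value jP (clsP p) (clsP p')).
- move=> p p'; have [pp ppA ppV] := pair_value_add jP (clsP p) (clsP p').
  by exists pp => //; apply: pair_value_uniq (clsP pp) ppV.
- move=> q; have [p [pl pr]] := pair_of (frac_ring QP) (q : Q^o).
  by exists p; split=> x; [apply: pl|apply: pr].
- move=> q pq p pqP; have [p' p'L p'V] := pair_value_lact jP pqP (clsP p).
  by exists p' => //; apply: pair_value_uniq (clsP p') p'V.
- move=> p q pq pqP; have [p' p'L p'V] := pair_value_ract jP pqP (clsP p).
  by exists p' => //; apply: pair_value_uniq (clsP p') p'V.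
Qed.

(** Both bimodules are made of classes of the same pairs. The descriptions of sums and products fix
    domains and values, so the pairs supplied by the two localizations for one operation are
    equivalent. *)
Lemma localization_uniq (M : bimodType R R) (B B' : bimodType Q Q)
    (cls : compatible_pair S M -> B) (cls' : compatible_pair S M -> B') :
  is_localization iota cls -> is_localization iota cls' ->
  exists2 F : B -> B', bimod_isom F & forall p, F (cls p) = cls' p.
Proof.
move=> L L'; have [P PK] := boolp.choice (loc_surj L).
pose F b := cls' (P b).
have FE p : F (cls p) = cls' p by apply/(loc_eq L')/(loc_eq L).
have FD : {morph F : x y / x + y}.
  move=> x y; have [p <-] := loc_surj L x; have [p' <-] := loc_surj L y.
  have [pp [D1 f1 H1 g1] <-] := loc_add L p p'.
  have [pp' [D2 f2 H2 g2] e] := loc_add L' p p'.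
  rewrite !FE -e; apply/(loc_eq L')/pair_equiv_eq; rewrite ?D1 ?H1 // => x' x'D.
    by rewrite f1 ?f2 ?D1 ?D2.
  by rewrite g1 ?g2 ?H1 ?H2.
exists F => //; split.
- split=> // q x; have [p <-] := loc_surj L x.
  have [pq pqP] := loc_represents L q.
  have [p1 [D1 f1 H1 g1] <-] := loc_lact L p pqP.
  have [p2 [D2 f2 H2 g2] e] := loc_lact L' p pqP.
  rewrite !FE -e; apply/(loc_eq L')/pair_equiv_eq; rewrite ?D1 ?H1 // => y yD.
    by rewrite f1 ?f2 ?D1 ?D2.
  by have [Hy [s sP]] := yD; rewrite (g1 y s) // (g2 y s).
- split=> // x q; have [p <-] := loc_surj L x.
  have [pq pqP] := loc_represents L q.
  have [p1 [D1 f1 H1 g1] <-] := loc_ract L p pqP.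
  have [p2 [D2 f2 H2 g2] e] := loc_ract L' p pqP.
  rewrite !FE -e; apply/(loc_eq L')/pair_equiv_eq; rewrite ?D1 ?H1 // => y yD.
    by have [Hy [s sP]] := yD; rewrite (f1 y s) // (f2 y s).
  by rewrite g1 ?g2 ?H1 ?H2.
- apply: inj_surj_bij => [x y|y].
    have [p <-] := loc_surj L x; have [p' <-] := loc_surj L y.
    by rewrite !FE => /(loc_eq L')/(loc_eq L).
  by have [p <-] := loc_surj L' y; exists (cls p).
Qed.

Lemma filter_bimod_frac (M : bimodType R R) : filter_bimod S M ->
  exists (B : bimodType Q Q) (j : M -> B), is_frac S iota j.
Proof.
move=> MF; have [N [al [be [ctx Mo No]]]] := filter_bimod_context SP MF.
exact: (frac_exists SP QP ctx Mo No).
Qed.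

(** The given localization is compared with the one constructed from a bimodule of fractions, and
    the properties are transported along that isomorphism. *)
Lemma localization_frac (M : bimodType R R) (B : bimodType Q Q)
    (cls : compatible_pair S M -> B) :
  filter_bimod S M -> is_localization iota cls ->
  is_frac S iota (fun m => cls (canonical_pair SP m)).
Proof.
move=> MF L; have [B0 [j0 jP0]] := filter_bimod_frac MF.
have [cls0 [L0 cls0E]] := frac_localization jP0.
have [F FP FE] := localization_uniq L0 L.
have -> : (fun m => cls (canonical_pair SP m)) = F \o j0.
  by apply: funext => m /=; rewrite -FE cls0E.
exact: isom_comp_frac FP jP0.
Qed.

(** Computes the last map from any bimodule of fractions at hand; its multiplicativity and its
    kernel are both read off from this. *)
Lemma loc_classE (M : bimodType R R) (B : bimodType Q Q) (j : M -> B) :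
  filter_bimod S M -> is_frac S iota j ->
  loc_class S iota (iso_class M) = iso_class B.
Proof.
move=> MF jP; apply: funext => C; apply: propext; split.
  move=> [M' [cls [MM' L]]]; have [f fP] := MM'.
  have MF' : filter_bimod S M'.
    by apply: (filter_bimod_iso SP) MF.
  have [F FP _] := frac_uniq SP QP jP
    (frac_comp_isom fP (localization_frac MF' L)).
  by exists F.
move=> [F FP]; have [cls [L _]] := frac_localization (isom_comp_frac FP jP).
by exists M, cls; split=> //; apply: bimod_iso_refl.
Qed.

Lemma loc_class_hom :
  is_group_hom (Pic_filters S) (Pic_mul R) (Pic Q) (Pic_mul Q)
    (loc_class S iota).
Proof.
rewrite (Pic_filtersE S); split=> [_ [M MF ->]|_ _ [M MF ->] [N NF ->]].
  have [B [j jP]] := filter_bimod_frac MF.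
  have [MI _ _] := MF; have [N [MN /bimod_iso_sym NM]] := MI.
  have NF := filter_bimod_inv SP MF MN NM.
  have [C [k kP]] := filter_bimod_frac NF.
  rewrite (loc_classE MF jP); exists B => //.
  (* [B' (x) C'] is a bimodule of fractions of [M' (x) N'], hence of [R], and so is [Q]; uniqueness
     identifies them. *)
  have inv (M' N' : bimodType R R) (B' C' : bimodType Q Q) (j' : M' -> B')
      (k' : N' -> C') : is_frac S iota j' -> is_frac S iota k' ->
      bimod_iso (tensor M' N') R^o -> bimod_iso (tensor N' M') R^o ->
      bimod_iso (tensor B' C') Q^o.
    move=> jP' kP' i i'; have [al [be ctx]] := iso_context i i'.
    have [f fP] := bimod_iso_sym i.
    have [F FP _] := frac_uniq SP QP
      (frac_comp_isom fP (frac_tensP SP QP (context_sym ctx) jP' kP'))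
        (frac_ring QP).
    by exists F.
  by apply: (@invertible_inv _ _ C);
    [apply: inv jP kP _ _|apply: inv kP jP _ _].
have [B [j jP]] := filter_bimod_frac MF;
  have [C [k kP]] := filter_bimod_frac NF.
have [M' [MM' /bimod_iso_sym M'M]] : invertible_bimod N by case: NF.
have [al [be ctx]] : exists (al : N -> M' -> R) (be : M' -> N -> R), context al
  be.
  exact: iso_context.
rewrite Pic_mulE (loc_classE MF jP) (loc_classE NF kP) Pic_mulE.
exact: loc_classE (filter_bimod_tensor SP MF NF) (frac_tensP SP QP ctx jP kP).
Qed.

End Localization.

(** * Subbimodules of the ring of fractions *)

Lemma central_units_group (A : pzRingType) : is_group (@central_units A) *%R 1.
Proof.
split.
- move=> x y [xC [x' [xx' x'x]]] [yC [y' [yy' y'y]]]; split.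
    by move=> z; rewrite -mulrA yC mulrA xC mulrA.
  exists (y' * x'); split.
    by rewrite mulrA -[x * y * y']mulrA yy' mulr1.
  by rewrite mulrA -[y' * x' * x]mulrA x'x mulr1.
- by move=> x y z _ _ _; apply: mulrA.
- by split=> [y|]; [rewrite mul1r mulr1|exists 1; rewrite mul1r].
- by move=> x _; rewrite mul1r mulr1.
- move=> x [xC [y [xy yx]]]; exists y => //; split; last by exists x.
  by move=> z; rewrite -[z in LHS]mulr1 -xy !mulrA -[y * z * x]mulrA -xC mulrA
    yx
    mul1r.
Qed.

Section SetProducts.
Variables (R Q : pzRingType) (iota : {rmorphism R -> Q}).
Implicit Types M N P : set Q.
Local Notation sub := (subbimodule iota).

Lemma set_prod0 M N : set_prod M N 0.
Proof. by exists [::] => //; rewrite big_nil. Qed.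

Lemma set_prodD M N x y : set_prod M N x -> set_prod M N y ->
  set_prod M N (x + y).
Proof.
move=> [s sP ->] [t tP ->]; exists (s ++ t); last by rewrite big_cat.
by move=> p; rewrite mem_cat => /orP[/sP|/tP].
Qed.

Lemma set_prod_mul M N x y : M x -> N y -> set_prod M N (x * y).
Proof.
move=> Mx Ny; exists [:: (x, y)]; last by rewrite big_seq1.
by move=> p; rewrite inE => /eqP->.
Qed.

Lemma set_prod_ind M N (P : Q -> Prop) :
  P 0 -> (forall x y, P x -> P y -> P (x + y)) ->
  (forall x y, M x -> N y -> P (x * y)) -> forall z, set_prod M N z -> P z.
Proof.
move=> P0 PD PM z [s sP ->]; rewrite big_seq; elim/big_ind: _ => // p ps.
by have [] := sP p ps; apply: PM.
Qed.

Lemma set_prodA M N P :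
  set_prod M (set_prod N P) = set_prod (set_prod M N) P.
Proof.
apply/seteqP; split; apply: set_prod_ind => [|x y|x y].
- exact: set_prod0.
- exact: set_prodD.
- move=> Mx; move: y; apply: set_prod_ind => [|y z Py Pz|y z Ny Pz].
  + by rewrite mulr0; apply: set_prod0.
  + by rewrite mulrDr; apply: set_prodD.
  + by rewrite mulrA; apply: set_prod_mul => //; apply: set_prod_mul.
- exact: set_prod0.
- exact: set_prodD.
- move=> MNx Py; move: x MNx; apply: set_prod_ind => [|x z Px Pz|x z Mx Nz].
  + by rewrite mul0r; apply: set_prod0.
  + by rewrite mulrDl; apply: set_prodD.
  + by rewrite -mulrA; apply: set_prod_mul => //; apply: set_prod_mul.
Qed.

Lemma subbimodule_range : sub (range iota).
Proof.
split.
- by exists 0; rewrite ?rmorph0.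
- by move=> _ _ [a _ <-] [b _ <-]; exists (a + b); rewrite ?rmorphD.
- by move=> a _ [b _ <-]; exists (a * b); rewrite ?rmorphM.
- by move=> _ a [b _ <-]; exists (b * a); rewrite ?rmorphM.
Qed.

Lemma subbimodule_prod M N : sub M -> sub N -> sub (set_prod M N).
Proof.
move=> [_ _ Ml _] [_ _ _ Nr]; split.
- exact: set_prod0.
- exact: set_prodD.
- move=> r; apply: set_prod_ind => [|x y Px Py|x y Mx Ny].
  + by rewrite mulr0; apply: set_prod0.
  + by rewrite mulrDr; apply: set_prodD.
  + by rewrite mulrA; apply: set_prod_mul => //; apply: Ml.
- move=> x r; move: x; apply: set_prod_ind => [|x y Px Py|x y Mx Ny].
  + by rewrite mul0r; apply: set_prod0.
  + by rewrite mulrDl; apply: set_prodD.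
  + by rewrite -mulrA; apply: set_prod_mul => //; apply: Nr.
Qed.

Lemma subbimodule_inv M : sub M -> sub (set_inv iota M).
Proof.
have [R0 RD Rl Rr] := subbimodule_range; move=> [_ _ Ml Mr]; split.
- by move=> m _; rewrite mul0r mulr0.
- move=> x y xP yP m Mm; rewrite mulrDl mulrDr.
  by have [? ?] := xP m Mm; have [? ?] := yP m Mm; split; apply: RD.
- move=> r x xP m Mm; have [? _] := xP m Mm; have [_ ?] := xP _ (Mr _ r Mm).
  by split; [rewrite -mulrA; apply: Rl|rewrite mulrA].
- move=> x r xP m Mm; have [_ ?] := xP m Mm; have [? _] := xP _ (Ml r _ Mm).
  by split; [rewrite -mulrA|rewrite mulrA; apply: Rr].
Qed.

Lemma set_prod1r M : sub M -> set_prod M (range iota) = M.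
Proof.
move=> [M0 MD _ Mr]; apply/seteqP; split.
  by apply: set_prod_ind => // x _ Mx [r _ <-]; apply: Mr.
by move=> x Mx; rewrite -[x]mulr1 -(rmorph1 iota); apply: set_prod_mul => //;
  exists 1.
Qed.

Lemma set_prod1l M : sub M -> set_prod (range iota) M = M.
Proof.
move=> [M0 MD Ml _]; apply/seteqP; split.
  by apply: set_prod_ind => // _ x [r _ <-] Mx; apply: Ml.
by move=> x Mx; rewrite -[x]mul1r -(rmorph1 iota); apply: set_prod_mul => //;
  exists 1.
Qed.

Lemma range1 : range iota 1.
Proof. by exists 1; rewrite ?rmorph1. Qed.

(** Both products lie in the image of [R] by the definition of [set_inv], and they are subbimodules,
    so equality amounts to containing 1. *)
Lemma Pic_relP M : Pic_rel iota M <->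
  [/\ sub M, set_prod M (set_inv iota M) 1 & set_prod (set_inv iota M) M 1].
Proof.
have [R0 RD Rl Rr] := subbimodule_range.
split=> [[MP -> ->]|[MP M1 M1']]; first by split=> //; apply: range1.
have NP := subbimodule_inv MP.
have [_ _ Il _] := subbimodule_prod MP NP.
have [_ _ Il' _] := subbimodule_prod NP MP.
split=> //; apply/seteqP; split.
- by apply: set_prod_ind => // x y Mx /(_ x Mx)[].
- by move=> _ [r _ <-]; rewrite -[iota r]mulr1; apply: Il.
- by apply: set_prod_ind => // y x yP Mx; have [] := yP x Mx.
- by move=> _ [r _ <-]; rewrite -[iota r]mulr1; apply: Il'.
Qed.

Lemma set_inv_mul M N x y : sub M -> sub N -> set_inv iota N x ->
  set_inv iota M y -> set_inv iota (set_prod M N) (x * y).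
Proof.
have [R0 RD _ _] := subbimodule_range.
move=> [_ _ _ Mr] [_ _ Nl _] xN yM; apply: set_prod_ind => [|z w|m n Mm Nn].
- by rewrite mul0r mulr0.
- by move=> [? ?] [? ?]; rewrite mulrDl mulrDr; split; apply: RD.
- split.
    have [[r _ e] _] := yM m Mm; rewrite -mulrA [y * _]mulrA -e.
    by have [] := xN _ (Nl r _ Nn).
  have [_ [r _ e]] := xN n Nn; rewrite mulrA -[m * n * x]mulrA -e.
  by have [] := yM _ (Mr _ r Mm).
Qed.

(** [M (N N') M'] contains [M M'] as soon as [N N'] contains [1]. *)
Lemma set_prod_sandwich M N N' M' (K L : set Q) z : set_prod N N' 1 ->
  (forall x y, M x -> N y -> K (x * y)) ->
  (forall x y, N' x -> M' y -> L (x * y)) ->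
  set_prod M M' z -> set_prod K L z.
Proof.
move=> N1 MN NM; move: z; apply: set_prod_ind => [|x y|m m' Mm Mm'].
- exact: set_prod0.
- exact: set_prodD.
- suff /(_ 1 N1) : forall w, set_prod N N' w -> set_prod K L (m * w * m').
    by rewrite mulr1.
  apply: set_prod_ind => [|x y|n n' Nn Nn'].
  + by rewrite mulr0 mul0r; apply: set_prod0.
  + by rewrite mulrDr mulrDl; apply: set_prodD.
  + by rewrite mulrA -mulrA; apply: set_prod_mul; [apply: MN|apply: NM].
Qed.

Lemma Pic_rel_prod M N : Pic_rel iota M -> Pic_rel iota N ->
  Pic_rel iota (set_prod M N).
Proof.
move=> /Pic_relP[MP M1 M1'] /Pic_relP[NP N1 N1']; apply/Pic_relP; split.
- exact: subbimodule_prod.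
- apply: set_prod_sandwich N1 _ _ M1 => [x y|x y]; first exact: set_prod_mul.
  exact: set_inv_mul.
- apply: set_prod_sandwich M1' _ _ N1' => [x y|x y]; last exact: set_prod_mul.
  exact: set_inv_mul.
Qed.

Lemma Pic_rel_inv M : Pic_rel iota M -> Pic_rel iota (set_inv iota M).
Proof.
move=> /Pic_relP[MP M1 M1']; apply/Pic_relP.
have MI : M `<=` set_inv iota (set_inv iota M).
  by move=> x Mx n nM; have [] := nM x Mx.
split; first exact: subbimodule_inv.
  by case: M1' => s sP s1; exists s => // p /sP[? ?]; split=> //; apply: MI.
by case: M1 => s sP s1; exists s => // p /sP[? ?]; split=> //; apply: MI.
Qed.

Lemma Pic_rel_group : is_group (Pic_rel iota) (@set_prod Q) (range iota).
Proof.
split.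
- exact: Pic_rel_prod.
- by move=> M N P _ _ _; apply: set_prodA.
- apply/Pic_relP; split; first exact: subbimodule_range.
    rewrite -[1]mulr1; apply: set_prod_mul; first exact: range1.
    by move=> m mR; rewrite mul1r mulr1.
  rewrite -[1]mulr1; apply: set_prod_mul; last exact: range1.
  by move=> m mR; rewrite mul1r mulr1.
- by move=> M [MP _ _]; rewrite set_prod1l ?set_prod1r.
- by move=> M MP; exists (set_inv iota M); [apply: Pic_rel_inv|case: MP].
Qed.

Lemma set_prod_sub_sum M N (MP : sub M) (NP : sub N) z : set_prod M N z ->
  exists s : seq (subbimod MP * subbimod NP),
    \sum_(p <- s) val p.1 * val p.2 = z.
Proof.
move: z; apply: set_prod_ind => [|x y [s <-] [t <-]|x y Mx Ny].
- by exists [::]; rewrite big_nil.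
- by exists (s ++ t); rewrite big_cat.
- by exists [:: (subbimod_in MP Mx, subbimod_in NP Ny)]; rewrite big_seq1.
Qed.

(** The carrier [subbimod MP] depends on the proof [MP]; proof irrelevance makes the choice
    immaterial. *)
Lemma class_ofE M (MP : sub M) : class_of iota M = iso_class (subbimod MP).
Proof.
apply: funext => B; apply: propext; split=> [[MP' i]|i]; last by exists MP.
by rewrite (Prop_irrelevance MP MP').
Qed.

End SetProducts.

(** * The maps of the sequence and exactness *)

Section Sequence.
Variables (R Q : pzRingType) (S : set R) (iota : {rmorphism R -> Q}).
Hypotheses (SP : regular_ore_set S) (QP : is_fraction_ring S iota).
Local Notation sub := (subbimodule iota).

(** Multiplication in [Q] provides both pairings, so the laws of a context become associativity and
    distributivity in [Q]. *)
Lemma Pic_rel_context (M : set Q) (MP : sub M) : Pic_rel iota M ->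
  let N := subbimod (subbimodule_inv MP) in
  exists (al : subbimod MP -> N -> R) (be : N -> subbimod MP -> R),
    [/\ context al be, forall m n, iota (al m n) = val m * val n
      & forall n m, iota (be n m) = val n * val m].
Proof.
move=> /Pic_relP[_ M1 M1'] N.
have [al alE] : exists al : subbimod MP * N -> R,
    forall p, iota (al p) = val p.1 * val p.2.
  suff /boolp.choice[al alE] : forall p : subbimod MP * N,
    exists r, iota r = val p.1 * val p.2 by exists al.
  move=> [m n]; have nM : set_inv iota M (val n) := subbimod_mem n.
  by have [_ [r _ e]] := nM (val m) (subbimod_mem m); exists r.
have [be beE] : exists be : N * subbimod MP -> R,
    forall p, iota (be p) = val p.1 * val p.2.
  suff /boolp.choice[be beE] : forall p : N * subbimod MP,
    exists r, iota r = val p.1 * val p.2 by exists be.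
  move=> [n m]; have nM : set_inv iota M (val n) := subbimod_mem n.
  by have [[r _ e] _] := nM (val m) (subbimod_mem m); exists r.
have iI := frac_inj QP.
exists (fun m n => al (m, n)), (fun n m => be (n, m)).
split=> [|m n|n m]; rewrite ?alE ?beE //; split.
- split=> [n x y|m x y|a m n|m n a|m a n]; apply: iI.
  + by rewrite rmorphD !alE; apply: mulrDl.
  + by rewrite rmorphD !alE; apply: mulrDr.
  + by rewrite rmorphM !alE; apply/esym/mulrA.
  + by rewrite rmorphM !alE; apply: mulrA.
  + by rewrite !alE; apply/esym/mulrA.
- split=> [n x y|m x y|a m n|m n a|m a n]; apply: iI.
  + by rewrite rmorphD !beE; apply: mulrDl.
  + by rewrite rmorphD !beE; apply: mulrDr.
  + by rewrite rmorphM !beE; apply/esym/mulrA.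
  + by rewrite rmorphM !beE; apply: mulrA.
  + by rewrite !beE; apply/esym/mulrA.
- move=> m n m'; apply: val_inj; rewrite /= -[LHS]/(iota _ * val m').
  by rewrite -[RHS]/(val m * iota _) alE beE mulrA.
- move=> n m n'; apply: val_inj; rewrite /= -[LHS]/(iota _ * val n').
  by rewrite -[RHS]/(val n * iota _) alE beE mulrA.
- have [s s1] := set_prod_sub_sum MP (subbimodule_inv MP) M1.
  exists s; apply: iI; rewrite rmorph_sum rmorph1 -s1.
  by apply: eq_bigr => -[m n] _; rewrite alE.
- have [s s1] := set_prod_sub_sum (subbimodule_inv MP) MP M1'.
  exists s; apply: iI; rewrite rmorph_sum rmorph1 -s1.
  by apply: eq_bigr => -[m n] _; rewrite beE.
Qed.

(** Write 1 as a sum of products [m n] with [n] in [M^-1]. A common right multiple of the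
    denominators of the [n] brings every term into [M]. *)
Lemma Pic_rel_meets (M : set Q) : Pic_rel iota M ->
  exists2 s, S s & M (iota s).
Proof.
move=> /Pic_relP[[M0 MD _ Mr] M1 _].
suff /(_ 1 M1)[s Ss] : forall z, set_prod M (set_inv iota M) z ->
    exists2 s, S s & M (z * iota s) by rewrite mul1r; exists s.
apply: set_prod_ind => [|x y [s Ss xs] [t St yt]|m n Mm nM].
- by exists 1; [apply: (ore_one SP)|rewrite mul0r].
- have [a [b [Sa e]]] := common_right_multiple SP Ss St.
  exists (s * a) => //; rewrite mulrDl {2}e !rmorphM !mulrA.
  by apply: MD; apply: Mr.
- have [r [s [Ss e]]] := frac_num_right QP n; exists s => //.
  by rewrite -mulrA e; apply: Mr.
Qed.

Lemma Pic_rel_frac (M : set Q) (MP : sub M) : Pic_rel iota M ->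
  is_frac S iota (val : subbimod MP -> Q^o).
Proof.
move=> /Pic_rel_meets[u Su Mu]; have [_ _ Ml Mr] := MP; split=> //.
- by move=> m m0; apply: val_inj.
- move=> q; have [r [s [Ss e]]] := frac_num_left QP q.
  exists (u * s), (subbimod_in MP (Mr _ r Mu)); split;
    first exact: (ore_mul SP).
  by rewrite rmorphM -scalerA; congr (_ * _).
- move=> q; have [r [s [Ss e]]] := frac_num_right QP q.
  exists (s * u), (subbimod_in MP (Ml r _ Mu)); split;
    first exact: (ore_mul SP).
  by rewrite rmorphM -rscalerA; congr (_ * _).
Qed.

Lemma Pic_rel_ore (M : set Q) (MP : sub M) : Pic_rel iota M ->
  ore_bimod S (subbimod MP : bimodType R R).
Proof.
move=> /(Pic_rel_frac MP) jP.
by split; [exact: (frac_right_ore QP jP)|exact: (frac_left_ore QP jP)].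
Qed.

Lemma Pic_rel_filter (M : set Q) (MP : sub M) : Pic_rel iota M ->
  filter_bimod S (subbimod MP : bimodType R R).
Proof.
move=> MR; have [al [be [ctx _ _]]] := Pic_rel_context MP MR.
apply/(context_filter_bimod SP ctx).
by split; apply: Pic_rel_ore => //; apply: Pic_rel_inv.
Qed.

(** The multiplication map is injective because contraction against [p] in [N^-1] is right
    multiplication by [p] in [Q]: a tensor with product 0 has only zero contractions. *)
Lemma class_of_prod (M N : set Q) (MP : sub M) (NP : sub N) (MNP : sub
  (set_prod M N)) :
  Pic_rel iota N ->
  bimod_iso (tensor (subbimod MP) (subbimod NP)) (subbimod MNP).
Proof.
move=> NR; have [al [be [ctx alE _]]] := Pic_rel_context NP NR.
have memP (m : subbimod MP) (n : subbimod NP) : set_prod M N (val m * val n).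
  by apply: set_prod_mul; apply: subbimod_mem.
pose f (m : subbimod MP) (n : subbimod NP) : subbimod MNP :=
  subbimod_in MNP (memP m n).
have fP : balanced f.
  split=> [n x y|m x y|m a n]; apply: val_inj.
  - exact: mulrDl.
  - exact: mulrDr.
  - exact/esym/mulrA.
have FD := tens_mapD fP.
have Fr p (z : tensor (subbimod MP) (subbimod NP)) :
    val (rcontract al p z) = val (tens_map f z) * val p.
  elim/tensor_ind: z => [|z w zE wE|m n].
  - by rewrite (morph_add0 (rcontractD ctx p)) (morph_add0 FD) mul0r.
  - rewrite (rcontractD ctx) FD -[LHS]/(val (rcontract al p z) + val _) zE wE.
    exact/esym/mulrDl.
  - rewrite (rcontractE ctx) (tens_mapE fP) -[LHS]/(val m * iota (al n p)) alE.
    exact: mulrA.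
exists (tens_map f); split.
- split=> //; apply: (tens_map_scale fP) => a m n; apply: val_inj.
  exact/esym/mulrA.
- split=> //; apply: (tens_map_rscale fP) => m n a; apply: val_inj.
  exact: mulrA.
apply: inj_surj_bij.
  apply: morph_add_inj FD _ => z z0; apply: (rcontract_eq0 ctx) => p.
  by apply: val_inj; rewrite Fr z0; apply: mul0r.
move=> y; have [s sE] := set_prod_sub_sum MP NP (subbimod_mem y).
exists (\sum_(p <- s) tens p.1 p.2); apply: val_inj.
rewrite (morph_add_sum FD) (@morph_add_sum _ _ (val : subbimod MNP -> Q)) //
  -sE.
by apply: eq_bigr => p _; rewrite (tens_mapE fP).
Qed.

Lemma commute_central x : (forall r, iota r * x = x * iota r) ->
  forall q, x * q = q * x.
Proof.
move=> xr q; have [r [s [Ss e]]] := frac_num_right QP q.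
apply: (@frac_rcancel _ _ _ _ QP Q^o s) => //.
have -> : (x * q : Q^o) :*r iota s = x * (q * iota s) by apply/esym/mulrA.
by rewrite e -xr -e -mulrA xr; apply: mulrA.
Qed.

Lemma central_units_hom :
  is_group_hom (@central_units R) *%R (@central_units Q) *%R iota.
Proof.
split=> [x [xC [y [xy yx]]]|x y _ _]; last exact: rmorphM.
split; first by apply: commute_central => r; rewrite -!rmorphM xC.
by exists (iota y); rewrite -!rmorphM xy yx rmorph1.
Qed.

Lemma principal_sub x : (forall q, x * q = q * x) -> sub (principal iota x).
Proof.
move=> xC; split.
- by exists 0; rewrite // rmorph0 mulr0.
- by move=> _ _ [a _ <-] [b _ <-]; exists (a + b); rewrite // rmorphD mulrDr.
- by move=> r _ [a _ <-]; exists (r * a); rewrite // rmorphM !mulrA xC.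
- by move=> _ r [a _ <-]; exists (a * r); rewrite // rmorphM mulrA.
Qed.

Lemma principal_gen x : principal iota x x.
Proof. by exists 1; rewrite // rmorph1 mulr1. Qed.

Lemma principal_hom :
  is_group_hom (@central_units Q) *%R (Pic_rel iota) (@set_prod Q)
    (principal iota).
Proof.
split=> [x [xC [y [xy yx]]]|x y [xC _] [yC _]].
  have yP : set_inv iota (principal iota x) y.
    move=> _ [r _ <-]; rewrite mulrA yx mul1r; split; exists r => //.
    by rewrite xC -mulrA xy mulr1.
  have xP := principal_gen x.
  apply/Pic_relP; split; first exact: principal_sub.
    by rewrite -xy; apply: set_prod_mul.
  by rewrite -yx; apply: set_prod_mul.
apply/seteqP; split.
  move=> _ [r _ <-]; rewrite -mulrA.
  by apply: set_prod_mul; [apply: principal_gen|exists r].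
apply: set_prod_ind => [|z w|_ _ [r _ <-] [t _ <-]].
- by exists 0; rewrite // rmorph0 mulr0.
- by move=> [a _ <-] [b _ <-]; exists (a + b); rewrite // rmorphD mulrDr.
- exists (r * t) => //; rewrite rmorphM !mulrA; congr (_ * _).
  by rewrite -!mulrA yC.
Qed.

Lemma class_of_hom :
  is_group_hom (Pic_rel iota) (@set_prod Q)
    (Pic_filters S) (Pic_mul R) (class_of iota).
Proof.
split=> [M MR|M N MR NR].
  have [MP _ _] := MR; rewrite (class_ofE MP) Pic_filtersE.
  by exists (subbimod MP) => //; apply: Pic_rel_filter.
have [MP _ _] := MR; have [NP _ _] := NR; have [MNP _ _] := Pic_rel_prod MR NR.
rewrite (class_ofE MP) (class_ofE NP) (class_ofE MNP) Pic_mulE.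
exact/iso_classP/bimod_iso_sym/class_of_prod.
Qed.

Lemma exact_at_units :
  exact_at [set (1 : R)] id (@central_units R) iota 1.
Proof.
move=> y; split=> [[_ y1]|[_ -> <-]].
  by exists 1 => //; apply: (frac_inj QP); rewrite y1 rmorph1.
split; last exact: rmorph1.
exact: group_one (central_units_group R).
Qed.

Lemma exact_at_fraction_units :
  exact_at (@central_units R) iota
    (@central_units Q) (principal iota) (range iota).
Proof.
have iI := frac_inj QP; have [homU _] := central_units_hom.
move=> x; split=> [[[xC [y [xy yx]]] xR]|[r [rC [r' [rr' r'r]]] <-]].
  have [r _ rE] : range iota x by rewrite -xR; apply: principal_gen.
  (* That 1 lies in [xR] says that the inverse of [x] already lies in [R]. *)
  have [r' _ r'E] : principal iota x 1 by rewrite xR; apply: range1.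
  exists r => //; split.
    by move=> t; apply: iI; rewrite !rmorphM rE xC.
  have r'x : iota r' * x = 1 by rewrite -xC.
  by exists r'; split; apply: iI; rewrite rmorphM rE rmorph1.
split; first by apply: homU; split=> //; exists r'.
apply/seteqP; split=> _ [t _ <-]; first by exists (r * t); rewrite // rmorphM.
by exists (r' * t); rewrite // -rmorphM mulrA rr' mul1r.
Qed.

Lemma exact_at_Pic_rel :
  exact_at (@central_units Q) (principal iota)
    (Pic_rel iota) (class_of iota) (Pic_one R).
Proof.
move=> M; split=> [[MR]|[x xU <-]].
  have [MP _ _] := MR; rewrite (class_ofE MP) => /iso_classP/bimod_iso_sym.
  move=> [f [[fD fl] [_ fr] [g fK gK]]].
  (* Two-sided linearity gives [f(r) = r x = x r], so the image [x] of 1 generates [M] and commutes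
     with [R], hence with all fractions. *)
  pose x : Q := val (f 1).
  have fL r : val (f r) = iota r * x.
    by rewrite -[LHS]/(val (f r)) -[r in LHS]mulr1;
      apply: (congr1 val (fl r 1)).
  have fR r : val (f r) = x * iota r.
    by rewrite -[r in LHS]mul1r; apply: (congr1 val (fr 1 r)).
  have xC : forall q, x * q = q * x.
    by apply: commute_central => r; rewrite -fL fR.
  exists x.
    split=> //; have /Pic_relP[_ M1 _] := MR.
    (* Invertibility of [x] comes from 1 being in [M M^-1], which is contained in [xQ] because every
       element of [M] is a multiple of [x]. *)
    suff /(_ 1 M1)[w w1] : forall z, set_prod M (set_inv iota M) z ->
      exists w, z = x * w by exists w; rewrite -xC -w1.
    apply: set_prod_ind => [|z w [a ->] [b ->]|m n Mm _].
    - by exists 0; rewrite mulr0.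
    - by exists (a + b); rewrite mulrDr.
    - exists (iota (g (subbimod_in MP Mm)) * n).
      by rewrite mulrA -fR gK.
  apply/seteqP; split=> [_ [r _ <-]|m Mm]; first by rewrite -fR;
    apply: subbimod_mem.
  by exists (g (subbimod_in MP Mm)); rewrite // -fR gK.
have MR := (proj1 principal_hom) x xU; have [xC [y [xy yx]]] := xU.
split=> //; have [MP _ _] := MR; rewrite (class_ofE MP).
apply/iso_classP/bimod_iso_sym.
have mem r : principal iota x (x * iota r) by exists r.
exists (fun r : R^o => subbimod_in MP (mem r)); split.
- split=> [r t|a r]; apply: val_inj => /=; first by rewrite rmorphD mulrDr.
  by rewrite rmorphM !mulrA -(xC (iota a)).
- split=> [r t|r a]; apply: val_inj => /=; first by rewrite rmorphD mulrDr.
  by rewrite rmorphM mulrA.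
- apply: inj_surj_bij => [r t /(congr1 val) /= e|m].
    by apply: (frac_inj QP); rewrite -[iota r]mul1r -yx -mulrA e mulrA yx mul1r.
  have [r _ e] := subbimod_mem m; exists r; exact: val_inj.
Qed.

(** If [M] localizes to [Q], then [M] embeds in [Q] by some [j], and every
    functional [al(-, n)] on [M] is right multiplication by an element of
    [j(M)^-1]. *)
Lemma exact_at_Pic_filters :
  exact_at (Pic_rel iota) (class_of iota)
    (Pic_filters S) (loc_class S iota) (Pic_one Q).
Proof.
move=> C; rewrite (Pic_filtersE S); split=> [[[M MF ->]]|[M MR <-]]; last first.
  have [MP _ _] := MR; rewrite (class_ofE MP).
  have MF := Pic_rel_filter MP MR.
  split; first by exists (subbimod MP).
  exact: (loc_classE SP QP MF (Pic_rel_frac MP MR)).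
have [B [j0 jP0]] := filter_bimod_frac SP QP MF.
rewrite (loc_classE SP QP MF jP0) => /iso_classP[h hP].
pose j : M -> Q := h \o j0.
have jP : is_frac S iota (j : M -> Q^o) by apply: isom_comp_frac hP jP0.
have [jD jZ jR] : [/\ {morph j : x y / x + y}, forall r m, j (r *: m) = iota r
  * j m
    & forall m r, j (m :*r r) = j m * iota r].
  by split; [apply: (fracD jP)|apply: (fracZ jP)|apply: (fracR jP)].
have MP : sub (range j).
  split.
  - by exists 0 => //; apply: (morph_add0 jD).
  - by move=> _ _ [m _ <-] [n _ <-]; exists (m + n).
  - by move=> r _ [m _ <-]; exists (r *: m); rewrite // jZ.
  - by move=> _ r [m _ <-]; exists (m :*r r); rewrite // jR.
have [N [al [be [ctx _ _]]]] := filter_bimod_context SP MF.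
have alP := ctx_pairl ctx.
have cP n : exists c : Q, forall m, iota (al m n) = j m * c.
  have [F [_ FZ] Fj] : exists2 F : Q^o -> Q^o, lmod_hom F &
      forall m, F (j m) = iota (al m n).
    apply: (frac_lextension SP QP jP (V := Q^o)) => [x y|r m].
      by rewrite (pairDl alP) rmorphD.
    by rewrite (pairZl alP) rmorphM.
  exists (F 1) => m; rewrite -Fj -[j m in LHS]mulr1; exact: FZ.
have [c cE] := boolp.choice cP.
have beE n m : iota (be n m) = c n * j m.
  (* A denominator of 1 is an [s] in [S] of the form [j m']. Multiplying by [j m'] on the left turns
     the claim into the associativity law [al m' n *: m = m' :*r be n m], and [s] cancels. *)
  have [s [m' [Ss sE]]] := frac_denl jP (1 : Q^o).
  have jm' : j m' = iota s by rewrite -[iota s]mulr1; apply: esym sE.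
  apply: (@frac_lcancel _ _ _ _ QP Q^o s) => //.
  rewrite -[LHS]/(iota s * _) -[RHS]/(iota s * _) -jm' mulrA -cE.
  by rewrite -jR -jZ (ctxAl ctx).
exists (range j); last first.
  rewrite (class_ofE MP); apply/iso_classP/bimod_iso_sym.
  have mem m : range j (j m) by exists m.
  exists (fun m => subbimod_in MP (mem m)); split.
  - split=> [x y|r m]; apply: val_inj; first exact: jD.
    exact: jZ.
  - split=> [x y|m r]; apply: val_inj; first exact: jD.
    exact: jR.
  - apply: inj_surj_bij => [m m' /(congr1 val)|m];
      first exact: (frac_inj_mor jP).
    have [m' _ e] := subbimod_mem m; exists m'; exact: val_inj.
have cI n : set_inv iota (range j) (c n).
  move=> _ [m _ <-]; rewrite -cE -beE.
  by split; [exists (be n m)|exists (al m n)].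
apply/Pic_relP; split=> //.
  have [s s1] := ctx1l ctx; rewrite -(rmorph1 iota) -s1 rmorph_sum.
  elim/big_ind: _ => [|x y|p _]; [exact: set_prod0|exact: set_prodD|].
  by rewrite cE; apply: set_prod_mul => //; exists p.1.
have [s s1] := ctx1r ctx; rewrite -(rmorph1 iota) -s1 rmorph_sum.
elim/big_ind: _ => [|x y|p _]; [exact: set_prod0|exact: set_prodD|].
by rewrite beE; apply: set_prod_mul => //; exists p.2.
Qed.

End Sequence.

Theorem corollary3p5 (R Q : pzRingType) (S : set R) (iota : {rmorphism R -> Q})
    (SP : regular_ore_set S) (QP : is_fraction_ring S iota) :
  (* the terms are groups *)
  [/\ is_group (@central_units R) *%R 1,
      is_group (@central_units Q) *%R 1,
      is_group (Pic_rel iota) (@set_prod Q) (range iota),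
      is_group (Pic_filters S) (Pic_mul R) (Pic_one R)
    & is_group (Pic Q) (Pic_mul Q) (Pic_one Q)] /\
  (* the maps are well-defined group homomorphisms *)
  [/\ is_group_hom (@central_units R) *%R (@central_units Q) *%R iota,
      is_group_hom (@central_units Q) *%R (Pic_rel iota) (@set_prod Q)
        (principal iota),
      is_group_hom (Pic_rel iota) (@set_prod Q)
        (Pic_filters S) (Pic_mul R) (class_of iota)
    & is_group_hom (Pic_filters S) (Pic_mul R)
        (Pic Q) (Pic_mul Q) (loc_class S iota)] /\
  (* exactness at each term *)
  [/\ exact_at [set (1 : R)] id (@central_units R) iota 1,
      exact_at (@central_units R) iota
        (@central_units Q) (principal iota) (range iota),
      exact_at (@central_units Q) (principal iota)
        (Pic_rel iota) (class_of iota) (Pic_one R)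
    & exact_at (Pic_rel iota) (class_of iota)
        (Pic_filters S) (loc_class S iota) (Pic_one Q)] /\
  (* the image of [M] under the last map is given by M (x) Q = Q (x) M *)
  (forall (M : bimodType R R) (B : bimodType Q Q) (cls : compatible_pair S M -> B),
     Pic_filters S (iso_class M) -> is_localization iota cls ->
     (exists phi : tensor M (resbimod iota idfun (Q^o : bimodType Q Q)) ->
                   resbimod iota idfun B,
        bimod_isom phi /\
        forall (m : M) (q : Q),
          phi (tens m (q : resbimod iota idfun (Q^o : bimodType Q Q))) =
            cls (canonical_pair SP m) :*r q) /\
     (exists psi : tensor (resbimod idfun iota (Q^o : bimodType Q Q)) M ->
                   resbimod idfun iota B,
        bimod_isom psi /\
        forall (q : Q) (m : M),
          psi (tens (q : resbimod idfun iota (Q^o : bimodType Q Q)) m) =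
            q *: cls (canonical_pair SP m))).
Proof.
split; first split.
- exact: central_units_group.
- exact: central_units_group.
- exact: Pic_rel_group.
- exact: Pic_filters_group.
- exact: Pic_group.
split; first split.
- exact: central_units_hom QP.
- exact: principal_hom.
- exact: class_of_hom SP QP.
- exact: loc_class_hom SP QP.
split; first split.
- exact: exact_at_units QP.
- exact: exact_at_fraction_units QP.
- exact: exact_at_Pic_rel QP.
- exact: exact_at_Pic_filters SP QP.
move=> M B cls /(Pic_filters_iso_class SP) MF L.
(* The canonical map into an arbitrary localization is itself a bimodule of fractions, so both
   multiplication maps are extensions of it by scalars; only linearity over [R] on the other side is
   left to check. *)
have jP := localization_frac SP QP MF L.
set j := fun m => cls (canonical_pair SP m) in jP.
split.
  exists (rextend j); split; last first.
    by move=> m q; exact: (rextendE (fracD jP) (fracR jP) q m).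
  have [FD FR] := rextend_hom (fracD jP) (fracR jP).
  split; last exact: (rextend_bij SP QP jP).
    split=> // r; apply: tensor_ext => [x y|x y|m q].
    - by rewrite scalerDr FD.
    - by rewrite FD scalerDr.
    - rewrite scale_tens !(rextendE (fracD jP) (fracR jP)) (fracZ jP).
      exact: scale_rscale.
  by split.
exists (lextend j); split; last exact: (lextendE (fracD jP) (fracZ jP)).
have [FD FZ] := lextend_hom (fracD jP) (fracZ jP).
split; last exact: (lextend_bij SP QP jP).
  by split.
split=> // z r; move: z; apply: tensor_ext => [x y|x y|q m].
- by rewrite rscalerDl FD.
- by rewrite FD rscalerDl.
- rewrite rscale_tens !(lextendE (fracD jP) (fracZ jP)) (fracR jP).
  exact/esym/scale_rscale.
Qed.
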